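(* Let $p\ge 7$ be a prime. Then the unique theta characteristic (up to isomorphism) on the modular curve $X(p)$ that is invariant under $\mathrm{Aut}(X(p))$ is even, i.e. if $L$ denotes this theta characteristic then $\dim_{\mathbb{C}} H^0(X(p),L)$ is even.
   Context: For a prime $p\ge 7$, $X(p)$ denotes the modular curve of level $p$, the compact Riemann surface obtained by compactifying the quotient $\Gamma(p)\backslash\mathbb{H}$ of the upper half plane by the principal congruence subgroup $\Gamma(p)\le \mathrm{SL}(2,\mathbb{Z})$ (by adding the cusps). Its full automorphism group is $\mathrm{PSL}(2,p)$; the quotient of $X(p)$ by this group is $\mathbb{P}^1$, branched over three points with isotropy groups of orders $2,3,p$. A theta characteristic on a Riemann surface $S$ is a (holomorphic) line bundle $L\to S$ with $L^{\otimes 2}\cong K_S$, where $K_S$ is the canonical bundle. Theta characteristics are considered up to isomorphism, and $L$ is invariant under $G\le \mathrm{Aut}(S)$ if $h^*L\cong L$ for every $h\in G$. It is known from earlier work that $X(p)$ has exactly one $\mathrm{Aut}(X(p))$-invariant theta characteristic for each prime $p\ge 7$. The parity of $L$ is $\dim_{\mathbb{C}} H^0(S,L)\bmod 2$; $L$ is even if this is $0$. *)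

(* Defs.v *)
From HB Require Import structures.
From mathcomp Require Import all_boot all_order all_algebra.
From mathcomp Require Import complex.
From mathcomp Require Import all_classical all_reals all_analysis.
From mathcomp Require Import ring.

Set Implicit Arguments.
Unset Strict Implicit.
Unset Printing Implicit Defensive.

Import Order.TTheory GRing.Theory Num.Theory.
Import numFieldNormedType.Exports.
Local Open Scope classical_set_scope.
Local Open Scope ring_scope.
Local Open Scope complex_scope.
Local Open Scope quotient_scope.

(** * Complex numbers *)

(* The alias has the structure type [numClosedFieldType] so that the topology
   and the normed-module structure over itself are inferred; thus
   [derivable f z 1] and ['D_1 f z] for [f : Cx R -> Cx R] are complex
   differentiability at [z] and the complex derivative. *)
Definition Cx (R : realType) : numClosedFieldType := R[i].

Definition imag (R : realType) (z : Cx R) : R := complex.Im z.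

Definition cexp (R : realType) (z : Cx R) : Cx R :=
  expR (complex.Re z) * cos (imag z) +i* (expR (complex.Re z) * sin (imag z)).

(* [A] is a subspace of dimension [n]. *)
Definition has_dim (K : fieldType) (V : lmodType K) (A : set V) (n : nat) :=
  exists b : 'I_n -> V,
    (forall v, A v <-> exists a : 'I_n -> K, v = \sum_k a k *: b k) /\
    (forall a : 'I_n -> K, \sum_k a k *: b k = 0 -> forall k, a k = 0).

(** * Complex curves and their holomorphic functions *)

(* Only the restriction of [chart_coord] to [chart_dom] is meaningful. *)
Record chart (R : realType) (T : Type) := Chart {
  chart_dom : set T;
  chart_coord : T -> Cx R }.

(* [x0] is a junk value, taken outside the range of the coordinate. *)
Definition chart_inv (R : realType) (T : Type) (c : chart R T) (x0 : T) :
  Cx R -> T := 'pinv_(fun=> x0) (chart_dom c) (chart_coord c).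

(* The data of a Riemann surface: a space and a holomorphic atlas, not
   necessarily maximal. *)
Record surface (R : realType) := Surface {
  surface_pts :> topologicalType;
  atlas : set (chart R surface_pts) }.

Section Surfaces.
Variable R : realType.
Local Notation C := (Cx R).

(* Meant for [W] open. *)
Definition holomorphic_on (S : surface R) (W : set S) (f : S -> C) : Prop :=
  forall c, atlas c -> forall x, W x -> chart_dom c x ->
    derivable (f \o chart_inv c x) (chart_coord c x) 1.

Definition holomorphic_map (S T : surface R) (h : S -> T) : Prop :=
  continuous h /\
  forall c d, atlas c -> atlas d ->
  forall x, chart_dom c x -> chart_dom d (h x) ->
    derivable (chart_coord d \o h \o chart_inv c x) (chart_coord c x) 1.

Definition automorphism (S : surface R) (h : S -> S) : Prop :=
  holomorphic_map h /\
  exists g : S -> S, [/\ holomorphic_map g, cancel h g & cancel g h].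

(** * Holomorphic line bundles *)

(* Gluing data over the sets [bundle_dom i]; a section is a family [s i] of
   functions with [s i = bundle_trans i j * s j] on
   [bundle_dom i `&` bundle_dom j]. *)
Record cocycle (S : surface R) := Cocycle {
  bundle_idx : Type;
  bundle_dom : bundle_idx -> set S;
  bundle_trans : bundle_idx -> bundle_idx -> S -> C }.

Definition line_bundle (S : surface R) (L : cocycle S) : Prop :=
  [/\ forall i : bundle_idx L, open (bundle_dom i),
      forall x : S, exists i : bundle_idx L, bundle_dom i x,
      forall i j : bundle_idx L,
        holomorphic_on (bundle_dom i `&` bundle_dom j) (bundle_trans i j),
      forall (i : bundle_idx L) x, bundle_dom i x -> bundle_trans i i x = 1 &
      forall (i j k : bundle_idx L) x,
        bundle_dom i x -> bundle_dom j x -> bundle_dom k x ->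
        bundle_trans i j x * bundle_trans j k x = bundle_trans i k x].

(* [f i j] is the isomorphism read in the trivialisations [i] of [L] and [j]
   of [M]: it maps the section [s] to [t] with [t j = f i j * s i]. *)
Definition bundle_iso (S : surface R) (L M : cocycle S) : Prop :=
  exists f : bundle_idx L -> bundle_idx M -> S -> C,
    [/\ forall i j, holomorphic_on (bundle_dom i `&` bundle_dom j) (f i j),
        forall i j x, bundle_dom i x -> bundle_dom j x -> f i j x != 0 &
        forall i i' j j' x,
          bundle_dom i x -> bundle_dom i' x ->
          bundle_dom j x -> bundle_dom j' x ->
          f i' j' x = bundle_trans j' j x * f i j x * bundle_trans i i' x].

Definition bundle_pow (S : surface R) (L : cocycle S) (n : nat) : cocycle S :=
  @Cocycle S (bundle_idx L) (@bundle_dom S L)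
    (fun i j x => bundle_trans i j x ^+ n).

Definition pullback (S T : surface R) (h : S -> T) (L : cocycle T) :
    cocycle S :=
  @Cocycle S (bundle_idx L) (fun i => h @^-1` bundle_dom i)
    (fun i j => bundle_trans i j \o h).

(* [chart_deriv c d] is [dz_d / dz_c] for the coordinates [z_c] and [z_d]. *)
Definition chart_deriv (S : surface R) (c d : chart R S) (x : S) : C :=
  'D_1 (chart_coord d \o chart_inv c x) (chart_coord c x).

(* Trivialised by [dz_c] over the domain of [c]:
   [s_c dz_c = s_d dz_d] iff [s_c = (dz_d / dz_c) s_d]. *)
Definition canonical_bundle (S : surface R) : cocycle S :=
  @Cocycle S {c : chart R S | atlas c} (fun c => chart_dom (sval c))
    (fun c d => chart_deriv (sval c) (sval d)).

Definition theta_characteristic (S : surface R) (L : cocycle S) : Prop :=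
  line_bundle L /\ bundle_iso (bundle_pow L 2) (canonical_bundle S).

Definition aut_invariant (S : surface R) (L : cocycle S) : Prop :=
  forall h : S -> S, automorphism h -> bundle_iso (pullback h L) L.

(* Extended by 0 off [bundle_dom i], so that equality of sections is equality
   of functions. *)
Definition global_sections (S : surface R) (L : cocycle S) :
    set (bundle_idx L -> S -> C) :=
  [set s | [/\ forall i, holomorphic_on (bundle_dom i) (s i),
      forall i j x, bundle_dom i x -> bundle_dom j x ->
        s i x = bundle_trans i j x * s j x &
      forall i x, ~ bundle_dom i x -> s i x = 0]].

(* [dim H^0(S, L) = n]; in particular [H^0(S, L)] is finite-dimensional. *)
Definition h0 (S : surface R) (L : cocycle S) (n : nat) : Prop :=
  has_dim (K := C) (V := bundle_idx L -> S -> C) (global_sections (L := L)) n.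

End Surfaces.

(** * The modular group acting on the extended upper half plane *)

Definition SL2Z := {A : 'M[int]_2 | \det A == 1}.

Definition toSL2Z (A : 'M[int]_2) (detA : \det A = 1) : SL2Z :=
  exist _ A (introT eqP detA).

(* [p > 1] is assumed: ['Z_p] is not [Z/p] otherwise. *)
Definition in_Gamma (p : nat) (g : SL2Z) : bool :=
  map_mx (intr : int -> 'Z_p) (val g) == 1%:M.

Section Moebius.
Variable R : realType.
Local Notation C := (Cx R).

(* [option C] is the Riemann sphere, with [None] the point at infinity. *)
Definition moebius (A : 'M[int]_2) (z : option C) : option C :=
  let a : C := (A 0 0)%:~R in let b : C := (A 0 1)%:~R in
  let c : C := (A 1 0)%:~R in let d : C := (A 1 1)%:~R in
  match z with
  | None => if c == 0 then None else Some (a / c)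
  | Some z =>
      if c * z + d == 0 then None else Some ((a * z + b) / (c * z + d))
  end.

Definition in_hstar (z : option C) : bool :=
  match z with
  | None => true
  | Some z => (0 < imag z) || `[< exists q : rat, z = ratr q >]
  end.

End Moebius.

(* The upper half plane together with the rational numbers and infinity. *)
Record hstar (R : realType) :=
  HStar { hpt : option (Cx R); hptP : in_hstar hpt }.

HB.instance Definition _ R := [isSub for @hpt R].
HB.instance Definition _ R := [Choice of hstar R by <:].

Section MoebiusTheory.
Variable R : realType.
Local Notation C := (Cx R).

Lemma det2E (A : 'M[int]_2) : \det A = A 0 0 * A 1 1 - A 0 1 * A 1 0.
Proof.
rewrite (expand_det_row _ 0) !big_ord_recl big_ord0 addr0 /cofactor !det_mx11.
rewrite !mxE /= expr0 expr1 mul1r.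
rewrite (_ : lift 0 0 = 1); last exact/val_inj.
rewrite (_ : lift 1 0 = 0); last exact/val_inj.
by rewrite mulN1r mulrN.
Qed.

Lemma mulmx2E (A B : 'M[int]_2) i j :
  (A *m B) i j = A i 0 * B 0 j + A i 1 * B 1 j.
Proof.
rewrite mxE !big_ord_recl big_ord0 addr0.
by rewrite (_ : lift 0 0 = 1); last exact/val_inj.
Qed.

Lemma det_intr (F : pzRingType) (A : 'M[int]_2) : \det A = 1 ->
  (A 0 0)%:~R * (A 1 1)%:~R - (A 0 1)%:~R * (A 1 0)%:~R = 1 :> F.
Proof. by move=> detA; rewrite -!intrM -intrB -det2E detA. Qed.

Lemma moebius1 (z : option C) : moebius 1%:M z = z.
Proof.
case: z => [z|]; rewrite /moebius !mxE /= ?eqxx //.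
by rewrite mul0r add0r oner_eq0 mul1r addr0 divr1.
Qed.

Lemma moebiusM (A B : 'M[int]_2) (z : option C) : \det A = 1 -> \det B = 1 ->
  moebius (A *m B) z = moebius A (moebius B z).
Proof.
move=> /(det_intr C) dA /(det_intr C) dB; rewrite /moebius !mulmx2E !intrD !intrM.
move: dA dB; set a : C := (A 0 0)%:~R; set b : C := (A 0 1)%:~R.
set c : C := (A 1 0)%:~R; set d : C := (A 1 1)%:~R.
set a' : C := (B 0 0)%:~R; set b' : C := (B 0 1)%:~R.
set c' : C := (B 1 0)%:~R; set d' : C := (B 1 1)%:~R.
move: a b c d a' b' c' d' => a b c d a' b' c' d' dA dB.
case: z => [z|].
- have [w0|w0] := eqVneq (c' * z + d') 0.
  + have v0 : a' * z + b' != 0.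
      apply/negP => /eqP v0; move/eqP: dB; apply/negP.
      rewrite (_ : _ - _ = a' * (c' * z + d') - c' * (a' * z + b')); last by ring.
      by rewrite v0 w0 !mulr0 subr0 eq_sym oner_eq0.
    rewrite (_ : _ * z + _ = c * (a' * z + b') + d * (c' * z + d')); last by ring.
    rewrite (_ : (_ * _ + _) * z + _ = a * (a' * z + b') + b * (c' * z + d')); last by ring.
    rewrite w0 !mulr0 !addr0 mulf_eq0 (negPf v0) orbF.
    by case: eqP => // /eqP c0; congr Some; field; rewrite v0 c0.
  + rewrite (_ : _ * z + _ = c * (a' * z + b') + d * (c' * z + d')); last by ring.
    rewrite (_ : (_ * _ + _) * z + _ = a * (a' * z + b') + b * (c' * z + d')); last by ring.
    rewrite (_ : c * _ + d = (c * (a' * z + b') + d * (c' * z + d')) / (c' * z + d')); last by field.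
    rewrite mulf_eq0 invr_eq0 (negPf w0) orbF.
    by case: eqP => // /eqP c0; congr Some; field; rewrite w0 c0.
- have [w0|w0] := eqVneq c' 0.
  + have v0 : a' != 0.
      apply/negP => /eqP v0; move/eqP: dB.
      by rewrite v0 w0 mulr0 mul0r subr0 eq_sym oner_eq0.
    rewrite w0 !mulr0 !addr0 mulf_eq0 (negPf v0) orbF.
    by case: eqP => // /eqP c0; congr Some; field; rewrite v0 c0.
  + rewrite (_ : c * (a' / c') + d = (c * a' + d * c') / c'); last by field.
    rewrite mulf_eq0 invr_eq0 (negPf w0) orbF.
    by case: eqP => // /eqP c0; congr Some; field; rewrite w0 c0.
Qed.

End MoebiusTheory.


Section Action.
Variable R : realType.
Local Notation C := (Cx R).

Lemma imag_moebius (a b c d : R) (z : C) : a * d - b * c = 1 ->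
  0 < imag z ->
  0 < imag ((a%:C * z + b%:C) / (c%:C * z + d%:C)).
Proof.
case: z => x y; rewrite /imag => det1 /= y0; simpc => /=.
set s := c * x + d; set t := c * y.
have st0 : 0 < s ^+ 2 + t ^+ 2.
  rewrite lt_neqAle addr_ge0 ?sqr_ge0 // andbT eq_sym paddr_eq0 ?sqr_ge0 //.
  rewrite !sqrf_eq0 /s /t mulf_eq0 (gt_eqF y0) orbF andbC.
  apply/negP => /andP[/eqP c0]; rewrite c0 mul0r add0r => /eqP d0.
  by move: det1; rewrite c0 d0 !mulr0 subr0 => /eqP; rewrite eq_sym oner_eq0.
rewrite [X in 0 < X](_ : _ = y / (s ^+ 2 + t ^+ 2)) ?divr_gt0 //.
rewrite -[y in RHS]mul1r -det1 /s /t; field.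
by move: st0; rewrite /s /t => /gt_eqF ->.
Qed.

Lemma moebius_hstar (g : SL2Z) (z : option C) :
  in_hstar z -> in_hstar (moebius (val g) z).
Proof.
have det1 := eqP (valP g); set A := val g in det1 *.
have ratz (n : int) : n%:~R = ratr n%:~R :> C by rewrite ratr_int.
rewrite /in_hstar /moebius; case: z => [z|_]; last first.
  case: ifP => // _; apply/orP; right; apply/asboolP.
  by exists ((A 0 0)%:~R / (A 1 0)%:~R); rewrite fmorph_div /= -!ratz.
move=> /orP[z0|/asboolP[q ->]]; last first.
  case: ifP => // _; apply/orP; right; apply/asboolP.
  exists (((A 0 0)%:~R * q + (A 0 1)%:~R) / ((A 1 0)%:~R * q + (A 1 1)%:~R)).
  by rewrite fmorph_div /= !rmorphD /= !rmorphM /= -!ratz.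
case: ifP => // _; apply/orP; left.
have cz (n : int) : n%:~R = (n%:~R : R)%:C :> C by rewrite rmorph_int.
by rewrite !cz; apply: imag_moebius => //; exact: det_intr.
Qed.

Definition moebius_act (g : SL2Z) (x : hstar R) : hstar R :=
  HStar (moebius_hstar g (hptP x)).

Definition cusp_infty : hstar R := @HStar R None isT.

(* [U] is open when its trace on the upper half plane is open and when it
   contains a horoball at each of its cusps; the cusps are the
   [moebius_act g cusp_infty]. *)
Definition hstar_open (U : set (hstar R)) : Prop :=
  (forall x z, U x -> hpt x = Some z -> 0 < imag z ->
     \forall w \near z, forall y, hpt y = Some w -> U y) /\
  (forall g, U (moebius_act g cusp_infty) ->
     exists M : R, forall y w,
       hpt y = Some w -> M < imag w -> U (moebius_act g y)).

Lemma hstar_openT : hstar_open setT.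
Proof.
split=> [x z _ _ _|g _]; last by exists 0.
by apply: (@filterS _ _ _ setT) => //; exact: filterT.
Qed.

Lemma hstar_openI (U V : set (hstar R)) :
  hstar_open U -> hstar_open V -> hstar_open (U `&` V).
Proof.
move=> [U1 U2] [V1 V2]; split=> [x z [Ux Vx] xz z0|g [Ug Vg]].
  have := V1 x z Vx xz z0; apply: filterS2 (U1 x z Ux xz z0).
  by move=> w Uw Vw y yw; split; [exact: Uw|exact: Vw].
have [M MU] := U2 g Ug; have [N NV] := V2 g Vg.
exists (Num.max M N) => y w yw; rewrite gt_max => /andP[Mw Nw].
by split; [exact: MU yw Mw|exact: NV yw Nw].
Qed.

Lemma hstar_open_bigU (I : Type) (F : I -> set (hstar R)) :
  (forall i, hstar_open (F i)) -> hstar_open (\bigcup_i F i).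
Proof.
move=> oF; split=> [x z [i _ Fx] xz z0|g [i _ Fg]].
  by apply: filterS ((oF i).1 x z Fx xz z0) => w Fw y yw; exists i => //; exact: Fw.
have [M MF] := (oF i).2 g Fg.
by exists M => y w yw Mw; exists i => //; exact: MF yw Mw.
Qed.

HB.instance Definition _ := isOpenTopological.Build (hstar R)
  hstar_openT hstar_openI hstar_open_bigU.

Section Level.
Variable p : nat.

Definition Gamma_equiv (x y : hstar R) : bool :=
  `[< exists2 g : SL2Z, in_Gamma p g & moebius_act g x = y >].

Lemma Gamma_equiv_refl : reflexive Gamma_equiv.
Proof.
move=> x; apply/asboolP.
have d1 : \det (1%:M : 'M[int]_2) = 1 by exact: det1.
exists (toSL2Z d1); first by rewrite /in_Gamma /= map_mx1.
by apply: val_inj; rewrite /= moebius1.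
Qed.

Lemma Gamma_equiv_sym : symmetric Gamma_equiv.
Proof.
suff H x y : Gamma_equiv x y -> Gamma_equiv y x.
  by move=> x y; apply/idP/idP; exact: H.
move=> /asboolP[g gG <-]; apply/asboolP.
have dg := eqP (valP g).
have dV : \det (\adj (val g)) = 1.
  have := congr1 determinant (mul_mx_adj (val g)).
  by rewrite det_mulmx dg det1 mul1r => ->.
exists (toSL2Z dV).
  rewrite /in_Gamma /=; have := congr1 (map_mx (intr : int -> 'Z_p)) (mul_mx_adj (val g)).
  by rewrite map_mxM dg map_mx1 (eqP gG) mul1mx => ->.
apply: val_inj; rewrite /= -moebiusM //.
by rewrite mul_adj_mx dg moebius1.
Qed.

Lemma Gamma_equiv_trans : transitive Gamma_equiv.
Proof.
move=> y x z /asboolP[g gG <-] /asboolP[h hG <-]; apply/asboolP.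
have dhg : \det (val h *m val g) = 1.
  by rewrite det_mulmx (eqP (valP g)) (eqP (valP h)) mulr1.
exists (toSL2Z dhg).
  by rewrite /in_Gamma /= map_mxM (eqP gG) (eqP hG) mulmx1.
by apply: val_inj; rewrite /= moebiusM //; [exact: eqP (valP h)|exact: eqP (valP g)].
Qed.

Canonical Gamma_equiv_rel :=
  EquivRel Gamma_equiv Gamma_equiv_refl Gamma_equiv_sym Gamma_equiv_trans.

Definition modular_space : topologicalType :=
  quotient_topology {eq_quot Gamma_equiv}.

Definition modular_proj (x : hstar R) : modular_space :=
  \pi_(quotient_topology {eq_quot Gamma_equiv}) x.

Definition ordinary_chart (c : chart R modular_space) : Prop :=
  exists V : set (hstar R),
    [/\ open V,
        {in V &, injective modular_proj},
        chart_dom c = modular_proj @` V &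
        forall x, V x -> exists z : C,
          [/\ hpt x = Some z, 0 < imag z & chart_coord c (modular_proj x) = z]].

(* [q = exp (2 i pi z / p)], and [q = 0] at infinity. *)
Definition qcoord (x : hstar R) : C :=
  match hpt x with
  | Some z => cexp ((2 * pi / p%:R)%:C * 'i * z)
  | None => 0
  end.

Definition horoball (M : R) : set (hstar R) :=
  [set x | match hpt x with Some z => M < imag z | None => True end].

(* For [M >= 1] (and [p > 2]), [moebius_act g x] and [moebius_act g y] with
   [x] and [y] in [horoball M] are equivalent under Gamma(p) iff
   [qcoord x = qcoord y]. *)
Definition cusp_chart (c : chart R modular_space) : Prop :=
  exists (g : SL2Z) (M : R),
    [/\ 1 <= M,
        chart_dom c = (modular_proj \o moebius_act g) @` horoball M &
        forall x, horoball M x ->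
          chart_coord c (modular_proj (moebius_act g x)) = qcoord x].

Definition modular_curve : surface R :=
  @Surface R modular_space [set c | ordinary_chart c \/ cusp_chart c].

End Level.
End Action.

(* Main.v *)
Require Import Defs.
From HB Require Import structures.
From mathcomp Require Import all_boot all_order all_algebra.
From mathcomp Require Import complex.
From mathcomp Require Import all_classical all_reals all_analysis.
From mathcomp Require Import ring lra zify.

(** Why the theta characteristic [L] is even. The group SL(2, Z) acts on X(p) through
    SL(2, Z/p). Let S be the matrix acting by z -> -1/z. A solution of x^2 + y^2 = -1 modulo p
    with x and y nonzero provides integral matrices b and c of trace 0 and determinant 1
    with S b = c modulo p ([klein_four]), so that S, b and c = S b induce three
    commuting involutions of X(p). Each of the three matrices fixes a point of the upper
    half plane, at which its derivative is -1 ([elliptic2_fixed], [hX_fixed_point]).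

    As [L] is invariant, each involution h lifts to an isomorphism from the pullback of
    [L] to [L]. The square of the lift is an isomorphism of canonical bundles, which
    differs by a constant from the natural action of h on differentials; the lift can be
    normalised so that the two coincide ([lift_square]). The normalised lift is unique
    up to sign, so that the normalised lifts of S, b and c compose up to sign
    ([lift_comp]), and the square of each of them is a sign. At the fixed point that
    sign is the derivative -1 ([lift_involution]). On the space of sections this gives
    three operators of square -1, the third one being plus or minus the product of the
    first two: the quaternion group acts. Comparing the determinants of the squares
    shows that the dimension is even ([quaternion_even], [even_h0]).

    Two facts of analysis carry the argument. A holomorphic function on a compact
    connected surface is constant ([constant_holomorphic]), because of the strong
    maximum principle; and the space of sections of a line bundle is finite-dimensional
    ([h0_finite]), by a theorem of Siegel that only needs the Schwarz lemma. Both come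
    from Goursat's theorem ([goursat]) by way of the maximum principle on squares
    ([maximum_principle]). To apply them to X(p), its points are given holomorphic discs
    ([modular_discs]), it is shown to be compact and connected ([modular_compact],
    [modular_connected]), and the action of SL(2, Z) is shown to be holomorphic in the
    ordinary charts and in the coordinate q at the cusps ([hX_smooth]). *)

Set Implicit Arguments.
Unset Strict Implicit.
Unset Printing Implicit Defensive.

Import Order.TTheory GRing.Theory Num.Theory.
Import numFieldNormedType.Exports.
Local Open Scope classical_set_scope.
Local Open Scope ring_scope.
Local Open Scope complex_scope.

(** * The complex plane as a metric space *)

Section Plane.
Variable R : realType.
Local Notation C := (Cx R).
Implicit Types (z w : C) (f g : C -> C).

(** The real-valued modulus; the norm itself is complex-valued. *)
Definition nm (z : C) : R := complex.Re `|z|.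

Lemma nmE z : `|z| = (nm z)%:C.
Proof. by rewrite /nm [`|z|]normc_def. Qed.

Lemma nm_sqr z : nm z ^+ 2 = complex.Re z ^+ 2 + complex.Im z ^+ 2.
Proof. by rewrite /nm normc_def /= sqr_sqrtr // addr_ge0 ?sqr_ge0. Qed.

Lemma nm_ge0 z : 0 <= nm z.
Proof. by rewrite -ler0c -nmE normr_ge0. Qed.

Lemma nm0 : nm 0 = 0.
Proof. by rewrite /nm normr0. Qed.

Lemma nm1 : nm 1 = 1.
Proof. by rewrite /nm normr1. Qed.

Lemma nm_eq0 z : (nm z == 0) = (z == 0).
Proof.
rewrite -[RHS]normr_eq0 nmE; apply/eqP/eqP => [->//|h].
by apply: complexI.
Qed.

Lemma nm_gt0 z : (0 < nm z) = (z != 0).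
Proof. by rewrite lt_neqAle nm_ge0 andbT eq_sym nm_eq0. Qed.

Lemma nmM z w : nm (z * w) = nm z * nm w.
Proof. by apply: complexI; rewrite rmorphM /= -!nmE normrM. Qed.

Lemma nmX z n : nm (z ^+ n) = nm z ^+ n.
Proof. by apply: complexI; rewrite rmorphXn /= -!nmE normrX. Qed.

Lemma nmV z : nm z^-1 = (nm z)^-1.
Proof. by apply: complexI; rewrite fmorphV /= -!nmE normfV. Qed.

Lemma nmN z : nm (- z) = nm z.
Proof. by rewrite /nm normrN. Qed.

Lemma nmB z w : nm (z - w) = nm (w - z).
Proof. by rewrite -nmN opprB. Qed.

Lemma nmD z w : nm (z + w) <= nm z + nm w.
Proof. by rewrite -lecR rmorphD /= -!nmE ler_normD. Qed.

Lemma nmD3 z w u : nm (z - w) <= nm (z - u) + nm (u - w).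
Proof. by rewrite (le_trans _ (nmD _ _)) // addrA subrK. Qed.

Lemma nm_real (x : R) : nm x%:C = `|x|.
Proof. by rewrite /nm normc_def /= expr0n addr0 sqrtr_sqr. Qed.

Lemma nm_int (n : int) : nm n%:~R = `|n%:~R|.
Proof. by rewrite -[X in nm X](rmorph_int (real_complex R)) nm_real. Qed.

Lemma nm_Re z : `|complex.Re z| <= nm z.
Proof.
by rewrite -ler_sqr ?nnegrE ?nm_ge0 // nm_sqr -normrX ger0_norm ?sqr_ge0 ?lerDl ?sqr_ge0.
Qed.

Lemma nm_Im z : `|complex.Im z| <= nm z.
Proof.
by rewrite -ler_sqr ?nnegrE ?nm_ge0 // nm_sqr -normrX ger0_norm ?sqr_ge0 ?lerDr ?sqr_ge0.
Qed.

Lemma nm_i : nm 'i%C = 1.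
Proof. by rewrite /nm normc_def /= expr0n add0r expr1n sqrtr1. Qed.

Lemma nm_leD z : nm z <= `|complex.Re z| + `|complex.Im z|.
Proof.
rewrite {1}[z]complexE (le_trans (nmD _ _)) //.
by rewrite nmM nm_i mul1r !nm_real.
Qed.

Lemma nm_prod (I : Type) (s : seq I) (F : I -> C) :
  nm (\prod_(i <- s) F i) = \prod_(i <- s) nm (F i).
Proof. by apply: (big_morph nm nmM nm1). Qed.

Lemma nbhsCP z (A : set C) :
  nbhs z A <-> exists2 e : R, 0 < e & forall w, nm (w - z) < e -> A w.
Proof.
split=> [/nbhs_ballP[e /= e0 eA]|[e e0 eA]].
  have er : e = (complex.Re e)%:C.
    by move: e0; rewrite ltcE; case: e {eA} => a b /= /andP[/eqP -> _].
  exists (complex.Re e); first by rewrite -ltcR -er.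
  move=> w ze; apply: eA; rewrite /ball /= nmE er ltcR.
  by rewrite nmB.
apply/nbhs_ballP; exists e%:C; first by rewrite /= ltcR.
by move=> w; rewrite /ball /= nmE ltcR nmB; exact: eA.
Qed.

Lemma nearCP z (P : C -> Prop) :
  (\forall w \near z, P w) <->
  exists2 e : R, 0 < e & forall w, nm (w - z) < e -> P w.
Proof. exact: nbhsCP. Qed.

Lemma cvgCP (T : Type) (F : set_system T) (FF : Filter F) (f : T -> C) z :
  f @ F --> z <-> forall e : R, 0 < e -> \forall x \near F, nm (f x - z) < e.
Proof.
split=> [fz e e0|H A /nbhsCP[e e0 eA]].
  have h : nbhs z [set w | nm (w - z) < e] by apply/nbhsCP; exists e.
  by have := fz _ h.
by apply: filterS (H e e0) => x; exact: eA.
Qed.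

Lemma contCP f z :
  {for z, continuous f} <-> forall e : R, 0 < e ->
    exists2 d : R, 0 < d & forall w, nm (w - z) < d -> nm (f w - f z) < e.
Proof.
have FF := nbhs_filter z.
split=> [/(cvgCP _) H e e0|H]; first exact/nearCP/H.
by apply/(cvgCP _) => e e0; apply/nearCP/H.
Qed.

Lemma contRCP (f : C -> R) z :
  {for z, continuous f} <-> forall e : R, 0 < e ->
    exists2 d : R, 0 < d & forall w, nm (w - z) < d -> `|f w - f z| < e.
Proof.
have E := @cvgrPdist_lt _ R _ (nbhs z) (nbhs_filter z) f (f z).
split=> [/E H e e0|H].
  have /nearCP[d d0 dH] := H e e0; exists d => // w /dH.
  by rewrite distrC.
apply/E => e e0; apply/nearCP; have [d d0 dH] := H e e0; exists d => // w /dH.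
by rewrite distrC.
Qed.

Lemma continuous_Re : continuous (@complex.Re R : C -> R).
Proof.
move=> z; apply/contRCP => e e0; exists e => // w wz.
by rewrite (le_lt_trans _ wz) // -(raddfB (@complex.Re R)) nm_Re.
Qed.

Lemma continuous_Im : continuous (@complex.Im R : C -> R).
Proof.
move=> z; apply/contRCP => e e0; exists e => // w wz.
by rewrite (le_lt_trans _ wz) // -(raddfB (@complex.Im R)) nm_Im.
Qed.

Lemma continuous_nm : continuous nm.
Proof.
move=> z; apply/contRCP => e e0; exists e => // w wz.
rewrite (le_lt_trans _ wz) // ler_distl; apply/andP; split.
  by rewrite lerBlDr nmB -{1}[z](subrKC w) nmD.
by rewrite -{1}[w](subrKC z) nmD.
Qed.

Lemma cvg_complex (T : Type) (F : set_system T) (FF : Filter F) (x y : T -> R)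
    (a b : R) :
  x @ F --> a -> y @ F --> b -> (fun t => (x t +i* y t : C)) @ F --> (a +i* b : C).
Proof.
move=> xa yb; apply/(cvgCP _) => e e0.
have e2 : 0 < e / 2 by rewrite divr_gt0.
move/cvgrPdist_lt: xa => /(_ _ e2) xa; move/cvgrPdist_lt: yb => /(_ _ e2) yb.
apply: filterS2 xa yb => t xt yt.
rewrite (le_lt_trans (nm_leD _)) //= (splitr e) ltrD // -normrN.
  by rewrite opprB.
by rewrite opprB.
Qed.

End Plane.

(** * Derivatives of functions of one variable *)

Section Derivation.
Variable K : numFieldType.
Implicit Types (f g : K -> K) (x l m : K).

Lemma is_deriveP f x l :
  is_derive x 1 f l <->
  forall e, 0 < e -> \forall y \near x, `|f y - f x - l * (y - x)| <= e * `|y - x|.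
Proof.
split=> [[df dl] e e0|H].
  have h : (fun h => h^-1 *: (f (h *: 1 + x) - f x)) @ 0^' --> l.
    by rewrite -dl; exact: df.
  move/cvgrPdist_le : h => /(_ _ e0)/nbhs_ballP[d /= d0 dH].
  apply/nbhs_ballP; exists d => //= y xy.
  have [->|yx] := eqVneq y x; first by rewrite !subrr mulr0 subrr normr0 mulr0.
  have yx0 : y - x != 0 by rewrite subr_eq0.
  have := dH (y - x); rewrite /ball /= sub0r normrN distrC => /(_ xy yx0) /=.
  rewrite [_ *: 1]mulr1 subrK => le.
  have -> : f y - f x - l * (y - x) =
      - ((l - (y - x)^-1 *: (f y - f x)) * (y - x)).
    by rewrite /GRing.scale /= mulrBl [_^-1 * _ * _]mulrAC mulVf // mul1r opprB.
  by rewrite normrN normrM (distrC x) ler_wpM2r.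
have h : (fun h => h^-1 *: (f (h *: 1 + x) - f x)) @ 0^' --> l.
  apply/cvgrPdist_le => e e0.
  have /nbhs_ballP[d /= d0 dH] := H e e0.
  apply/nbhs_ballP; exists d => //= t; rewrite /ball /= sub0r normrN => td t0.
  have := dH (t + x); rewrite /ball /= opprD addrCA subrr addr0 normrN => /(_ td).
  rewrite addrK [_ *: 1]mulr1 => le.
  have -> : l - t^-1 *: (f (t + x) - f x) =
      - ((f (t + x) - f x - l * t) / t).
    by rewrite /GRing.scale /= mulrBl mulfK // opprB mulrC.
  by rewrite normrN normrM normfV ler_pdivrMr ?normr_gt0.
by apply: DeriveDef; [apply/cvg_ex; exists l|exact/cvg_lim].
Qed.

Lemma continuous_forP f x : {for x, continuous f} <->
  forall e, 0 < e -> \forall y \near x, `|f x - f y| <= e.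
Proof. exact: (@cvgrPdist_le _ K _ (nbhs x) (nbhs_filter x) f (f x)). Qed.

(** The difference quotient, completed by the derivative, is continuous. This form of
    differentiability composes without division, and it divides a zero out of a
    function. *)
Lemma caratheodoryP f x l :
  is_derive x 1 f l <->
  exists u : K -> K, [/\ {for x, continuous u}, u x = l &
    forall y, f y = f x + u y * (y - x)].
Proof.
split=> [df|[u [cu ux fu]]]; last first.
  apply/is_deriveP => e e0.
  move/continuous_forP : cu => /(_ _ e0); apply: filterS => y uy.
  rewrite fu [f x + _]addrC addrK -mulrBl normrM ler_wpM2r //.
  by rewrite distrC -ux.
exists (fun y => if y == x then l else (f y - f x) / (y - x)); split.
- apply/continuous_forP => e e0.
  move/is_deriveP : df => /(_ _ e0); apply: filterS => y fy.
  rewrite eqxx; case: eqVneq => [_|yx]; first by rewrite subrr normr0 ltW.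
  have yx0 : y - x != 0 by rewrite subr_eq0.
  rewrite -(ler_pM2r (x := `|y - x|)) ?normr_gt0 // (le_trans _ fy) //.
  by rewrite -normrM mulrBl mulfVK // distrC.
- by rewrite eqxx.
- move=> y; case: eqVneq => [->|yx]; first by rewrite subrr mulr0 addr0.
  by rewrite mulfVK ?subr_eq0 // subrKC.
Qed.

Lemma is_derive_continuous f x l : is_derive x 1 f l -> {for x, continuous f}.
Proof.
by case=> /derivable1_diffP /differentiable_continuous.
Qed.

Lemma is_derive_compC f g x l m : is_derive x 1 f l -> is_derive (f x) 1 g m ->
  is_derive x 1 (g \o f) (m * l).
Proof.
move=> /[dup] df /caratheodoryP[u [cu <- fu]] /caratheodoryP[v [cv <- gv]].
apply/caratheodoryP; exists (fun y => v (f y) * u y); split=> //.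
  apply: continuousM; last exact: cu.
  by apply: continuous_comp; [exact: is_derive_continuous df|exact: cv].
by move=> y /=; rewrite gv -mulrA; congr (_ + _ * _); rewrite {1}fu addrAC subrr add0r.
Qed.

Lemma is_derive_inv f g x l : {for x, continuous f} ->
  is_derive (f x) 1 g l -> l != 0 -> (\forall y \near x, g (f y) = y) ->
  is_derive x 1 f l^-1.
Proof.
move=> cf /caratheodoryP[u [cu <- gu]] u0 gf.
have gfx : g (f x) = x := nbhs_singleton gf.
have cuf : {for x, continuous (fun y => u (f y))} by apply: continuous_comp.
have cV : {for x, continuous (fun y => (u (f y))^-1)} by exact: continuousV.
apply/is_deriveP => e e0; move/continuous_forP : cV => /(_ _ e0) near1.
have near2 : \forall y \near x, u (f y) != 0.
  have e20 : 0 < `|u (f x)| / 2 by rewrite divr_gt0 ?normr_gt0.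
  move/continuous_forP : cuf => /(_ _ e20); apply: filterS => y.
  apply: contraTneq => ->; rewrite subr0 lt_geF //.
  by rewrite ltr_pdivrMr // ltr_pMr ?normr_gt0 // ltr1n.
apply: filterS3 gf near1 near2 => y gfy ly uy0.
have -> : f y - f x = (u (f y))^-1 * (y - x).
  have -> : y - x = u (f y) * (f y - f x).
    by rewrite -{1}gfy gu gfx addrAC subrr add0r.
  by rewrite mulKf.
by rewrite -mulrBl normrM ler_wpM2r // distrC.
Qed.

Lemma is_derive_near f g x l : (\forall y \near x, f y = g y) ->
  is_derive x 1 f l -> is_derive x 1 g l.
Proof. exact: near_eq_is_derive. Qed.

Lemma is_derive_mulC f g x l m : is_derive x 1 f l -> is_derive x 1 g m ->
  is_derive x 1 (fun y => f y * g y) (l * g x + f x * m).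
Proof.
move=> df dg; apply: (is_derive_eq (f' := f x *: m + g x *: l)).
by rewrite addrC; congr (_ + _); rewrite [_ *: _]mulrC.
Qed.

Lemma is_derive_divC f g x l m : is_derive x 1 f l -> is_derive x 1 g m ->
  g x != 0 ->
  is_derive x 1 (fun y => f y / g y) ((l * g x - f x * m) / g x ^+ 2).
Proof.
move=> df [dg gm] gx0.
have dV : is_derive x 1 (fun y => (g y)^-1) (- m / g x ^+ 2).
  apply: DeriveDef; first exact: derivableV.
  by rewrite deriveV // gm [_ *: _]mulrC mulNr mulrN.
apply: is_derive_eq (is_derive_mulC df dV) _.
by field.
Qed.

End Derivation.

Lemma continuous_near (T U : topologicalType) (f g : T -> U) (a : T) :
  (\forall b \near a, f b = g b) -> {for a, continuous f} -> {for a, continuous g}.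
Proof.
move=> fg cf A; rewrite /= -(nbhs_singleton fg) => /cf fA.
by apply: filterS2 fg fA => y; rewrite /preimage /= => ->.
Qed.


(** * Exponential and logarithm *)

Section Exponential.
Variable R : realType.
Local Notation C := (Cx R).
Implicit Types (z w : C) (f g : C -> C).

Lemma is_deriveCP f z l :
  is_derive z 1 f l <-> forall e : R, 0 < e ->
    exists2 d : R, 0 < d & forall w, nm (w - z) < d ->
      nm (f w - f z - l * (w - z)) <= e * nm (w - z).
Proof.
split=> [/is_deriveP H e e0|H].
  have e0C : (0 : C) < e%:C by rewrite ltcR.
  have /nearCP[d d0 dH] := H _ e0C; exists d => // w /dH.
  by rewrite !nmE -rmorphM /= lecR.
apply/is_deriveP => e e0.
have er : e = (complex.Re e)%:C.
  by move: e0; rewrite ltcE; case: e => a b /= /andP[/eqP -> _].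
rewrite er ltcR in e0 *.
have [d d0 dH] := H _ e0; apply/nearCP; exists d => // w /dH.
by rewrite !nmE -rmorphM /= lecR.
Qed.

Lemma cexpD z w : cexp (z + w) = cexp z * cexp w.
Proof.
case: z w => [a b] [c d]; rewrite /cexp /imag /= expRD cosD sinD; simpc.
by congr (_ +i* _); ring.
Qed.

Lemma cexp0 : cexp (0 : C) = 1.
Proof. by rewrite /cexp /imag /= expR0 cos0 sin0 mulr1 mulr0. Qed.

Lemma nm_cexp z : nm (cexp z) = expR (complex.Re z).
Proof.
apply/eqP; rewrite -(eqrXn2 (n := 2)) ?nm_ge0 ?expR_ge0 // nm_sqr /=.
by rewrite !exprMn -mulrDr cos2Dsin2 mulr1.
Qed.

Lemma cexp_neq0 z : cexp z != 0.
Proof. by rewrite -nm_gt0 nm_cexp expR_gt0. Qed.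

Lemma cexpN z : cexp (- z) = (cexp z)^-1.
Proof.
by apply: (mulfI (cexp_neq0 z)); rewrite -cexpD subrr cexp0 mulfV ?cexp_neq0.
Qed.

Lemma cexpB z w : cexp (z - w) = cexp z / cexp w.
Proof. by rewrite cexpD cexpN. Qed.

(** By the addition formula it suffices to differentiate at 0, where the estimates for
    the real functions exp, cos and sin combine. *)
Lemma is_derive_cexp z : is_derive z 1 (@cexp R) (cexp z).
Proof.
have d0 : is_derive (0 : C) 1 (@cexp R) 1.
  apply/is_deriveCP => e e0; rewrite cexp0.
  have [e' [e4 e'1 e'e]] : exists e' : R, [/\ 0 < e', e' <= 1 & 9 * e' <= e].
    exists (Num.min (e / 9) 1); split.
    - by rewrite lt_min divr_gt0 //=.
    - by rewrite ge_min lexx orbT.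
    - by rewrite mulrC -ler_pdivlMr // ge_min lexx.
  have de : is_derive (0 : R) 1 (@expR R) 1.
    by have := is_derive_expR (0 : R); rewrite expR0.
  have dc : is_derive (0 : R) 1 (@cos R) 0.
    by have := is_derive_cos (0 : R); rewrite sin0 oppr0.
  have ds : is_derive (0 : R) 1 (@sin R) 1.
    by have := is_derive_sin (0 : R); rewrite cos0.
  move/is_deriveP : de => /(_ _ e4)/nbhs_ballP[d1 /= d10 H1].
  move/is_deriveP : dc => /(_ _ e4)/nbhs_ballP[d2 /= d20 H2].
  move/is_deriveP : ds => /(_ _ e4)/nbhs_ballP[d3 /= d30 H3].
  exists (Num.min (Num.min d1 d2) (Num.min d3 e')).
    by rewrite !lt_min d10 d20 d30 e4.
  move=> [x y]; rewrite subr0 !lt_min => /andP[/andP[n1 n2] /andP[n3 n4]].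
  have := nm_Re (x +i* y); have := nm_Im (x +i* y); move: n1 n2 n3 n4 => /=.
  set n := nm _ => n1 n2 n3 n4 ny nx.
  have {}H1 := H1 x; rewrite /ball /= sub0r normrN subr0 expR0 mul1r in H1; have {}H1 := H1 (le_lt_trans nx n1).
  have {}H2 := H2 y; rewrite /ball /= sub0r normrN subr0 cos0 mul0r subr0 in H2; have {}H2 := H2 (le_lt_trans ny n2).
  have {}H3 := H3 y; rewrite /ball /= sub0r normrN subr0 sin0 mul1r subr0 in H3; have {}H3 := H3 (le_lt_trans ny n3).
  set E := expR x in H1 *; set c := cos y in H2 *; set s := sin y in H3 *.
  have n0 : 0 <= n by exact: nm_ge0.
  have {H1} : `|E - 1 - x| <= e' * n by rewrite (le_trans H1) // ler_wpM2l // ltW.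
  have {H2} : `|c - 1| <= e' * n by rewrite (le_trans H2) // ler_wpM2l // ltW.
  have {H3} : `|s - y| <= e' * n by rewrite (le_trans H3) // ler_wpM2l // ltW.
  set k := e' * n => H3 H2 H1.
  have k0 : 0 <= k by rewrite mulr_ge0 // ltW.
  have E1 : `|E - 1| <= k + n.
    by rewrite -(subrK x (E - 1)) (le_trans (ler_normD _ _)) // lerD.
  have kn : k <= n by rewrite ler_piMl.
  have E3 : `|E| <= 3.
    rewrite -(subrK 1 E) (le_trans (ler_normD _ _)) // normr1 -lerBrDr.
    rewrite (le_trans E1) //.
    have : n <= 1 by rewrite (le_trans (ltW n4)).
    by lra.
  have -> : cexp (x +i* y) - 1 - 1 * (x +i* y) = (E * c - 1 - x) +i* (E * s - y).
    rewrite mul1r /cexp /imag /= -/E -/c -/s; apply/eqP.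
    by rewrite eq_complex /= oppr0 addr0 !eqxx.
  rewrite (le_trans (nm_leD _)) //=.
  have -> : E * c - 1 - x = E * (c - 1) + (E - 1 - x) by ring.
  have -> : E * s - y = E * (s - y) + (E - 1) * y by ring.
  have h1 : `|E * (c - 1) + (E - 1 - x)| <= 3 * k + k.
    by rewrite (le_trans (ler_normD _ _)) // lerD // normrM ler_pM.
  have h2 : `|E * (s - y) + (E - 1) * y| <= 3 * k + (k + n) * n.
    rewrite (le_trans (ler_normD _ _)) // lerD // normrM ler_pM //.
  rewrite (le_trans (lerD h1 h2)) //.
  have h3 : (k + n) * n <= 1 * k + k.
    rewrite mulrDl lerD //; last by rewrite /k ler_wpM2r // ltW.
    by rewrite mulrC ler_wpM2r // (le_trans (ltW n4)).
  apply: (@le_trans _ _ (9 * e' * n)); last by rewrite ler_wpM2r.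
  have : 0 <= k by []. 
  move: h3; rewrite -mulrA -/k; lra.
have -> : @cexp R = (fun w => cexp z * cexp (w - z)).
  by apply/funext => w; rewrite -cexpD subrKC.
have h : is_derive z 1 (fun w => w - z) 1 by apply: is_derive_eq; rewrite subr0.
have h2 : is_derive (z - z) 1 (@cexp R) 1 by rewrite subrr.
have h3 := is_derive_compC h h2.
have := is_derive_mulC (is_derive_cst (cexp z) z 1) h3.
by rewrite mul0r add0r mulr1 subrr cexp0 mulr1.
Qed.

Lemma cexp_pi : cexp (pi *i : C) = -1.
Proof.
rewrite /cexp /imag /= expR0 !mul1r cospi sinpi.
by apply/eqP; rewrite eq_complex /= oppr0 !eqxx.
Qed.

Lemma cexp_pihalf : cexp ((pi / 2) *i : C) = 'i%C.
Proof. by rewrite /cexp /imag /= expR0 !mul1r cos_pihalf sin_pihalf. Qed.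

(** The principal branch, a logarithm on the right half plane only. *)
Definition clog (w : C) : C :=
  ln (nm w) +i* atan (complex.Im w / complex.Re w).

Lemma clogK w : 0 < complex.Re w -> cexp (clog w) = w.
Proof.
case: w => u v /= u0; rewrite /cexp /imag /clog /=.
have n0 : 0 < nm (u +i* v : C).
  by rewrite nm_gt0 eq_complex /= gt_eqF.
rewrite lnK ?posrE //.
have co : cos (atan (v / u)) = u / nm (u +i* v : C).
  rewrite cos_atan.
  have -> : nm (u +i* v : C) = u * Num.sqrt (1 + (v / u) ^+ 2).
    rewrite -[X in X * _]ger0_norm ?(ltW u0) // -sqrtr_sqr -sqrtrM ?sqr_ge0 //.
    rewrite /nm normc_def /=; congr Num.sqrt.
    by field; rewrite gt_eqF.
  have s0 : Num.sqrt (1 + (v / u) ^+ 2) != 0.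
    by rewrite gt_eqF // sqrtr_gt0 ltr_pwDl // sqr_ge0.
  by field; rewrite s0 gt_eqF.
have si : sin (atan (v / u)) = v / nm (u +i* v : C).
  have c0 : cos (atan (v / u)) != 0 by rewrite co gt_eqF // divr_gt0.
  have := atanK (v / u); rewrite /tan => /(congr1 ( *%R ^~ (cos (atan (v / u))))).
  rewrite mulfVK // => ->; rewrite co.
  by field; rewrite !gt_eqF.
by rewrite co si; congr (_ +i* _); rewrite mulrC mulfVK // gt_eqF.
Qed.

Lemma clog1 : clog 1 = 0.
Proof. by rewrite /clog nm1 ln1 /= mul0r atan0. Qed.

Lemma continuous_clog w : 0 < complex.Re w -> {for w, continuous clog}.
Proof.
move=> w0.
have n0 : 0 < nm w by rewrite (lt_le_trans w0) // (le_trans (ler_norm _)) // nm_Re.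
have FF : Filter (nbhs w) := nbhs_filter w.
apply: (@cvg_complex R C (nbhs w) FF (fun w => ln (nm w))
   (fun w => atan (complex.Im w / complex.Re w))).
  apply: (@continuous_comp _ _ _ (@nm R) (@ln R) w); first exact: continuous_nm.
  exact: continuous_ln.
apply: (@continuous_comp _ _ _ (fun w : C => complex.Im w / complex.Re w) (@atan R) w).
  apply: (@continuousM R C (@complex.Im R) (fun w => (complex.Re w)^-1) w).
    exact: continuous_Im.
  apply: continuousV; first by rewrite gt_eqF.
  exact: continuous_Re.
exact: continuous_atan.
Qed.

Lemma near_Re_gt0 w : 0 < complex.Re w -> \forall v \near w, 0 < complex.Re v.
Proof.
move=> w0; apply/nearCP; exists (complex.Re w) => // v /(le_lt_trans (nm_Re _)).
rewrite raddfB /= ltr_distl => /andP[h _].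
by move: h; rewrite subrr.
Qed.

Lemma is_derive_clog w : 0 < complex.Re w -> is_derive w 1 clog w^-1.
Proof.
move=> w0; apply: (@is_derive_inv _ clog (@cexp R)).
- exact: continuous_clog.
- by rewrite -{2}(clogK w0); exact: is_derive_cexp.
- by rewrite -(clogK w0) cexp_neq0.
- by apply: filterS (near_Re_gt0 w0) => v; exact: clogK.
Qed.

(** One of w, -w, iw and -iw lies in the right half plane unless w is 0. *)
Lemma cexp_surj w : w != 0 -> exists z, cexp z = w.
Proof.
move=> w0.
have aux (v u : C) : 0 < complex.Re u -> cexp v * u = w -> exists z, cexp z = w.
  by move=> u0 <-; exists (v + clog u); rewrite cexpD clogK.
have [h|h|h] := ltgtP (complex.Re w) 0.
- apply: (aux (pi *i) (- w)); last by rewrite cexp_pi mulN1r opprK.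
  by case: (w) h => a b /=; rewrite oppr_gt0.
- by apply: (aux 0 w) => //; rewrite cexp0 mul1r.
- have [k|k|k] := ltgtP (complex.Im w) 0.
  + apply: (aux (- (pi / 2) *i) ('i%C * w)).
      by case: (w) h k => a b /= -> b0; rewrite mul0r sub0r mul1r oppr_gt0.
    by rewrite cexpN cexp_pihalf mulKf // -nm_gt0 nm_i.
  + apply: (aux ((pi / 2) *i) (- 'i%C * w)).
      by case: (w) h k => a b /= -> b0; rewrite oppr0 mulN1r opprK mul0r add0r.
    by rewrite cexp_pihalf mulrA mulrN -expr2 sqr_i opprK mul1r.
  + by case: w w0 h k {aux} => a b /= /[swap] -> /[swap] ->; rewrite eqxx.
Qed.

Lemma cos1_sin0 (t : R) : cos t = 1 -> sin t = 0 -> exists k : int, t = k%:~R * (pi *+ 2).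
Proof.
move=> ct st; have p0 : 0 < (pi : R) *+ 2 by rewrite pmulrn_lgt0 // pi_gt0.
exists (Num.floor (t / (pi *+ 2))).
set k := Num.floor _.
have co (n : int) (s : R) : cos (s + n%:~R * (pi *+ 2)) = cos s.
  have E (m : nat) (u : R) : cos (u + m%:R * (pi *+ 2)) = cos u.
    by rewrite mulr_natl (periodicn (@cosD2pi R)).
  case: n => n; first exact: E.
  by rewrite NegzE rmorphN /= mulNr -(E n.+1) subrK.
set s := t - k%:~R * (pi *+ 2).
have cs : cos s = 1 by rewrite -(co k s) /s subrK.
have s0 : 0 <= s.
  by rewrite subr_ge0 -ler_pdivlMr // floor_le_tmp.
have s1 : s < pi *+ 2.
  by rewrite ltrBlDr -{1}[pi *+ 2]mul1r -mulrDl -ltr_pdivrMr // addrC -[1]/(1%:~R) -intrD floorD1_gt.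
suff : s = 0 by move/eqP; rewrite subr_eq0 => /eqP.
have pi0 := @pi_gt0 R.
have [sp|sp] := leP s pi.
  by apply: cos_inj; rewrite ?in_itv /= ?s0 ?lexx ?sp ?(ltW pi0) // cos0.
have : pi *+ 2 - s = 0.
  apply: cos_inj.
  - by rewrite in_itv /= subr_ge0 (ltW s1) /= lerBlDl mulr2n lerD2r ltW.
  - by rewrite in_itv /= lexx ltW.
  - by rewrite addrC cosD2pi cosN cos0.
by move/eqP; rewrite subr_eq0 => /eqP h; move: s1; rewrite h ltxx.
Qed.

Lemma cexp_eq1 z : cexp z = 1 -> exists k : int, z = (k%:~R * (pi *+ 2)) *i.
Proof.
move=> z1.
have x0 : complex.Re z = 0.
  by apply: expR_inj; rewrite expR0 -nm_cexp z1 nm1.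
case: z x0 z1 => a b /= ->; rewrite /cexp /imag /= expR0 !mul1r => -[/cos1_sin0 h /h[k ->]].
by exists k.
Qed.

End Exponential.

(** * Integrals along segments *)

Section LineIntegral.
Variable R : realType.
Local Notation C := (Cx R).
Implicit Types (phi psi : R -> C).

Lemma derive_bound (G g : R -> R) (a b K : R) : a <= b ->
  (forall x, a <= x <= b -> is_derive x 1 G (g x)) ->
  (forall x, a <= x <= b -> `|g x| <= K) -> `|G b - G a| <= K * (b - a).
Proof.
move=> ab dG gK.
have dG' x : x \in `]a, b[ -> is_derive x 1 G (g x).
  by rewrite in_itv /= => /andP[ax xb]; apply: dG; rewrite !ltW.
have cG : {within `[a, b], continuous G}.
  apply: derivable_within_continuous => x; rewrite in_itv /= => xab.
  by have [] := dG x xab.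
have [c cab ->] := MVT_segment ab dG' cG.
rewrite normrM [`|b - a|]ger0_norm ?subr_ge0 // ler_wpM2r ?subr_ge0 //.
by apply: gK; move: cab; rewrite in_itv.
Qed.

Lemma derive_lbound (G g : R -> R) (a b K : R) : a <= b ->
  (forall x, a <= x <= b -> is_derive x 1 G (g x)) ->
  (forall x, a <= x <= b -> K <= g x) -> K * (b - a) <= G b - G a.
Proof.
move=> ab dG gK.
have dG' x : x \in `]a, b[ -> is_derive x 1 G (g x).
  by rewrite in_itv /= => /andP[ax xb]; apply: dG; rewrite !ltW.
have cG : {within `[a, b], continuous G}.
  apply: derivable_within_continuous => x; rewrite in_itv /= => xab.
  by have [] := dG x xab.
have [c cab ->] := MVT_segment ab dG' cG.
rewrite ler_wpM2r ?subr_ge0 //.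
by apply: gK; move: cab; rewrite in_itv.
Qed.

Lemma primitive_ex (g : R -> R) : continuous g ->
  exists G : R -> R, forall x : R, -2 < x -> is_derive x 1 G (g x).
Proof.
move=> cg; exists (fun x => \int[lebesgue_measure]_(t in `[-2, x]) g t)%R => x x2.
have xu : x < x + 1 by rewrite ltrDl.
have ig : lebesgue_measure.-integrable `[-2, x + 1] (EFin \o g).
  apply: continuous_compact_integrable; first exact: segment_compact.
  exact: continuous_subspaceT.
have [d e] := continuous_FTC1_closed xu ig x2 (cg x).
by apply: DeriveDef => //; rewrite -derive1E e.
Qed.

(** Real and imaginary parts are kept apart, so that the real mean value theorem and
    fundamental theorem of calculus apply. The base point -2 only has to lie to the
    left of the segments in use. *)
Definition primitive phi (Phi : R -> C) := forall x : R, -2 < x ->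
  is_derive x 1 (fun t => complex.Re (Phi t)) (complex.Re (phi x)) /\
  is_derive x 1 (fun t => complex.Im (Phi t)) (complex.Im (phi x)).

(** Two primitives differ by a constant to the right of -2, so on segments there the
    chosen primitive does not matter. *)
Definition lint phi (a b : R) : C :=
  let Phi := xget (fun=> 0) [set Phi | primitive phi Phi] in Phi b - Phi a.

Definition rcont phi := continuous (fun t => complex.Re (phi t)) /\
  continuous (fun t => complex.Im (phi t)).

Lemma lintP phi : rcont phi -> exists2 Phi, primitive phi Phi &
  forall a b, lint phi a b = Phi b - Phi a.
Proof.
move=> [/primitive_ex[A HA] /primitive_ex[B HB]].
exists (xget (fun=> 0) [set Phi | primitive phi Phi]) => //.
have := @xgetI _ (fun=> 0) [set Phi | primitive phi Phi] (fun x => (A x +i* B x : C)).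
by apply=> x x2; split; [exact: HA|exact: HB].
Qed.

Lemma lint_split phi a b c : lint phi a c = lint phi a b + lint phi b c.
Proof. by rewrite /lint; ring. Qed.

Lemma lint_bound phi a b K : rcont phi -> -2 < a -> a <= b ->
  (forall x, a <= x <= b -> nm (phi x) <= K) ->
  nm (lint phi a b) <= 2 * K * (b - a).
Proof.
move=> /lintP[Phi dPhi E] a2 ab pK; rewrite E.
have lt2 x : a <= x <= b -> -2 < x by case/andP => ax _; exact: lt_le_trans ax.
rewrite (le_trans (nm_leD _)) // !raddfB /=.
rewrite -mulrA mulr2n mulrDl !mul1r lerD //.
  apply: (@derive_bound (fun x => complex.Re (Phi x)) (fun x => complex.Re (phi x))) => // x xab.
    by have [] := dPhi x (lt2 x xab).
  exact: le_trans (nm_Re _) (pK x xab).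
apply: (@derive_bound (fun x => complex.Im (Phi x)) (fun x => complex.Im (phi x))) => // x xab.
  by have [] := dPhi x (lt2 x xab).
exact: le_trans (nm_Im _) (pK x xab).
Qed.

Lemma lint_Im_ge phi a b K : rcont phi -> -2 < a -> a <= b ->
  (forall x, a <= x <= b -> K <= complex.Im (phi x)) ->
  K * (b - a) <= complex.Im (lint phi a b).
Proof.
move=> /lintP[Phi dPhi E] a2 ab pK; rewrite E raddfB /=.
apply: (@derive_lbound (fun x => complex.Im (Phi x)) (fun x => complex.Im (phi x))) => // x xab.
have [|//] := dPhi x _.
by case/andP: xab => ax _; exact: lt_le_trans ax.
Qed.

(** The difference of two primitives has derivative 0. *)
Lemma lint_prim phi Phi a b : rcont phi -> primitive phi Phi ->
  -2 < a -> a <= b -> lint phi a b = Phi b - Phi a.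
Proof.
move=> /lintP[Psi dPsi E] dPhi a2 ab; rewrite E.
have lt2 x : a <= x <= b -> -2 < x by case/andP => ax _; exact: lt_le_trans ax.
have eqr (f g h : R -> R) : (forall x, a <= x <= b -> is_derive x 1 f (h x)) ->
    (forall x, a <= x <= b -> is_derive x 1 g (h x)) -> f b - f a = g b - g a.
  move=> df dg; apply/eqP; rewrite -subr_eq0 -normr_le0.
  have := @derive_bound (f - g) (h - h) a b 0 ab.
  rewrite mul0r => H.
  rewrite (le_trans _ (H _ _)) //.
  - have -> : f b - f a - (g b - g a) = (f b - g b) - (f a - g a) by ring.
    exact: lexx.
  - by move=> x xab; have := df x xab; have := dg x xab; move=> *; exact: is_deriveB.
  - by move=> x xab; rewrite -[(h - h) x]/(h x - h x) subrr normr0.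
have er : complex.Re (Psi b - Psi a) = complex.Re (Phi b - Phi a).
  rewrite !raddfB /=; apply: (eqr (fun x => complex.Re (Psi x)) (fun x => complex.Re (Phi x)) (fun x => complex.Re (phi x))) => x /lt2 xab.
    by have [] := dPsi x xab.
  by have [] := dPhi x xab.
have ei : complex.Im (Psi b - Psi a) = complex.Im (Phi b - Phi a).
  rewrite !raddfB /=; apply: (eqr (fun x => complex.Im (Psi x)) (fun x => complex.Im (Phi x)) (fun x => complex.Im (phi x))) => x /lt2 xab.
    by have [] := dPsi x xab.
  by have [] := dPhi x xab.
by apply/eqP; rewrite eq_complex er ei !eqxx.
Qed.

Lemma rcontP phi : rcont phi <-> forall x (e : R), 0 < e ->
  exists2 d : R, 0 < d & forall y, `|y - x| < d -> nm (phi y - phi x) < e.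
Proof.
split=> [[cr ci] x e e0|H].
  have e2 : 0 < e / 2 by rewrite divr_gt0.
  have /cvgrPdist_lt/(_ _ e2)/nbhs_ballP[d1 /= d10 H1] := cr x.
  have /cvgrPdist_lt/(_ _ e2)/nbhs_ballP[d2 /= d20 H2] := ci x.
  exists (Num.min d1 d2); first by rewrite lt_min d10.
  move=> y; rewrite lt_min => /andP[y1 y2].
  rewrite (le_lt_trans (nm_leD _)) // [e]splitr !raddfB /= ltrD // distrC.
    by apply: H1; rewrite /ball /= distrC.
  by apply: H2; rewrite /ball /= distrC.
split=> x; apply/cvgrPdist_lt => e /(H x)[d d0 dH]; apply/nbhs_ballP; exists d => //= y.
  rewrite /ball /= distrC => /dH; apply: le_lt_trans.
  by rewrite -raddfB /= nmB nm_Re.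
rewrite /ball /= distrC => /dH; apply: le_lt_trans.
by rewrite -raddfB /= nmB nm_Im.
Qed.

Lemma rcont_comp (F : C -> C) (l : R -> C) :
  (forall x, {for l x, continuous F}) ->
  (forall x y, nm (l x - l y) <= `|x - y|) -> rcont (fun x => F (l x)).
Proof.
move=> cF ll; apply/rcontP => x e e0.
have /contCP/(_ _ e0)[d d0 dH] := cF x; exists d => // y yx.
by apply: dH; rewrite (le_lt_trans (ll _ _)).
Qed.

Lemma is_deriveMl (f : R -> R) (k df x : R) : is_derive x 1 f df ->
  is_derive x 1 (fun t => k * f t) (k * df).
Proof. by move=> h; exact: is_deriveZ. Qed.

Lemma Re_lin (p q s t : R) (x y : C) :
  complex.Re ((p +i* q) * x + (s +i* t) * y) =
  (p * complex.Re x - q * complex.Im x) + (s * complex.Re y - t * complex.Im y).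
Proof. by case: x y => ? ? []. Qed.

Lemma Im_lin (p q s t : R) (x y : C) :
  complex.Im ((p +i* q) * x + (s +i* t) * y) =
  (p * complex.Im x + q * complex.Re x) + (s * complex.Im y + t * complex.Re y).
Proof. by case: x y => ? ? []. Qed.

(** The linear combination of two primitives is a primitive. *)
Lemma lint_lin phi psi (u v : C) a b : rcont phi -> rcont psi ->
  -2 < a -> a <= b ->
  lint (fun x => u * phi x + v * psi x) a b = u * lint phi a b + v * lint psi a b.
Proof.
move=> cphi cpsi a2 ab.
have [Phi dPhi E1] := lintP cphi; have [Psi dPsi E2] := lintP cpsi.
rewrite E1 E2 (lint_prim (Phi := fun x => u * Phi x + v * Psi x)) //; first by ring.
  case: cphi cpsi => [cr ci] [cr' ci'].
  case: u v => [p q] [s t]; split=> x.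
    have -> : (fun t0 => complex.Re ((p +i* q) * phi t0 + (s +i* t) * psi t0)) =
      (fun t0 => (p * complex.Re (phi t0) - q * complex.Im (phi t0)) +
         (s * complex.Re (psi t0) - t * complex.Im (psi t0))).
      by apply/funext => t0; exact: Re_lin.
    by apply: cvgD; (apply: cvgB; apply: cvgMr); [exact: cr|exact: ci|exact: cr'|exact: ci'].
  have -> : (fun t0 => complex.Im ((p +i* q) * phi t0 + (s +i* t) * psi t0)) =
    (fun t0 => (p * complex.Im (phi t0) + q * complex.Re (phi t0)) +
       (s * complex.Im (psi t0) + t * complex.Re (psi t0))).
    by apply/funext => t0; exact: Im_lin.
  by apply: cvgD; (apply: cvgD; apply: cvgMr); [exact: ci|exact: cr|exact: ci'|exact: cr'].
move=> x x2; have [r1 i1] := dPhi x x2; have [r2 i2] := dPsi x x2.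
case: u v => [p q] [s t]; split.
  have -> : (fun t0 => complex.Re ((p +i* q) * Phi t0 + (s +i* t) * Psi t0)) =
    ((fun t0 => p * complex.Re (Phi t0)) - (fun t0 => q * complex.Im (Phi t0))) +
       ((fun t0 => s * complex.Re (Psi t0)) - (fun t0 => t * complex.Im (Psi t0))).
    by apply/funext => t0; exact: Re_lin.
  have -> : complex.Re ((p +i* q) * phi x + (s +i* t) * psi x) =
     (p * complex.Re (phi x) - q * complex.Im (phi x)) +
         (s * complex.Re (psi x) - t * complex.Im (psi x)).
    exact: Re_lin.
  have j1 := is_deriveMl p r1; have j2 := is_deriveMl q i1.
  have j3 := is_deriveMl s r2; have j4 := is_deriveMl t i2.
  exact: is_deriveD (is_deriveB j1 j2) (is_deriveB j3 j4).
have -> : (fun t0 => complex.Im ((p +i* q) * Phi t0 + (s +i* t) * Psi t0)) =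
  ((fun t0 => p * complex.Im (Phi t0)) + (fun t0 => q * complex.Re (Phi t0))) +
     ((fun t0 => s * complex.Im (Psi t0)) + (fun t0 => t * complex.Re (Psi t0))).
  by apply/funext => t0; exact: Im_lin.
have -> : complex.Im ((p +i* q) * phi x + (s +i* t) * psi x) =
   (p * complex.Im (phi x) + q * complex.Re (phi x)) +
       (s * complex.Im (psi x) + t * complex.Re (psi x)).
  exact: Im_lin.
have j1 := is_deriveMl p i1; have j2 := is_deriveMl q r1.
have j3 := is_deriveMl s i2; have j4 := is_deriveMl t r2.
exact: is_deriveD (is_deriveD j1 j2) (is_deriveD j3 j4).
Qed.

End LineIntegral.

(** * Goursat's theorem for rectangles *)

Section Goursat.
Variable R : realType.
Local Notation C := (Cx R).
Implicit Types (F P : C -> C) (a b c d : R).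

(** The integral of [F] along the boundary of the rectangle, counterclockwise. *)
Definition rint F a b c d : C :=
  lint (fun x => F (x +i* c)) a b + 'i%C * lint (fun y => F (b +i* y)) c d
  - lint (fun x => F (x +i* d)) a b - 'i%C * lint (fun y => F (a +i* y)) c d.

Definition bd_cont F a b c d :=
  [/\ rcont (fun x => F (x +i* c)), rcont (fun y => F (b +i* y)),
      rcont (fun x => F (x +i* d)) & rcont (fun y => F (a +i* y))].

Lemma hline_lip (c x y : R) : nm ((x +i* c : C) - (y +i* c)) <= `|x - y|.
Proof. by rewrite (le_trans (nm_leD _)) //= subrr normr0 addr0. Qed.

Lemma vline_lip (c x y : R) : nm ((c +i* x : C) - (c +i* y)) <= `|x - y|.
Proof. by rewrite (le_trans (nm_leD _)) //= subrr normr0 add0r. Qed.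

Lemma rcont_h F (c : R) : continuous F -> rcont (fun x : R => F (x +i* c)).
Proof.
move=> cF; apply: (@rcont_comp R F (fun x : R => x +i* c)) => [x|x y].
  exact: cF.
exact: hline_lip.
Qed.

Lemma rcont_v F (c : R) : continuous F -> rcont (fun x : R => F (c +i* x)).
Proof.
move=> cF; apply: (@rcont_comp R F (fun x : R => c +i* x)) => [x|x y].
  exact: cF.
exact: vline_lip.
Qed.

Lemma bd_contW F a b c d : continuous F -> bd_cont F a b c d.
Proof. by move=> cF; split; [exact: rcont_h|exact: rcont_v|exact: rcont_h|exact: rcont_v]. Qed.

Lemma rint_hsplit F a m b c d : rint F a b c d = rint F a m c d + rint F m b c d.
Proof. by rewrite /rint (lint_split _ a m b) (lint_split (fun x => F (x +i* d)) a m b); ring. Qed.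

Lemma rint_vsplit F a b c m d : rint F a b c d = rint F a b c m + rint F a b m d.
Proof. by rewrite /rint (lint_split _ c m d) (lint_split (fun x => F (a +i* x)) c m d); ring. Qed.

Lemma rint_bound F a b c d (K : R) : bd_cont F a b c d ->
  -2 < a -> a <= b -> -2 < c -> c <= d ->
  (forall z, a <= complex.Re z <= b -> c <= complex.Im z <= d ->
     (complex.Re z == a) || (complex.Re z == b) || (complex.Im z == c) || (complex.Im z == d) ->
     nm (F z) <= K) ->
  nm (rint F a b c d) <= 4 * K * ((b - a) + (d - c)).
Proof.
move=> [h1 h2 h3 h4] a2 ab c2 cd FK.
have e1 : nm (lint (fun x => F (x +i* c)) a b) <= 2 * K * (b - a).
  by apply: lint_bound => // x xab; apply: FK; rewrite //= ?lexx ?cd ?eqxx ?orbT.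
have e2 : nm ('i%C * lint (fun y => F (b +i* y)) c d) <= 2 * K * (d - c).
  rewrite nmM nm_i mul1r.
  by apply: lint_bound => // x xab; apply: FK; rewrite //= ?lexx ?ab ?eqxx ?orbT.
have e3 : nm (lint (fun x => F (x +i* d)) a b) <= 2 * K * (b - a).
  by apply: lint_bound => // x xab; apply: FK; rewrite //= ?lexx ?cd ?eqxx ?orbT.
have e4 : nm ('i%C * lint (fun y => F (a +i* y)) c d) <= 2 * K * (d - c).
  rewrite nmM nm_i mul1r.
  by apply: lint_bound => // x xab; apply: FK; rewrite //= ?lexx ?ab ?eqxx ?orbT.
rewrite /rint (le_trans (nmD _ _)) // nmN.
have := nmD (lint (fun x => F (x +i* c)) a b + 'i%C * lint (fun y => F (b +i* y)) c d)
  (- lint (fun x => F (x +i* d)) a b).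
have := nmD (lint (fun x => F (x +i* c)) a b) ('i%C * lint (fun y => F (b +i* y)) c d).
by rewrite nmN; nra.
Qed.

Lemma rint_lin F P (u v : C) a b c d : bd_cont F a b c d -> bd_cont P a b c d ->
  -2 < a -> a <= b -> -2 < c -> c <= d ->
  rint (fun z => u * F z + v * P z) a b c d = u * rint F a b c d + v * rint P a b c d.
Proof.
move=> [h1 h2 h3 h4] [k1 k2 k3 k4] a2 ab c2 cd.
by rewrite /rint !(lint_lin (phi := fun x => F _) (psi := fun x => P _)) //; ring.
Qed.

(** The chain rule along a line run through at unit speed. *)
Lemma real_line_derive P (l : R -> C) (u v : C) (x : R) :
  (forall y, l y = l x + (y - x)%:C * v) -> nm v = 1 ->
  is_derive (l x) 1 P u ->
  is_derive x 1 (fun t => complex.Re (P (l t))) (complex.Re (v * u)) /\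
  is_derive x 1 (fun t => complex.Im (P (l t))) (complex.Im (v * u)).
Proof.
move=> lE v1 /is_deriveCP H.
have near (e : R) : 0 < e -> \forall y \near x,
    nm (P (l y) - P (l x) - (v * u) * (y - x)%:C) <= e * `|y - x|.
  move=> /H[d d0 dH]; apply/nbhs_ballP; exists d => //= y; rewrite /ball /= => yx.
  have dl : l y - l x = (y - x)%:C * v by rewrite lE addrAC subrr add0r.
  have nl : nm (l y - l x) = `|y - x| by rewrite dl nmM nm_real v1 mulr1.
  have := dH (l y); rewrite nl distrC => /(_ yx).
  by rewrite dl; rewrite [(v * u) * _]mulrAC [u * _]mulrC [v * _]mulrC.
have Rel (t : R) (w : C) : complex.Re (w * t%:C) = complex.Re w * t.
  by case: w => ? ?; rewrite /= mulr0 subr0.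
have Iml (t : R) (w : C) : complex.Im (w * t%:C) = complex.Im w * t.
  by case: w => ? ?; rewrite /= mulr0 add0r.
split; apply/is_deriveP => e /near; apply: filterS => y; apply: le_trans.
  by rewrite -Rel -!raddfB /= nm_Re.
by rewrite -Iml -!raddfB /= nm_Im.
Qed.

(** Each side contributes the increment of [P] between its ends, and the four increments
    cancel. *)
Lemma rint_exact F P a b c d : continuous F ->
  (forall z : C, is_derive z 1 P (F z)) ->
  -2 < a -> a <= b -> -2 < c -> c <= d -> rint F a b c d = 0.
Proof.
move=> cF dP a2 ab c2 cd; rewrite /rint.
have i0 : 'i%C != 0 :> C by rewrite -nm_gt0 nm_i.
have hl (y : R) : lint (fun x => F (x +i* y)) a b = P (b +i* y) - P (a +i* y).
  apply: (@lint_prim R _ (fun x => P (x +i* y))) => //; first exact: rcont_h.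
  move=> x _; rewrite -[F _]mul1r.
  apply: (@real_line_derive P (fun x => x +i* y)); last exact: nm1.
  by move=> z; apply/eqP; rewrite mulr1 eq_complex /= addr0 subrKC !eqxx.
have vl (x : R) : 'i%C * lint (fun y => F (x +i* y)) c d = P (x +i* d) - P (x +i* c).
  rewrite (@lint_prim R _ (fun y => (('i%C : C)^-1 * P (x +i* y) : C))) //; first by field.
    exact: rcont_v.
  move=> y _.
  have dQ : is_derive (x +i* y : C) 1 (fun z : C => (('i%C : C)^-1 * P z : C)) (('i%C : C)^-1 * F (x +i* y) : C).
    have := is_derive_mulC (is_derive_cst ('i%C^-1 : C) (x +i* y : C) 1) (dP (x +i* y)).
    by rewrite mul0r add0r.
  have := @real_line_derive (fun z : C => (('i%C : C)^-1 * P z : C)) (fun y => x +i* y) _ 'i%C y _ (nm_i R) dQ.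
  rewrite mulVKf //; apply.
  by move=> z; apply/eqP; rewrite eq_complex /= mul0r mulr0 mulr1 subr0 mul0r !addr0 subrKC !eqxx.
by rewrite !hl !vl; ring.
Qed.

Lemma is_derive_affine (u v w z : C) : is_derive z 1 (fun z : C => u + v * (z - w)) v.
Proof.
have h : is_derive z 1 (fun w0 : C => w0 - w) 1 by apply: is_derive_eq; rewrite subr0.
have h2 := is_deriveD (is_derive_cst u z 1) (is_derive_mulC (is_derive_cst v z 1) h).
by apply: is_derive_eq h2 _; rewrite mul0r !add0r /cst mulr1.
Qed.

Lemma rint_affine (u v w : C) a b c d :
  -2 < a -> a <= b -> -2 < c -> c <= d ->
  rint (fun z => u + v * (z - w)) a b c d = 0.
Proof.
have cF : continuous (fun z : C => u + v * (z - w)).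
  by move=> z; exact: is_derive_continuous (is_derive_affine u v w z).
move=> a2 ab c2 cd; apply: (rint_exact (P := fun z : C => u * (z - w) + (v / 2) * ((z - w) * (z - w))) cF _ a2 ab c2 cd).
move=> z.
have h : is_derive z 1 (fun w0 => w0 - w) 1 by apply: is_derive_eq; rewrite subr0.
have h2 := is_derive_mulC (is_derive_cst u z 1) h.
have h3 := is_derive_mulC (is_derive_cst (v / 2) z 1) (is_derive_mulC h h).
have h4 := is_deriveD h2 h3.
apply: is_derive_eq h4 _.
by rewrite /cst; field.
Qed.

(** Here [x k] is the lower end of the k-th interval, of length [A / 2 ^+ k]. *)
Lemma nested_point (A : R) (x : nat -> R) :
  (forall k, x k.+1 = x k \/ x k.+1 = x k + A / 2 ^+ k.+1) -> 0 <= A ->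
  exists t : R, forall k, x k <= t <= x k + A / 2 ^+ k.
Proof.
move=> xS A0.
have p2 k : (0 : R) < 2 ^+ k by rewrite exprn_gt0.
have half k : A / 2 ^+ k = A / 2 ^+ k.+1 + A / 2 ^+ k.+1.
  by rewrite exprS; field; rewrite gt_eqF.
have up k : x k <= x k.+1.
  by case: (xS k) => -> //; rewrite lerDl divr_ge0 // ltW.
have dn k : x k.+1 + A / 2 ^+ k.+1 <= x k + A / 2 ^+ k.
  by rewrite (half k) addrA; case: (xS k) => -> //; rewrite lerDl divr_ge0 // ltW.
have mono k n : (k <= n)%N -> x k <= x n.
  by elim: n => [|n IH]; [rewrite leqn0 => /eqP ->|rewrite leq_eqVlt => /orP[/eqP -> //|/IH h]; exact: le_trans (up n)].
have mono2 k n : (k <= n)%N -> x n + A / 2 ^+ n <= x k + A / 2 ^+ k.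
  by elim: n => [|n IH]; [rewrite leqn0 => /eqP ->|rewrite leq_eqVlt => /orP[/eqP -> //|/IH h]; exact: le_trans (dn n) h].
have ub k : ubound (range x) (x k + A / 2 ^+ k).
  move=> _ [n _ <-]; have [kn|nk] := leqP k n.
    by apply: le_trans (mono2 k n kn); rewrite lerDl divr_ge0 // ltW.
  by apply: le_trans (mono n k (ltnW nk)) _; rewrite lerDl divr_ge0 // ltW.
exists (sup (range x)) => k; apply/andP; split.
  apply: sup_ubound; last by exists k.
  by exists (x 0%N + A / 2 ^+ 0).
by apply: ge_sup; [exists (x 0%N); exists 0%N|exact: ub].
Qed.

Lemma exp2_ge (k : nat) : (k%:R : R) <= 2 ^+ k.
Proof.
elim: k => [|k IH]; first by rewrite expr0.
rewrite exprS mulr_natl mulr2n -natr1 lerD // (le_trans _ (exprn_ege1 _ _)) //.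
by rewrite ler1n.
Qed.

(** If the integral were nonzero, of modulus N, bisection would give nested rectangles,
    the k-th one with an integral of modulus at least N / 4^k. At their common point F
    is affine up to an error e times the diameter; the affine part integrates to 0 and
    the error contributes at most e times a constant over 4^k. *)
Theorem goursat F a b c d : continuous F ->
  -2 < a -> a <= b -> -2 < c -> c <= d ->
  (forall z, a <= complex.Re z <= b -> c <= complex.Im z <= d -> derivable F z 1) ->
  rint F a b c d = 0.
Proof.
move=> cF a2 ab c2 cd dF.
set A := b - a; set B := d - c.
have A0 : 0 <= A by rewrite subr_ge0.
have B0 : 0 <= B by rewrite subr_ge0.
have p2 k : (0 : R) < 2 ^+ k by rewrite exprn_gt0.
pose sub (q : R * R) k := rint F q.1 (q.1 + A / 2 ^+ k) q.2 (q.2 + B / 2 ^+ k).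
apply/eqP/negPn/negP => n0.
set N := nm (rint F a b c d).
have N0 : 0 < N by rewrite nm_gt0.
pose bad (q : R * R) k := N / 4 ^+ k <= nm (sub q k).
(* one of the four quarters is bad if the rectangle is; the choice is made total *)
have step (s : (R * R) * nat) : exists q' : R * R, bad s.1 s.2 ->
   [/\ bad q' s.2.+1, q'.1 = s.1.1 \/ q'.1 = s.1.1 + A / 2 ^+ s.2.+1 &
       q'.2 = s.1.2 \/ q'.2 = s.1.2 + B / 2 ^+ s.2.+1].
  case: s => [[x y] k] /=.
  have [h|nb] := pselect (exists q' : R * R,
     [/\ bad q' k.+1, q'.1 = x \/ q'.1 = x + A / 2 ^+ k.+1 &
       q'.2 = y \/ q'.2 = y + B / 2 ^+ k.+1]).
    by case: h => q' hq; exists q'.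
  exists (x, y) => bad0; exfalso.
  have sm (q : R * R) : (q.1 = x \/ q.1 = x + A / 2 ^+ k.+1) ->
       (q.2 = y \/ q.2 = y + B / 2 ^+ k.+1) -> nm (sub q k.+1) < N / 4 ^+ k.+1.
    by move=> h1 h2; rewrite ltNge; apply/negP => h; apply: nb; exists q.
  set hA := A / 2 ^+ k.+1 in sm; set hB := B / 2 ^+ k.+1 in sm.
  have eA : A / 2 ^+ k = hA + hA by rewrite /hA exprS; field; rewrite gt_eqF.
  have eB : B / 2 ^+ k = hB + hB by rewrite /hB exprS; field; rewrite gt_eqF.
  have e4 : N / 4 ^+ k = N / 4 ^+ k.+1 *+ 4.
    by rewrite exprS; field; rewrite gt_eqF // exprn_gt0.
  have s1 := sm (x, y) (or_introl erefl) (or_introl erefl).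
  have s2 := sm (x + hA, y) (or_intror erefl) (or_introl erefl).
  have s3 := sm (x, y + hB) (or_introl erefl) (or_intror erefl).
  have s4 := sm (x + hA, y + hB) (or_intror erefl) (or_intror erefl).
  have : sub (x, y) k = (sub (x, y) k.+1 + sub (x + hA, y) k.+1) +
                        (sub (x, y + hB) k.+1 + sub (x + hA, y + hB) k.+1).
    rewrite /sub /= eA eB -/hA -/hB !addrA.
    rewrite (rint_vsplit _ _ _ _ (y + hB)) (rint_hsplit _ _ (x + hA)).
    by rewrite [in X in _ + X](rint_hsplit _ _ (x + hA)) !addrA.
  move=> eq; move: bad0; rewrite /bad leNgt => /negP; apply.
  rewrite eq (le_lt_trans (nmD _ _)) // e4 (mulrnDr _ 2 2) ltrD //.
    by rewrite (le_lt_trans (nmD _ _)) // mulr2n ltrD.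
  by rewrite (le_lt_trans (nmD _ _)) // mulr2n ltrD.
have [f fP] := choice step.
pose q := fix q k := if k is k'.+1 then f (q k', k') else (a, c).
have qbad k : bad (q k) k.
  elim: k => [|k IH]; last by have [] := fP (q k, k) IH.
  by rewrite /bad /sub /= !expr0 !divr1 /A /B !subrKC.
have q1 k : (q k.+1).1 = (q k).1 \/ (q k.+1).1 = (q k).1 + A / 2 ^+ k.+1.
  by have [] := fP (q k, k) (qbad k).
have q2 k : (q k.+1).2 = (q k).2 \/ (q k.+1).2 = (q k).2 + B / 2 ^+ k.+1.
  by have [] := fP (q k, k) (qbad k).
have [x xP] := nested_point q1 A0; have [y yP] := nested_point q2 B0.
have x0 : a <= x <= b by have := xP 0%N; rewrite /= expr0 divr1 /A subrKC.
have y0 : c <= y <= d by have := yP 0%N; rewrite /= expr0 divr1 /B subrKC.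
have loc1 k : a <= (q k).1.
  elim: k => [//|k IH]; apply: le_trans IH _.
  by case: (q1 k) => -> //; rewrite lerDl divr_ge0 // ltW.
have loc2 k : c <= (q k).2.
  elim: k => [//|k IH]; apply: le_trans IH _.
  by case: (q2 k) => -> //; rewrite lerDl divr_ge0 // ltW.
have [u du] : exists u, is_derive (x +i* y : C) 1 F u.
  by exists ('D_1 F (x +i* y)); apply: derivableP; exact: dF.
set S := A + B; have S0 : 0 <= S by rewrite addr_ge0.
(* adding 1 covers a rectangle reduced to a point, for which S = 0 *)
pose e := N / (8 * (S ^+ 2 + 1)).
have e0 : 0 < e by rewrite divr_gt0 // mulr_gt0 // ltr_pwDr // sqr_ge0.
have [del del0 dH] := (iffLR (is_deriveCP _ _ _)) du e e0.
have [k kS] : exists k : nat, S / 2 ^+ k < del.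
  exists (Num.bound (S / del)).
  rewrite ltr_pdivrMr // mulrC -ltr_pdivrMr //.
  apply: lt_le_trans (exp2_ge _); apply: archi_boundP.
  by rewrite divr_ge0 // ltW.
have := qbad k; rewrite /bad leNgt => /negP; apply.
(* the remainder is separated from the affine part of [F] at the common point *)
have ->: sub (q k) k = rint (fun z => 1 * (F z - (F (x +i* y) + u * (z - (x +i* y)))) +
     1 * (F (x +i* y) + u * (z - (x +i* y))))
   (q k).1 ((q k).1 + A / 2 ^+ k) (q k).2 ((q k).2 + B / 2 ^+ k).
  by congr rint; apply/funext => z; rewrite !mul1r subrK.
set a' := (q k).1; set c' := (q k).2; set A' := A / 2 ^+ k; set B' := B / 2 ^+ k.
have A'0 : 0 <= A' by rewrite divr_ge0 // ltW.
have B'0 : 0 <= B' by rewrite divr_ge0 // ltW.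
have caff : continuous (fun z : C => F (x +i* y) + u * (z - (x +i* y))).
  by move=> z; exact: is_derive_continuous (is_derive_affine _ _ _ z).
have crem : continuous (fun z : C => F z - (F (x +i* y) + u * (z - (x +i* y)))).
  by move=> z; exact: (continuousB (cF z) (caff z)).
have a'2 : -2 < a' by exact: lt_le_trans (loc1 k).
have c'2 : -2 < c' by exact: lt_le_trans (loc2 k).
have a'l : a' <= a' + A' by rewrite lerDl.
have c'l : c' <= c' + B' by rewrite lerDl.
rewrite (rint_lin 1 1 (bd_contW _ _ _ _ crem) (bd_contW _ _ _ _ caff) a'2 a'l c'2 c'l).
rewrite (rint_affine _ _ _ a'2 a'l c'2 c'l) mulr0 addr0 mul1r.
have S'E : A' + B' = S / 2 ^+ k by rewrite /A' /B' -mulrDl.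
apply: (@le_lt_trans _ _ (4 * (e * (A' + B')) * ((a' + A' - a') + (c' + B' - c')))).
  apply: rint_bound => //; first exact: bd_contW.
  move=> z zr zi _.
  have zn : nm (z - (x +i* y)) <= A' + B'.
    rewrite (le_trans (nm_leD _)) // lerD //.
      have /andP[z1 z2] := zr; have /andP[x1 x2] := xP k.
      rewrite raddfB /= ler_norml; apply/andP; split.
        by rewrite -/a' -/A' in x1 x2; lra.
      by rewrite -/a' -/A' in x1 x2; lra.
    have /andP[z1 z2] := zi; have /andP[x1 x2] := yP k.
    rewrite raddfB /= ler_norml; apply/andP; split.
      by rewrite -/c' -/B' in x1 x2; lra.
    by rewrite -/c' -/B' in x1 x2; lra.
  rewrite opprD addrA (le_trans (dH z _)) ?ler_wpM2l ?(ltW e0) //.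
  by rewrite (le_lt_trans zn) // S'E.
rewrite [a' + A']addrC addrK [c' + B']addrC addrK S'E.
have -> : 4 * (e * (S / 2 ^+ k)) * (S / 2 ^+ k) = 4 * e * S ^+ 2 / 4 ^+ k.
  have -> : (4 : R) ^+ k = 2 ^+ k * 2 ^+ k by rewrite -exprMn -natrM.
  by field; rewrite gt_eqF.
rewrite ltr_pM2r ?invr_gt0 ?exprn_gt0 // /e.
have S2 := sqr_ge0 S.
rewrite (_ : 4 * _ * _ = N * (S ^+ 2 / (2 * (S ^+ 2 + 1)))); last first.
  by field; rewrite gt_eqF // ltr_pwDr.
rewrite gtr_pMr // ltr_pdivrMr ?mulr_gt0 ?ltr_pwDr // mul1r.
by lra.
Qed.

End Goursat.

(** * The maximum principle on squares *)

Section MaximumPrinciple.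
Variable R : realType.
Local Notation C := (Cx R).
Implicit Types (F f h : C -> C) (a b c d : R).

Lemma near_neq (z w : C) : z != w -> \forall v \near z, v != w.
Proof.
move=> zw; apply/nearCP; exists (nm (z - w)); first by rewrite nm_gt0 subr_eq0.
by move=> v; apply: contraTneq => ->; rewrite nmB ltxx.
Qed.

(** The rectangles that avoid [w] contribute 0 by Goursat; a small square around [w] is
    left, on which [F] is bounded and whose perimeter is arbitrarily small. *)
Lemma goursat_punctured F a b c d (w : C) : continuous F ->
  -2 < a -> -2 < c -> a < complex.Re w < b -> c < complex.Im w < d ->
  (forall z, a <= complex.Re z <= b -> c <= complex.Im z <= d -> z != w ->
    derivable F z 1) ->
  rint F a b c d = 0.
Proof.
move=> cF a2 c2 /andP[ax xb] /andP[cy yd] dF.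
set x := complex.Re w in ax xb; set y := complex.Im w in cy yd.
have [del del0 dH] := (iffLR (contCP _ _)) (cF w) 1 ltr01.
pose K := nm (F w) + 1.
have K0 : 0 < K by rewrite ltr_pwDr // nm_ge0.
apply/eqP/negPn/negP => n0.
set N := nm (rint F a b c d); have N0 : 0 < N by rewrite nm_gt0.
have [e [e0 ea eb ec [ed edel eN]]] : exists e : R, [/\ 0 < e, e < x - a, e < b - x, e < y - c &
    [/\ e < d - y, 2 * e < del & 16 * K * e < N]].
  pose m := Num.min (Num.min (Num.min (x - a) (b - x)) (Num.min (y - c) (d - y)))
    (Num.min (del / 2) (N / (16 * K))).
  have m0 : 0 < m by rewrite !lt_min !subr_gt0 ax xb cy yd !divr_gt0 // mulr_gt0.
  have mm : m / 2 < m by rewrite ltr_pdivrMr // ltr_pMr // ltr1n.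
  have [h1 h2] : m <= Num.min (Num.min (x - a) (b - x)) (Num.min (y - c) (d - y)) /\
     m <= Num.min (del / 2) (N / (16 * K)).
    by apply/andP; rewrite -le_min.
  move: h1 h2; rewrite !le_min => /andP[/andP[h1 h2] /andP[h3 h4]] /andP[h5 h6].
  exists (m / 2); rewrite divr_gt0 //; split; rewrite ?(lt_le_trans mm) //.
  split; first by rewrite ?(lt_le_trans mm).
    by rewrite mulrC -ltr_pdivlMr // ?(lt_le_trans mm).
  by rewrite mulrC -ltr_pdivlMr ?mulr_gt0 // ?(lt_le_trans mm).
have e2 : x - e <= x + e by lra.
have e3 : y - e <= y + e by lra.
have Z a' b' c' d' : a <= a' -> a' <= b' -> b' <= b -> c <= c' -> c' <= d' -> d' <= d ->
    [|| b' < x, x < a', d' < y | y < c'] -> rint F a' b' c' d' = 0.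
  move=> h1 h2 h3 h4 h5 h6 ne; apply: goursat => //.
  - exact: lt_le_trans h1.
  - exact: lt_le_trans h4.
  - move=> z /andP[z1 z2] /andP[z3 z4]; apply: dF.
    + by rewrite (le_trans h1 z1) (le_trans z2 h3).
    + by rewrite (le_trans h4 z3) (le_trans z4 h6).
    + apply: contraTneq ne => zw; move: z1 z2 z3 z4; rewrite zw -/x -/y => z1 z2 z3 z4.
      by rewrite !ltNge z1 z2 z3 z4.
have E : rint F a b c d = rint F (x - e) (x + e) (y - e) (y + e).
  rewrite (rint_hsplit _ a (x - e) b) (rint_hsplit _ (x - e) (x + e) b).
  rewrite (rint_vsplit _ (x - e) (x + e) c (y - e) d).
  rewrite (rint_vsplit _ (x - e) (x + e) (y - e) (y + e) d).
  have -> : rint F a (x - e) c d = 0.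
    by apply: Z; rewrite ?lexx //; try lra; apply/orP; left; lra.
  have -> : rint F (x + e) b c d = 0.
    by apply: Z; rewrite ?lexx //; try lra; apply/or4P; apply: Or42; lra.
  have -> : rint F (x - e) (x + e) c (y - e) = 0.
    by apply: Z; rewrite ?lexx //; try lra; apply/or4P; apply: Or43; lra.
  have -> : rint F (x - e) (x + e) (y + e) d = 0.
    by apply: Z; rewrite ?lexx //; try lra; apply/or4P; apply: Or44; lra.
  by rewrite !add0r !addr0.
move: N0 eN; rewrite /N E => N0; apply/negP; rewrite -leNgt.
apply: (@le_trans _ _ (4 * K * ((x + e - (x - e)) + (y + e - (y - e))))).
  apply: rint_bound => //; try lra; first exact: bd_contW.
  move=> z /andP[z1 z2] /andP[z3 z4] _.
  have : nm (z - w) < del.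
    rewrite (le_lt_trans (nm_leD _)) // (le_lt_trans _ edel) //.
    rewrite mulr2n mulrDl !mul1r lerD // raddfB /= ler_norml -/x -/y.
      by apply/andP; split; lra.
    by apply/andP; split; lra.
  move=> /dH h; rewrite -(subrK (F w) (F z)) (le_trans (nmD _ _)) // addrC lerD2l.
  exact: ltW.
have -> : x + e - (x - e) + (y + e - (y - e)) = 4 * e by ring.
by lra.
Qed.

Lemma lint_Im_geM (phi : R -> C) (u : C) a b (K : R) : rcont phi -> -2 < a -> a <= b ->
  (forall x, a <= x <= b -> K <= complex.Im (u * phi x)) ->
  K * (b - a) <= complex.Im (u * lint phi a b).
Proof.
move=> cp a2 ab H.
have <- : lint (fun x => u * phi x + 0 * phi x) a b = u * lint phi a b.
  by rewrite lint_lin // mul0r addr0.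
apply: lint_Im_ge => // [|x xab]; last by rewrite mul0r addr0; exact: H.
have -> : (fun x => u * phi x + 0 * phi x) = (fun x => u * phi x).
  by apply/funext => x; rewrite mul0r addr0.
apply/rcontP => x e e0.
have u0 : 0 < nm u + 1 by rewrite ltr_pwDr // nm_ge0.
have eu : 0 < e / (nm u + 1) by rewrite divr_gt0.
have [d d0 dH] := (iffLR (rcontP _)) cp x _ eu.
exists d => // y /dH; rewrite -mulrBr nmM ltr_pdivlMr // => h.
apply: le_lt_trans h; rewrite mulrC ler_wpM2l ?nm_ge0 // lerDl //.
Qed.

Lemma rint_ext F f a b c d :
  (forall x, F (x +i* c) = f (x +i* c)) -> (forall x, F (x +i* d) = f (x +i* d)) ->
  (forall x, F (a +i* x) = f (a +i* x)) -> (forall x, F (b +i* x) = f (b +i* x)) ->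
  rint F a b c d = rint f a b c d.
Proof.
by move=> /funext h1 /funext h2 /funext h3 /funext h4; rewrite /rint h1 h2 h3 h4.
Qed.

Section Square.
Variables (rho : R) (w : C).
Hypotheses (rho0 : 0 < rho) (rho1 : rho <= 1).
Hypotheses (wx : `|complex.Re w| < rho) (wy : `|complex.Im w| < rho).

Let x := complex.Re w.
Let y := complex.Im w.
Let xE : - rho < x /\ x < rho.
Proof. by move: wx; rewrite ltr_norml => /andP[]. Qed.
Let yE : - rho < y /\ y < rho.
Proof. by move: wy; rewrite ltr_norml => /andP[]. Qed.

Let k (z : C) : C := (z - w)^-1.

Lemma continuous_kernel z : z != w -> {for z, continuous k}.
Proof.
move=> zw; have h : is_derive z 1 (fun w0 : C => w0 - w) 1.
  by apply: is_derive_eq; rewrite subr0.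
have := is_derive_divC (is_derive_cst (1 : C) z 1) h.
rewrite subr_eq0 => /(_ zw) /is_derive_continuous; apply: continuous_near.
by near=> t; rewrite div1r.
Unshelve. all: by end_near. Qed.

Lemma off_h (c t : R) : c != y -> (t +i* c : C) != w.
Proof. by apply: contra => /eqP h; rewrite /y -h. Qed.
Lemma off_v (c t : R) : c != x -> (c +i* t : C) != w.
Proof. by apply: contra => /eqP h; rewrite /x -h. Qed.

Let b1 : - rho != y. Proof. by rewrite lt_eqF //; case: yE. Qed.
Let b2 : rho != y. Proof. by rewrite gt_eqF //; case: yE. Qed.
Let b3 : - rho != x. Proof. by rewrite lt_eqF //; case: xE. Qed.
Let b4 : rho != x. Proof. by rewrite gt_eqF //; case: xE. Qed.

Lemma bd_cont_off f : (forall z, z != w -> {for z, continuous f}) ->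
  bd_cont f (- rho) rho (- rho) rho.
Proof.
move=> cf; split; (apply: rcont_comp; [move=> t; apply: cf|]).
- exact: off_h.
- exact: hline_lip.
- exact: off_v.
- exact: vline_lip.
- exact: off_h.
- exact: hline_lip.
- exact: off_v.
- exact: vline_lip.
Qed.

Lemma Im_inv (s t : R) : complex.Im ((s +i* t : C)^-1) = - t / (s ^+ 2 + t ^+ 2).
Proof. by rewrite mulNr. Qed.
Lemma Re_inv (s t : R) : complex.Re ((s +i* t : C)^-1) = s / (s ^+ 2 + t ^+ 2).
Proof. by []. Qed.

(** On each side of the square the integrand, multiplied by the direction of the side,
    has an imaginary part of constant sign. This bounds the integral of 1 / (z - w) away
    from 0, which is all that the maximum principle asks of its value. *)
Lemma rint_kernel : exists2 kap : R, 0 < kap & kap <= nm (rint k (- rho) rho (- rho) rho).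
Proof.
have [x1 x2] := xE; have [y1 y2] := yE.
have [c1 c2 c3 c4] := bd_cont_off continuous_kernel.
have rle1 := rho1; have r2 : -2 < - rho by lra.
have rr : - rho <= rho by lra.
have kE (s t : R) : k (s +i* t) = ((s - x) +i* (t - y))^-1 by rewrite /k /x /y; case: (w).
exists ((y + rho) / 8 * (rho - - rho)).
  by rewrite mulr_gt0 ?divr_gt0 //; lra.
apply: le_trans (nm_Im _); apply: le_trans (ler_norm _).
have h1 : (y + rho) / 8 * (rho - - rho) <= complex.Im (1 * lint (fun x => k (x +i* - rho)) (- rho) rho).
  apply: lint_Im_geM => // s /andP[s1 s2]; rewrite mul1r kE Im_inv opprB opprK.
  have t0 : 0 < (- rho - y) ^+ 2 by rewrite exprn_even_gt0 //= lt_eqF //; lra.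
  apply: ler_wpM2l; first lra.
  rewrite lef_pV2 ?posrE //; first by nra.
  by rewrite ltr_wpDl ?sqr_ge0.
have h2 : 0 * (rho - - rho) <= complex.Im ('i%C * lint (fun y => k (rho +i* y)) (- rho) rho).
  apply: lint_Im_geM => // s /andP[s1 s2]; rewrite mulrC ImiRe kE Re_inv.
  by apply: divr_ge0; [lra|rewrite addr_ge0 ?sqr_ge0].
have h3 : 0 * (rho - - rho) <= complex.Im (-1 * lint (fun x => k (x +i* rho)) (- rho) rho).
  apply: lint_Im_geM => // s /andP[s1 s2]; rewrite mulN1r raddfN /= kE Im_inv -mulNr opprK.
  by apply: divr_ge0; [lra|rewrite addr_ge0 ?sqr_ge0].
have h4 : 0 * (rho - - rho) <= complex.Im (- 'i%C * lint (fun y => k (- rho +i* y)) (- rho) rho).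
  apply: lint_Im_geM => // s /andP[s1 s2]; rewrite mulNr raddfN /= mulrC ImiRe kE Re_inv -mulNr.
  by apply: divr_ge0; [lra|rewrite addr_ge0 ?sqr_ge0].
have ImD (u v : C) : complex.Im (u + v) = complex.Im u + complex.Im v by exact: raddfD.
have -> : rint k (- rho) rho (- rho) rho =
    1 * lint (fun x => k (x +i* - rho)) (- rho) rho
    + 'i%C * lint (fun y => k (rho +i* y)) (- rho) rho
    + -1 * lint (fun x => k (x +i* rho)) (- rho) rho
    + - 'i%C * lint (fun y => k (- rho +i* y)) (- rho) rho.
  by rewrite /rint; ring.
rewrite !ImD; rewrite !mul0r in h2 h3 h4.
rewrite -[leLHS]addr0 lerD // -[leLHS]addr0 lerD // -[leLHS]addr0 lerD //.
Qed.

(** The quotient (h z - h w) / (z - w) is continuous, with value h'(w) at w, and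
    holomorphic off w; its integral is 0 by Goursat. *)
Lemma cauchy_kernel h : continuous h ->
  (forall z, `|complex.Re z| <= rho -> `|complex.Im z| <= rho -> derivable h z 1) ->
  h w * rint k (- rho) rho (- rho) rho = rint (fun z => h z * k z) (- rho) rho (- rho) rho.
Proof.
move=> ch dh.
have [x1 x2] := xE; have [y1 y2] := yE.
have dw : is_derive w 1 h ('D_1 h w) by apply: derivableP; apply: dh; exact: ltW.
have [u [cu uw hu]] := (iffLR (caratheodoryP _ _ _)) dw.
have uE z : z != w -> u z = (h z - h w) / (z - w).
  by move=> zw; rewrite (hu z) addrAC subrr add0r mulfK // subr_eq0.
have near_u (z : C) : z != w -> \forall t \near z, (h t - h w) / (t - w) = u t.
  by move=> zw; apply: filterS (near_neq zw) => t /uE.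
have du z : z != w -> derivable h z 1 -> derivable u z 1.
  move=> zw dz.
  have hz : is_derive z 1 (fun t => h t - h w) ('D_1 h z).
    have := is_deriveB (derivableP dz) (is_derive_cst (h w) z 1).
    by rewrite subr0.
  have h2 : is_derive z 1 (fun w0 : C => w0 - w) 1.
    by apply: is_derive_eq; rewrite subr0.
  have zw0 : z - w != 0 by rewrite subr_eq0.
  have [] := is_derive_near (near_u z zw) (is_derive_divC hz h2 zw0).
  by [].
have cu' : continuous u.
  move=> z; have [->//|zw] := eqVneq z w.
  apply: continuous_near (near_u z zw) _.
  apply: (@continuousM _ _ (fun t => h t - h w) (fun t => (t - w)^-1)).
    by apply: (@continuousB _ _ _ h (fun=> h w)); [exact: ch|exact: cst_continuous].
  exact: continuous_kernel.
have rle1 := rho1; have r2 : -2 < - rho by lra.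
have rr : - rho <= rho by lra.
have u0 : rint u (- rho) rho (- rho) rho = 0.
  have wx' : - rho < complex.Re w < rho by rewrite -ltr_norml.
  have wy' : - rho < complex.Im w < rho by rewrite -ltr_norml.
  apply: (goursat_punctured cu' r2 r2 wx' wy') => z.
  by rewrite -!ler_norml => z1 z2 zw; exact: (du z zw (dh z z1 z2)).
have chk : bd_cont (fun z => h z * k z) (- rho) rho (- rho) rho.
  apply: bd_cont_off => z zw; apply: (@continuousM _ _ h k); first exact: ch.
  exact: continuous_kernel.
have ck : bd_cont k (- rho) rho (- rho) rho by exact: bd_cont_off continuous_kernel.
have ue z : z != w -> u z = 1 * (h z * k z) + (- h w) * k z.
  by move=> /uE ->; rewrite mul1r -mulrDl.
have := rint_lin 1 (- h w) chk ck r2 rr r2 rr.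
rewrite -(@rint_ext u); first last.
- by move=> t; apply: ue; exact: off_v.
- by move=> t; apply: ue; exact: off_v.
- by move=> t; apply: ue; exact: off_h.
- by move=> t; apply: ue; exact: off_h.
by rewrite u0 mul1r mulNr => /esym/eqP; rewrite subr_eq0 => /eqP.
Qed.

(** Landau's trick: taking n-th roots removes the constants. *)
Lemma pow_le_const (t M kap B : R) : 0 <= t -> 0 <= M -> 0 < kap ->
  (forall n, t ^+ n * kap <= B * M ^+ n) -> t <= M.
Proof.
move=> t0 M0 k0 H; rewrite leNgt; apply/negP => Mt.
have tp : 0 < t by exact: le_lt_trans Mt.
have B0 : 0 < B.
  by have := H 0%N; rewrite !expr0 mul1r mulr1; exact: lt_le_trans.
have q1 : `|M / t| < 1 by rewrite ger0_norm ?divr_ge0 ?(ltW tp) // ltr_pdivrMr // mul1r.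
have /cvgrPdist_lt/(_ (kap / B)) := cvg_expr q1.
rewrite divr_gt0 // => /(_ isT)[n _ /(_ n (leqnn n))] /=.
rewrite sub0r normrN ger0_norm; last by rewrite exprn_ge0 // divr_ge0 // ltW.
rewrite expr_div_n ltr_pdivrMr ?exprn_gt0 // mulrAC ltr_pdivlMr //.
by rewrite mulrC [kap * _]mulrC ltNge H.
Qed.

(** The Cauchy formula for [f ^+ n] bounds the n-th power of [nm (f w)] by a constant
    times [M ^+ n]. *)
Lemma max_continuous f (M : R) : continuous f ->
  (forall z, `|complex.Re z| <= rho -> `|complex.Im z| <= rho -> derivable f z 1) ->
  (forall z, `|complex.Re z| <= rho -> `|complex.Im z| <= rho ->
     (`|complex.Re z| == rho) || (`|complex.Im z| == rho) -> nm (f z) <= M) ->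
  nm (f w) <= M.
Proof.
move=> cf df fM.
have [x1 x2] := xE; have [y1 y2] := yE.
have M0 : 0 <= M.
  apply: le_trans (nm_ge0 (f (rho%:C))) (fM _ _ _ _) => /=.
  - by rewrite ger0_norm // ltW.
  - by rewrite normr0 ltW.
  - by rewrite ger0_norm ?eqxx // ltW.
have [kap kap0 kapk] := rint_kernel.
pose del := Num.min (Num.min (x + rho) (rho - x)) (Num.min (y + rho) (rho - y)).
have del0 : 0 < del by rewrite !lt_min; apply/andP; split; apply/andP; split; lra.
have [d1 d2 d3 d4] : [/\ del <= x + rho, del <= rho - x, del <= y + rho & del <= rho - y].
  have : del <= del by [].
  by rewrite {2}/del !le_min => /andP[/andP[? ?] /andP[? ?]].
apply: (@pow_le_const _ _ kap (4 * del^-1 * ((rho - - rho) + (rho - - rho)))) => //.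
  exact: nm_ge0.
move=> n.
have cfn : continuous (fun z => f z ^+ n).
  move=> z; elim: n => [|n IH].
    by apply: (@continuous_near C C (fun=> 1)); [near=> t; rewrite expr0|exact: cst_continuous].
  apply: (@continuous_near C C (fun z => f z * f z ^+ n)).
    by near=> t; rewrite exprS.
  by apply: continuousM; [exact: cf|exact: IH].
have dfn z : `|complex.Re z| <= rho -> `|complex.Im z| <= rho ->
    derivable (fun z => f z ^+ n) z 1.
  move=> z1 z2; rewrite (_ : (fun z => f z ^+ n) = f ^+ n).
    exact: derivableX (df z z1 z2).
  by apply/funext => t; elim: n {cfn} => [|n IH]; rewrite ?expr0 // !exprS IH.
have E := cauchy_kernel cfn dfn.
apply: (@le_trans _ _ (nm (f w ^+ n * rint k (- rho) rho (- rho) rho))).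
  by rewrite nmM nmX ler_wpM2l // exprn_ge0 // nm_ge0.
rewrite E.
have -> : 4 * del^-1 * (rho - - rho + (rho - - rho)) * M ^+ n =
   4 * (M ^+ n * del^-1) * ((rho - - rho) + (rho - - rho)) by ring.
have rle1 := rho1; have r2 : -2 < - rho by lra.
have rr : - rho <= rho by lra.
have chk : bd_cont (fun z => f z ^+ n * k z) (- rho) rho (- rho) rho.
  apply: bd_cont_off => z zw; apply: (@continuousM _ _ (fun z => f z ^+ n) k).
    exact: cfn.
  exact: continuous_kernel.
apply: (rint_bound chk r2 rr r2 rr).
move=> z zx zy zb.
have zb' : (`|complex.Re z| == rho) || (`|complex.Im z| == rho).
  have nr : `|rho| = rho by rewrite ger0_norm // ltW.
  by case/orP: zb => [/orP[/orP[]|]|] /eqP ->; rewrite ?normrN nr eqxx ?orbT.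
rewrite nmM nmX ler_pM ?exprn_ge0 ?nm_ge0 //.
  by rewrite lerXn2r ?nnegrE ?nm_ge0 // fM // ler_norml.
have zw : del <= nm (z - w).
  case/orP: zb => [/orP[/orP[]|]|] /eqP zE.
  - apply: le_trans (nm_Re _); rewrite raddfB /= zE -/x distrC ger0_norm; lra.
  - apply: le_trans (nm_Re _); rewrite raddfB /= zE -/x ger0_norm; lra.
  - apply: le_trans (nm_Im _); rewrite raddfB /= zE -/y distrC ger0_norm; lra.
  - apply: le_trans (nm_Im _); rewrite raddfB /= zE -/y ger0_norm; lra.
by rewrite nmV lef_pV2 // posrE // (lt_le_trans del0).
Unshelve. all: by end_near. Qed.

End Square.

Definition clamp (tau t : R) := Num.max (- tau) (Num.min t tau).

Lemma clamp_lip (tau : R) : 0 <= tau ->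
  forall s t, `|clamp tau s - clamp tau t| <= `|s - t|.
Proof.
move=> t0 s t; have := ler_norm (s - t); have := ler_norm (t - s); rewrite (distrC t).
rewrite /clamp /Num.max /Num.min ler_norml; move: `|s - t| => v h1 h2.
case: (ltP s tau) => hs; case: (ltP t tau) => ht; case: ltP => h3; case: ltP => h4;
by apply/andP; split; lra.
Qed.

(** Composing [f] with a Lipschitz retraction onto a slightly larger square makes it
    continuous on the whole plane, as the integrals require. *)
Theorem maximum_principle f (rho sigma M : R) (w : C) :
  0 < rho -> rho < sigma -> sigma <= 1 ->
  (forall z, `|complex.Re z| < sigma -> `|complex.Im z| < sigma -> derivable f z 1) ->
  (forall z, `|complex.Re z| <= rho -> `|complex.Im z| <= rho ->
     (`|complex.Re z| == rho) || (`|complex.Im z| == rho) -> nm (f z) <= M) ->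
  `|complex.Re w| <= rho -> `|complex.Im w| <= rho -> nm (f w) <= M.
Proof.
move=> rho0 rs s1 df fM wx wy.
have [wx'|] := ltP `|complex.Re w| rho; last first.
  by move=> h; apply: fM => //; rewrite eq_le wx h.
have [wy'|] := ltP `|complex.Im w| rho; last first.
  by move=> h; apply: fM => //; rewrite orbC eq_le wy h.
(* [P] retracts the plane onto the square of half-side [tau] *)
pose tau := (rho + sigma) / 2.
have rt : rho < tau by rewrite /tau; lra.
have ts : tau < sigma by rewrite /tau; lra.
pose cl := clamp tau.
have clE t : `|t| <= tau -> cl t = t.
  rewrite ler_norml => /andP[t1 t2]; rewrite /cl /clamp.
  by rewrite (min_idPl t2) (max_idPr t1).
have cltau t : `|cl t| <= tau.
  have t0 : - tau <= tau by rewrite /tau; lra.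
  by rewrite ler_norml /cl /clamp le_max lexx /= ge_max t0 ge_min lexx orbT.
have cll := clamp_lip (ltW (lt_trans rho0 rt)).
pose P (z : C) : C := cl (complex.Re z) +i* cl (complex.Im z).
have cP : continuous P.
  move=> z; apply/contCP => e e0; exists (e / 2); first by rewrite divr_gt0.
  move=> v vz; rewrite (le_lt_trans (nm_leD _)) // [e]splitr /= ltrD //.
    apply: le_lt_trans (cll _ _) _; apply: le_lt_trans vz.
    by rewrite -raddfB /= nm_Re.
  apply: le_lt_trans (cll _ _) _; apply: le_lt_trans vz.
  by rewrite -raddfB /= nm_Im.
have PE z : `|complex.Re z| <= tau -> `|complex.Im z| <= tau -> P z = z.
  by move=> z1 z2; rewrite /P !clE //; case: (z).
have wE : P w = w by apply: PE; exact: le_trans (ltW rt).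
have rle1 : rho <= 1 by apply: le_trans s1; exact: ltW (lt_trans rt ts).
have rsig : rho < sigma := rs.
have cfP : continuous (f \o P).
  move=> z; apply: (@continuous_comp _ _ _ P f); first exact: cP.
  apply: is_derive_continuous; apply: derivableP; apply: df.
    exact: le_lt_trans (cltau _) ts.
  exact: le_lt_trans (cltau _) ts.
have dfP z : `|complex.Re z| <= rho -> `|complex.Im z| <= rho -> derivable (f \o P) z 1.
  move=> z1 z2.
  have dz := df z (le_lt_trans z1 rsig) (le_lt_trans z2 rsig).
  apply: near_eq_derivable dz.
  apply/nearCP; exists (tau - rho); first by rewrite subr_gt0.
  move=> v vz; rewrite /= PE //.
    rewrite -[complex.Re v](subrK (complex.Re z)) (le_trans (ler_normD _ _)) //.
    have := nm_Re (v - z); rewrite raddfB /=; lra.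
  rewrite -[complex.Im v](subrK (complex.Im z)) (le_trans (ler_normD _ _)) //.
  by have := nm_Im (v - z); rewrite raddfB /=; lra.
have MfP z : `|complex.Re z| <= rho -> `|complex.Im z| <= rho ->
    (`|complex.Re z| == rho) || (`|complex.Im z| == rho) -> nm ((f \o P) z) <= M.
  move=> z1 z2 zb.
  by rewrite /= (PE z (le_trans z1 (ltW rt)) (le_trans z2 (ltW rt))); exact: fM.
rewrite -wE.
exact: (max_continuous rho0 rle1 wx' wy' cfP dfP MfP).
Qed.

End MaximumPrinciple.

(** * Schwarz lemma and strong maximum principle *)

Section Schwarz.
Variable R : realType.
Local Notation C := (Cx R).
Implicit Types (f g : C -> C) (s : seq C).

Definition sq (r : R) : set C := [set z | `|complex.Re z| < r /\ `|complex.Im z| < r].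

Definition csq (r : R) : set C := [set z | `|complex.Re z| <= r /\ `|complex.Im z| <= r].

Lemma nm_csq (r : R) z : csq r z -> nm z <= 2 * r.
Proof. by move=> [h1 h2]; rewrite (le_trans (nm_leD _)) // mulr2n mulrDl !mul1r lerD. Qed.

Lemma sq0 (r : R) : 0 < r -> sq r 0.
Proof. by move=> r0; split; rewrite /= normr0. Qed.

Lemma sq_csq (r r' : R) : r < r' -> csq r `<=` sq r'.
Proof. by move=> h z [h1 h2]; split; exact: le_lt_trans h. Qed.

Lemma sub_sq (r r' : R) : r <= r' -> sq r `<=` sq r'.
Proof. by move=> h z [h1 h2]; split; exact: lt_le_trans h. Qed.

Lemma sub_csq (r : R) : sq r `<=` csq r.
Proof. by move=> z [h1 h2]; split; exact: ltW. Qed.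

Lemma nm_sq (r : R) z : nm z < r -> sq r z.
Proof. by move=> h; split; apply: le_lt_trans h; [exact: nm_Re|exact: nm_Im]. Qed.

Lemma open_sq (r : R) : open (sq r).
Proof.
rewrite openE => z [h1 h2]; apply/nbhsCP.
pose e := Num.min (r - `|complex.Re z|) (r - `|complex.Im z|).
have e0 : 0 < e by rewrite lt_min !subr_gt0 h1.
exists e => // w; rewrite lt_min => /andP[w1 w2]; split.
  rewrite -[complex.Re w](subrK (complex.Re z)) (le_lt_trans (ler_normD _ _)) // -ltrBrDr.
  by apply: le_lt_trans w1; rewrite -raddfB /= nm_Re.
rewrite -[complex.Im w](subrK (complex.Im z)) (le_lt_trans (ler_normD _ _)) // -ltrBrDr.
by apply: le_lt_trans w2; rewrite -raddfB /= nm_Im.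
Qed.

Lemma is_derive_subC (a z : C) : is_derive z 1 (fun w : C => w - a) 1.
Proof. by apply: is_derive_eq; rewrite subr0. Qed.

Lemma derivable_prodB s (z : C) : derivable (fun w : C => \prod_(a <- s) (w - a)) z 1.
Proof.
elim: s => [|a s IH].
  rewrite (_ : (fun w : C => _) = cst 1); first exact: derivable_cst.
  by apply/funext => w; rewrite big_nil.
rewrite (_ : (fun w : C => _) = fun w => (w - a) * \prod_(a <- s) (w - a)).
  have [] := is_derive_mulC (is_derive_subC a z) (derivableP IH).
  by [].
by apply/funext => w; rewrite big_cons.
Qed.

Lemma derivable_cont f (z : C) : derivable f z 1 -> {for z, continuous f}.
Proof. by move=> df; apply: is_derive_continuous; exact: derivableP. Qed.

Lemma derivable_mulC f g (z : C) : derivable f z 1 -> derivable g z 1 ->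
  derivable (fun w => f w * g w) z 1.
Proof. by move=> /derivableP df /derivableP dg; have [] := is_derive_mulC df dg. Qed.

Lemma derivable_divC f g (z : C) : derivable f z 1 -> derivable g z 1 -> g z != 0 ->
  derivable (fun w => f w / g w) z 1.
Proof. by move=> /derivableP df /derivableP dg gz; have [] := is_derive_divC df dg gz. Qed.

Lemma derivable_expC f n (z : C) : derivable f z 1 -> derivable (fun w => f w ^+ n) z 1.
Proof.
move=> df; rewrite (_ : (fun w => f w ^+ n) = f ^+ n); first exact: derivableX df.
by apply/funext => t; elim: n => [|n IH]; rewrite ?expr0 // !exprS IH.
Qed.

Lemma derivable_compC f g (z : C) : derivable f z 1 -> derivable g (f z) 1 ->
  derivable (g \o f) z 1.
Proof. by move=> /derivableP df /derivableP dg; have [] := is_derive_compC df dg. Qed.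

Lemma continuous_mulC f g (z : C) : {for z, continuous f} -> {for z, continuous g} ->
  {for z, continuous (fun w => f w * g w)}.
Proof. exact: (@continuousM _ _ f g z). Qed.

Lemma continuous_expC f n (z : C) : {for z, continuous f} ->
  {for z, continuous (fun w => f w ^+ n)}.
Proof.
move=> cf; elim: n => [|n IH].
  rewrite (_ : (fun w : C => _) = fun=> 1); first exact: cst_continuous.
  by apply/funext => t; rewrite expr0.
rewrite (_ : (fun w : C => _) = fun w => f w * f w ^+ n); first exact: continuous_mulC cf IH.
by apply/funext => t; rewrite exprS.
Qed.

Lemma prod_le (F : C -> R) s (K : R) : (forall a, a \in s -> 0 <= F a <= K) ->
  0 <= \prod_(a <- s) F a <= K ^+ size s.
Proof.
elim: s => [|a s IH] H; first by rewrite big_nil expr0 ler01 lexx.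
have /andP[a0 aK] := H a (mem_head a s).
have /andP[p0 pK] : 0 <= \prod_(a <- s) F a <= K ^+ size s.
  by apply: IH => b bs; apply: H; rewrite inE bs orbT.
by rewrite big_cons exprS mulr_ge0 //= ler_pM.
Qed.

Lemma prod_ge (F : C -> R) s (K : R) : 0 <= K -> (forall a, a \in s -> K <= F a) ->
  K ^+ size s <= \prod_(a <- s) F a.
Proof.
move=> K0; elim: s => [|a s IH] H; first by rewrite big_nil expr0.
have aK := H a (mem_head a s).
have pK : K ^+ size s <= \prod_(a <- s) F a.
  by apply: IH => b bs; apply: H; rewrite inE bs orbT.
by rewrite big_cons exprS ler_pM // exprn_ge0.
Qed.

(** The zeros are divided out one at a time by the quotient of [caratheodoryP]. *)
Lemma divide_zeros f (r : R) s : uniq s ->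
  (forall z, sq r z -> derivable f z 1) ->
  (forall a, a \in s -> sq r a /\ f a = 0) ->
  exists g, [/\ forall z, sq r z -> {for z, continuous g},
    forall z, sq r z -> z \notin s -> derivable g z 1 &
    forall z, f z = g z * \prod_(a <- s) (z - a)].
Proof.
elim: s => [|a s IH] /=.
  move=> _ df _; exists f; split=> [z /df/derivable_cont//|z /df//|z].
  by rewrite big_nil mulr1.
move=> /andP[as_ us] df H.
have [|g [cg dg fg]] := IH us df; first by move=> b bs; apply: H; rewrite inE bs orbT.
have [sa fa] : sq r a /\ f a = 0 by apply: H; rewrite inE eqxx.
have ga : g a = 0.
  have := fg a; rewrite fa => /esym/eqP; rewrite mulf_eq0 => /orP[/eqP //|].
  rewrite prodf_seq_eq0 => /hasP[b bs]; rewrite subr_eq0 => /eqP ab.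
  by rewrite ab bs in as_.
have [u [cu _ gu]] := (iffLR (caratheodoryP _ _ _)) (derivableP (dg a sa as_)).
have uE z : z != a -> g z / (z - a) = u z.
  by move=> za; rewrite gu ga add0r mulfK // subr_eq0.
have nu z : z != a -> \forall t \near z, g t / (t - a) = u t.
  by move=> za; apply: filterS (near_neq za) => t /uE.
have na z : z != a -> z - a != 0 by rewrite subr_eq0.
exists u; split.
- move=> z sz; have [->//|za] := eqVneq z a.
  apply: continuous_near (nu z za) _.
  apply: continuous_mulC; first exact: cg.
  apply: (@continuousV _ _ (fun t => t - a)); first exact: na.
  exact: is_derive_continuous (is_derive_subC a z).
- move=> z sz; rewrite inE negb_or => /andP[za zs].
  have [da _] := is_derive_subC a z.
  exact: (near_eq_derivable (nu z za) (derivable_divC (dg z sz zs) da (na z za))).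
- by move=> z; rewrite big_cons mulrA fg gu ga add0r.
Qed.

(** The product of [g ^+ n] with the factors z - a, for a in [s], is holomorphic
    everywhere; the extra factors are bounded independently of n, so that
    [pow_le_const] removes them. *)
Lemma max_except g (rho r M : R) s (w : C) :
  0 < rho -> rho < r -> r <= 1 -> uniq s -> (forall a, a \in s -> sq r a) ->
  (forall z, sq r z -> {for z, continuous g}) ->
  (forall z, sq r z -> z \notin s -> derivable g z 1) ->
  (forall z, csq rho z -> (`|complex.Re z| == rho) || (`|complex.Im z| == rho) ->
     nm (g z) <= M) ->
  csq rho w -> w \notin s -> nm (g w) <= M.
Proof.
move=> rho0 rr r1 us sr cg dg gM wrho ws.
have M0 : 0 <= M.
  have h : csq rho (rho%:C) by split; rewrite /= ?normr0 ?ger0_norm // ltW.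
  apply: le_trans (nm_ge0 (g (rho%:C))) (gM _ h _) => /=.
  by rewrite ger0_norm ?eqxx // ltW.
apply: (@pow_le_const R _ _ (nm (\prod_(a <- s) (w - a))) (4 ^+ size s)) => //.
- exact: nm_ge0.
- rewrite nm_gt0 prodf_seq_neq0; apply/allP => a aS /=.
  by rewrite subr_eq0; apply: contraNneq ws => ->.
move=> n.
pose H (z : C) := g z ^+ n * \prod_(a <- s) (z - a).
have dH z : sq r z -> derivable H z 1.
  move=> sz; have [zs|zs] := boolP (z \in s); last first.
    by have := derivable_mulC (derivable_expC (n := n) (dg z sz zs)) (@derivable_prodB s z).
  have HE t : H t = (g t ^+ n * \prod_(a <- rem z s) (t - a)) * (t - z).
    rewrite /H (perm_big _ (perm_to_rem zs)) big_cons /=.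
    by rewrite [(t - z) * _]mulrC mulrA.
  have [] : is_derive z 1 H (g z ^+ n * \prod_(a <- rem z s) (z - a)) => //.
  apply/caratheodoryP; exists (fun t => g t ^+ n * \prod_(a <- rem z s) (t - a)); split=> //.
    apply: continuous_mulC.
      by apply: continuous_expC; exact: cg.
    exact: derivable_cont (@derivable_prodB _ z).
  by move=> t; rewrite !HE subrr mulr0 add0r.
have dH' z : `|complex.Re z| < r -> `|complex.Im z| < r -> derivable H z 1.
  by move=> z1 z2; apply: dH.
have [w1 w2] := wrho.
suff : nm (H w) <= 4 ^+ size s * M ^+ n by rewrite nmM nmX.
apply: (maximum_principle rho0 rr r1 dH' _ w1 w2) => z z1 z2 zb.
rewrite nmM nmX mulrC ler_pM ?exprn_ge0 ?nm_ge0 //; last first.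
  by rewrite lerXn2r ?nnegrE ?nm_ge0 // gM.
rewrite nm_prod.
have h a : a \in s -> 0 <= nm (z - a) <= 4.
  move=> /sr/sub_csq/nm_csq na; rewrite nm_ge0 /= (le_trans (nmD _ _)) // nmN.
  have := @nm_csq rho z (conj z1 z2); lra.
by have /andP[] := prod_le h.
Qed.

(** The maximum principle for the quotient of [f] by the product of the z - a. On the
    boundary of the large square each factor is at least [rho - del]; on the small
    square it is at most [2 * eta + del]. *)
Lemma schwarz f (rho r M del eta : R) s (w : C) :
  0 < rho -> rho < r -> r <= 1 -> uniq s -> 0 <= del -> del < rho ->
  (forall z, sq r z -> derivable f z 1) ->
  (forall a, a \in s -> nm a <= del /\ f a = 0) ->
  (forall z, csq rho z -> nm (f z) <= M) ->
  csq eta w -> eta <= rho ->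
  nm (f w) <= M * ((2 * eta + del) / (rho - del)) ^+ size s.
Proof.
move=> rho0 rr r1 us del0 dr df fs fM weta er.
have eta0 : 0 <= eta by case: weta => h _; exact: le_trans h.
have M0 : 0 <= M.
  by apply: le_trans (nm_ge0 (f 0)) (fM _ _); apply: sub_csq; exact: sq0.
have q0 : 0 <= (2 * eta + del) / (rho - del).
  by apply: divr_ge0; lra.
have [ws|ws] := boolP (w \in s).
  by have [_ ->] := fs w ws; rewrite nm0 mulr_ge0 // exprn_ge0.
have sr a : a \in s -> sq r a.
  by move=> /fs[na _]; apply: nm_sq; apply: le_lt_trans na _; lra.
have [g [cg dg fg]] := @divide_zeros f r s us df (fun a h => conj (sr a h) (fs a h).2).
have rd : 0 < rho - del by rewrite subr_gt0.
have gM z : csq rho z -> (`|complex.Re z| == rho) || (`|complex.Im z| == rho) ->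
    nm (g z) <= M / (rho - del) ^+ size s.
  move=> zr zb; rewrite ler_pdivlMr ?exprn_gt0 //.
  apply: le_trans (fM z zr); rewrite fg nmM ler_wpM2l ?nm_ge0 // nm_prod.
  apply: prod_ge => [|a /fs[na _]]; first exact: ltW.
  have zn : rho <= nm z by case/orP: zb => /eqP <-; [exact: nm_Re|exact: nm_Im].
  have := nmD (z - a) a; rewrite subrK; lra.
have wr : csq rho w by case: weta => h1 h2; split; exact: le_trans er.
have := max_except rho0 rr r1 us sr cg dg gM wr ws.
move=> gw; rewrite fg nmM expr_div_n mulrA mulrAC ler_pM ?nm_ge0 // nm_prod.
have h a : a \in s -> 0 <= nm (w - a) <= 2 * eta + del.
  move=> /fs[na _]; rewrite nm_ge0 /= (le_trans (nmD _ _)) // nmN.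
  by rewrite lerD // nm_csq.
by have /andP[] := prod_le h.
Qed.

Lemma schwarz_simple f (M : R) (w : C) :
  (forall z, sq 1 z -> derivable f z 1) -> f 0 = 0 ->
  (forall z, sq 1 z -> nm (f z) <= M) -> csq (1 / 8) w ->
  nm (f w) <= M / 2.
Proof.
move=> df f0 fM w8.
have h12 : (1 / 2 : R) < 1 by lra.
have h0 : (0 : R) < 1 / 2 by lra.
have h8 : (1 / 8 : R) <= 1 / 2 by lra.
have fs (a : C) : a \in [:: 0] -> nm a <= 0 /\ f a = 0.
  by rewrite inE => /eqP ->; rewrite nm0.
have fM' z : csq (1 / 2) z -> nm (f z) <= M by move=> /(sq_csq h12); exact: fM.
have := @schwarz f (1 / 2) 1 M 0 (1 / 8) [:: 0] w h0 h12 (lexx _) isT (lexx _) h0 df fs fM' w8 h8.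
by rewrite addr0 subr0 /= expr1 (_ : 2 * (1 / 8) / (1 / 2) = 2^-1) //; field.
Qed.

(** The function h = 1 - f / f(0) vanishes at 0 and has a nonnegative real part, so
    that h / (h + 2d) is bounded by 1 for every d > 0. The Schwarz lemma then gives
    nm h <= 2d near 0. *)
Lemma strong_maximum f (w : C) :
  (forall z, sq 1 z -> derivable f z 1) ->
  (forall z, sq 1 z -> nm (f z) <= nm (f 0)) -> csq (1 / 8) w ->
  f w = f 0.
Proof.
move=> df fM w8.
have [f0|f0] := eqVneq (f 0) 0.
  have sw : sq 1 w by apply: sq_csq w8; lra.
  have := fM w sw; rewrite f0 nm0 => h.
  by apply/eqP; rewrite -nm_eq0 eq_le h nm_ge0.
pose h z := 1 - f z / f 0.
have dh z : sq 1 z -> derivable h z 1.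
  move=> sz; apply: derivableB; first exact: derivable_cst.
  by apply: derivable_mulC; [exact: df|exact: derivable_cst].
have h0 : h 0 = 0 by rewrite /h mulfV // subrr.
have Re_h z : sq 1 z -> 0 <= complex.Re (h z).
  move=> sz; rewrite raddfB /= subr_ge0 (le_trans (ler_norm _)) // (le_trans (nm_Re _)) //.
  by rewrite nmM nmV ler_pdivrMr ?nm_gt0 // mul1r fM.
suff hw : h w = 0.
  move: hw; rewrite /h => /eqP; rewrite subr_eq0 => /eqP e.
  by rewrite -[f w](mulfVK f0) -e mul1r.
have sw : sq 1 w by apply: sq_csq w8; lra.
(* for d > 0 the denominator has a positive real part *)
have bound (d : R) : 0 < d -> nm (h w) <= 2 * d.
  move=> d0.
  have Re_hd z : sq 1 z -> 0 < complex.Re (h z + (2 * d)%:C).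
    by move=> /Re_h hz; rewrite raddfD /=; lra.
  have nz z : sq 1 z -> h z + (2 * d)%:C != 0.
    by move=> /Re_hd; apply: contraTneq => ->; rewrite ltxx.
  have dphi z : sq 1 z -> derivable (fun z => h z / (h z + (2 * d)%:C)) z 1.
    move=> sz; apply: derivable_divC; [exact: dh| |exact: nz].
    by apply: derivableD; [exact: dh|exact: derivable_cst].
  have := @schwarz_simple (fun z => h z / (h z + (2 * d)%:C)) 1 w dphi.
  rewrite h0 mul0r => /(_ erefl).
  have phi1 z : sq 1 z -> nm (h z / (h z + (2 * d)%:C)) <= 1.
    move=> sz; rewrite nmM nmV ler_pdivrMr ?nm_gt0 ?nz // mul1r.
    have a0 := Re_h z sz; have ad := mulr_ge0 a0 (ltW d0).
    rewrite -ler_sqr ?nnegrE ?nm_ge0 // !nm_sqr.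
    case: (h z) a0 ad => a b /= a0 ad; rewrite addr0 lerD2r.
    by nra.
  move=> /(_ phi1 w8); rewrite nmM nmV ler_pdivrMr ?nm_gt0 ?nz //.
  have := nmD (h w) ((2 * d)%:C); rewrite nm_real ger0_norm; last lra.
  lra.
apply/eqP; rewrite -nm_eq0 eq_le nm_ge0 andbT leNgt; apply/negP => n0.
by have := bound (nm (h w) / 4); rewrite divr_gt0 // => /(_ isT); lra.
Qed.

Lemma compact_csq (r : R) : compact (csq r).
Proof.
have -> : csq r = (fun p : R * R => p.1 +i* p.2 : C) @` (`[- r, r] `*` `[- r, r]).
  apply/seteqP; split=> [z [h1 h2]|z [[x y] /= [hx hy] <-]].
    exists (complex.Re z, complex.Im z); last by case: (z).
    by split; rewrite /= in_itv /= -ler_norml.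
  by move: hx hy; rewrite !in_itv /= -!ler_norml => h1 h2; split.
apply: continuous_compact; last by apply: compact_setX; exact: segment_compact.
apply: continuous_subspaceT => p.
apply: (@cvg_complex R (R * R) (nbhs p) (nbhs_filter p) (fun p => p.1) (fun p => p.2)).
  exact: cvg_fst.
exact: cvg_snd.
Qed.

End Schwarz.

(** * Functions and sections on a compact surface *)

Section FiniteDimension.

(** The matrix of the forms on a free family of [A] has independent rows, so that the
    family has at most [N] members; a maximal free family is a basis. *)
Lemma has_dim_separated (K : fieldType) (V : lmodType K) (A : set V) (N : nat)
    (ev : 'I_N -> V -> K) :
  A 0 -> (forall a u v, A u -> A v -> A (a *: u + v)) ->
  (forall j a u v, ev j (a *: u + v) = a * ev j u + ev j v) ->
  (forall v, A v -> (forall j, ev j v = 0) -> v = 0) ->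
  exists n, has_dim A n.
Proof.
move=> A0 Alin evlin evinj.
have ev0 j : ev j 0 = 0.
  by have := evlin j (-1) 0 0; rewrite scaler0 add0r mulN1r addNr.
have Asum n (b : 'I_n -> V) (c : 'I_n -> K) : (forall k, A (b k)) ->
    A (\sum_k c k *: b k).
  move=> Ab; elim/big_ind : _ => [//|u v Au Av|k _].
    by rewrite -[u]scale1r; exact: Alin.
  by rewrite -[_ *: _]addr0; exact: Alin.
have evsum n (b : 'I_n -> V) (c : 'I_n -> K) j :
    ev j (\sum_k c k *: b k) = \sum_k c k * ev j (b k).
  elim: n b c => [|n IH] b c; first by rewrite !big_ord0 ev0.
  by rewrite !big_ord_recl evlin IH.
pose free n := exists b : 'I_n -> V, (forall k, A (b k)) /\
  (forall c : 'I_n -> K, \sum_k c k *: b k = 0 -> forall k, c k = 0).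
have free0 : `[< free 0%N >].
  by apply/asboolP; exists (fun=> 0); split=> [//|c _ []].
have freeN n : `[< free n >] -> (n <= N)%N.
  move=> /asboolP[b [Ab fb]].
  pose M := \matrix_(k < n, j < N) ev j (b k).
  suff : row_free M by rewrite /row_free => /eqP <-; exact: rank_leq_col.
  rewrite -kermx_eq0; apply/eqP/row_matrixP => i; rewrite row0.
  set v := row i _.
  have vM : v *m M = 0 by apply/sub_kermxP; exact: row_sub.
  apply/rowP => k; rewrite [RHS]mxE; apply: (fb (fun k => v 0 k)).
  apply: evinj; first exact: Asum.
  move=> j; rewrite evsum.
  transitivity ((v *m M) 0 j); last by rewrite vM mxE.
  rewrite [RHS]mxE.
  by apply: eq_bigr => l _; rewrite [M l j]mxE.
have ex : exists n, `[< free n >] by exists 0%N.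
case: (ex_maxnP ex freeN) => n /asboolP[b [Ab fb]] nmax.
exists n, b; split=> // v; split=> [Av|[a ->]]; last exact: Asum.
apply: contrapT => nv.
suff : `[< free n.+1 >] by move=> /nmax; rewrite ltnn.
apply/asboolP; exists (fun k => if unlift ord0 k is Some k' then b k' else v); split.
  by move=> k; case: unliftP => [k' _|_].
move=> c; rewrite big_ord_recl unlift_none.
under eq_bigr do rewrite liftK.
move=> sum0.
have c0 : c ord0 = 0.
  apply/eqP/negPn/negP => c0; apply: nv.
  exists (fun k => - (c ord0)^-1 * c (lift ord0 k)).
  move/eqP: sum0; rewrite addr_eq0 => /eqP h.
  rewrite -[v in LHS](scalerK c0) h scalerN -scaleNr scaler_sumr.
  by apply: eq_bigr => k _; rewrite scalerA.
move: sum0; rewrite c0 scale0r add0r => /fb ck k.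
by case: (unliftP ord0 k) => [k' ->|-> //]; exact: ck.
Qed.

End FiniteDimension.

(** The finite lists of centres, ordered by inclusion, form the filter to which the
    near-covering form of compactness is applied. *)
Lemma compact_finite_cover (T : topologicalType) (D : T -> set T) :
  compact [set: T] -> (forall x, open (D x)) -> (forall x, D x x) ->
  exists s : seq T, forall y, exists2 x, x \in s & D x y.
Proof.
move=> /compact_near_coveringP cpt oD xD.
pose F : set_system (seq T) := filter_from setT (fun s0 : seq T => [set s : seq T | {subset s0 <= s}]).
have FF : Filter F.
  apply: filter_from_filter; first by exists [::].
  move=> s1 s2 _ _; exists (s1 ++ s2) => // s sub; split=> x xs; apply: sub.
    by rewrite mem_cat xs.
  by rewrite mem_cat xs orbT.
have := cpt _ F (fun s y => exists2 x, x \in s & D x y) FF.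
case=> [x _|s _ /(_ s)].
  exists (D x, [set s : seq T | {subset [:: x] <= s}]) => /=.
    split; first by apply: open_nbhs_nbhs; split.
    by exists [:: x].
  by move=> [y s] /= [Dxy sub]; exists x => //; apply: sub; rewrite inE.
by move=> H; exists s => y; exact: H.
Qed.

Section CompactSurface.
Variable R : realType.
Local Notation C := (Cx R).
Variable S : surface R.

(** A holomorphic parametrisation of a neighbourhood of [phi 0], described by its effect
    on open sets and on holomorphic functions. *)
Definition disc (phi : C -> S) :=
  [/\ forall z, sq 1 z -> {for z, continuous phi},
      forall r : R, 0 < r < 1 -> open (phi @` sq r) &
      forall W f, holomorphic_on W f -> forall z, sq 1 z -> W (phi z) ->
        derivable (f \o phi) z 1].

Definition has_discs := forall (x : S) (U : set S), open U -> U x ->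
  exists phi, [/\ disc phi, phi 0 = x & forall z, sq 1 z -> U (phi z)].

Hypothesis discs : has_discs.
Hypothesis cptS : compact [set: S].

Lemma holomorphic_continuous (W : set S) (f : S -> C) x : open W ->
  holomorphic_on W f -> W x -> {for x, continuous f}.
Proof.
move=> oW hf Wx.
have [phi [[cphi ophi dphi] phi0 phiW]] := discs oW Wx.
have df : derivable (f \o phi) 0 1.
  by apply: dphi hf _ _ _; [exact: sq0|rewrite phi0].
have cf := derivable_cont df.
move=> A; rewrite -{1}phi0 => fA.
have /nbhsCP[e e0 eA] : nbhs (0 : C) ((f \o phi) @^-1` A) by exact: cf.
pose r := Num.min (e / 2) (1 / 2).
have r0 : 0 < r by rewrite lt_min !divr_gt0.
have r1 : r < 1 by rewrite gt_min; apply/orP; right; lra.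
have re : 2 * r <= e by rewrite mulrC -ler_pdivlMr // ge_min lexx.
have op : open (phi @` sq r) by apply: ophi; rewrite r0.
have : nbhs x (phi @` sq r).
  by apply: open_nbhs_nbhs; split=> //; exists 0 => //; exact: sq0.
apply: filterS => _ [z [z1 z2] <-]; apply: eA; rewrite subr0.
apply: lt_le_trans re; rewrite (le_lt_trans (nm_leD _)) // mulr2n mulrDl !mul1r.
by rewrite ltrD.
Qed.

(** The modulus attains its maximum, and the strong maximum principle makes the set
    where the function takes that value open. *)
Lemma constant_holomorphic (f : S -> C) : connected [set: S] ->
  holomorphic_on setT f -> forall x y, f x = f y.
Proof.
move=> conS hf.
have cf : continuous f by move=> x; apply: holomorphic_continuous hf _ => //; exact: openT.
move=> x0 y0.
have [m _ fm] : exists2 m, m \in [set: S] & forall t, t \in [set: S] -> nm (f t) <= nm (f m).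
  apply: (@compact_EVT_max S R (fun t => nm (f t))) => //; first by exists x0.
  apply: continuous_subspaceT => x; apply: (@continuous_comp _ _ _ f (@nm R)); first exact: cf.
  exact: continuous_nm.
suff E : [set t | f t = f m] = setT.
  have h1 : [set t | f t = f m] x0 by rewrite E.
  have h2 : [set t | f t = f m] y0 by rewrite E.
  by rewrite h1 h2.
apply: conS; first by exists m.
- exists [set t | f t = f m]; last by rewrite setTI.
  rewrite openE => x /= fx.
  have [phi [[cphi ophi dphi] phi0 _]] := discs openT (I : [set: S] x).
  have df z : sq 1 z -> derivable (f \o phi) z 1 by move=> sz; exact: dphi hf _ sz I.
  have mx z : sq 1 z -> nm ((f \o phi) z) <= nm ((f \o phi) 0).
    by move=> _; rewrite /= phi0 fx; apply: fm; rewrite inE.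
  have := strong_maximum df mx.
  have op : open (phi @` sq (1 / 8)) by apply: ophi; lra.
  move=> cst; have : nbhs x (phi @` sq (1 / 8)).
    apply: open_nbhs_nbhs; split=> //; exists 0 => //; apply: sq0; lra.
  apply: filterS => t [z /sub_csq z8 <-].
  by have := cst z z8; rewrite /= phi0 fx.
- exists [set t | f t = f m]; last by rewrite setTI.
  rewrite -openC openE => x /eqP fx.
  have : nbhs (f x) [set z : C | z != f m] by exact: near_neq.
  move=> nb; have : nbhs x (f @^-1` [set z : C | z != f m]) := cf x _ nb.
  by apply: filterS => t /= /eqP.
Qed.

Section Sections.
Variable L : cocycle S.
Hypothesis bL : line_bundle L.

Lemma sections0 : global_sections (L := L) 0.
Proof.
split=> // [i c _ x _ _|i j x _ _]; last by rewrite /= mulr0.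
exact: derivable_cst.
Qed.

Lemma sectionsD (a : C) u v : global_sections (L := L) u -> global_sections (L := L) v ->
  global_sections (L := L) (a *: u + v).
Proof.
move=> [hu tu zu] [hv tv zv].
have E i x : (a *: u + v) i x = a * u i x + v i x by [].
split.
- move=> i c ac x ix cx.
  have du := hu i c ac x ix cx; have dv := hv i c ac x ix cx.
  exact: derivableD (derivableZ (k := a) du) dv.
- by move=> i j x ix jx; rewrite !E mulrDr mulrCA -tu // -tv.
- by move=> i x nix; rewrite E zu // zv // mulr0 addr0.
Qed.

(** Distinct points of modulus at most 1/16. *)
Definition pt (k : nat) : C := ((16 * (k.+1)%:R)^-1 : R)%:C.

Lemma pt_inj : injective pt.
Proof.
move=> k l /complexI/invr_inj /(mulfI _) h.
have /h/eqP : (16 : R) != 0 by rewrite pnatr_eq0.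
by rewrite eqr_nat => /eqP [].
Qed.

Lemma nm_pt k : nm (pt k) <= 1 / 16.
Proof.
rewrite nm_real ger0_norm; last by rewrite invr_ge0 mulr_ge0.
rewrite div1r lef_pV2 ?posrE ?mulr_gt0 // ler_peMr // ler1n //.
Qed.

(** Siegel's argument. Finitely many small discs cover the surface. By the Schwarz
    lemma a section with N zeros in each of them is smaller there, by a factor
    (5/7)^N, than on the large discs; going from the large disc where it is maximal to
    a small disc costs at most the constant Cm that bounds the transition functions.
    For large N this forces the section to vanish, so that finitely many evaluations
    are jointly injective on sections. *)
Theorem h0_finite : exists n, h0 L n.
Proof.
have [oD covL hT Tii Tcoc] := bL.
have choose (x : S) : exists p : bundle_idx L * (C -> S),
    [/\ disc p.2, p.2 0 = x & forall z, sq 1 z -> bundle_dom p.1 (p.2 z)].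
  have [i ix] := covL x; have [phi hphi] := discs (oD i) ix.
  by exists (i, phi).
have [P HP] := boolp.choice choose.
pose idx x := (P x).1; pose phi x := (P x).2.
pose D x := phi x @` sq (1 / 8).
have oD8 x : open (D x) by have [[_ o _] _ _] := HP x; apply: o; lra.
have xD x : D x x.
  by exists 0; [apply: sq0; lra|have [_ e _] := HP x].
have [Xs cov] := compact_finite_cover cptS oD8 xD.
pose m := size Xs.
pose t (k : 'I_m) : S := tnth (in_tuple Xs) k.
have covt y : exists k, D (t k) y.
  have [x xX xy] := cov y.
  have /tnthP[k kE] : x \in in_tuple Xs by [].
  by exists k; rewrite /t -kE.
pose g (k l : 'I_m) (y : S) := bundle_trans (idx (t k)) (idx (t l)) y.
(* a point of the k-th disc lies in some small disc l, which can be kept nearby; so the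
   transition functions from k to these l are bounded on a compact square *)
have boundk k : exists c : R, forall z, csq (1 / 2) z ->
    exists2 l, D (t l) (phi (t k) z) & nm (g k l (phi (t k) z)) <= c.
  have cpt := @compact_csq R (1 / 2); move/compact_near_coveringP : cpt => cpt.
  have := cpt R +oo%R (fun c z => exists2 l, D (t l) (phi (t k) z) &
    nm (g k l (phi (t k) z)) <= c) _.
  case.
    move=> z0 z0h.
    have sz0 : sq 1 z0 by apply: sq_csq z0h; lra.
    have [l lD] := covt (phi (t k) z0).
    have [[cphi _ dphi] _ domk] := HP (t k).
    have near1 : \forall z \near z0, D (t l) (phi (t k) z).
      have nb : nbhs (phi (t k) z0) (D (t l)).
        by apply: open_nbhs_nbhs; split=> //; exact: oD8.
      exact: cphi sz0 _ nb.
    have hl : bundle_dom (idx (t l)) (phi (t k) z0).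
      have [_ _ doml] := HP (t l); case: lD => v v8 <-; apply: doml.
      by apply: sub_sq v8; lra.
    have dg := dphi _ _ (hT (idx (t k)) (idx (t l))) z0 sz0 (conj (domk z0 sz0) hl).
    have [d d0 dH] := (iffLR (contCP _ _)) (derivable_cont dg) 1 ltr01.
    have near2 : \forall z \near z0, nm (g k l (phi (t k) z)) < nm (g k l (phi (t k) z0)) + 1.
      apply/nearCP; exists d => // z /dH h.
      rewrite -[X in nm X](subrK (g k l (phi (t k) z0))) (le_lt_trans (nmD _ _)) // addrC ltrD2l.
      exact: h.
    exists ([set z | D (t l) (phi (t k) z) /\ nm (g k l (phi (t k) z)) < nm (g k l (phi (t k) z0)) + 1],
            [set c | nm (g k l (phi (t k) z0)) + 1 < c]) => /=.
      split; first exact: filterI near1 near2.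
      by exists (nm (g k l (phi (t k) z0)) + 1); split; first exact: num_real.
    move=> [z c] /= [[zD zg] gc]; exists l => //.
    exact: ltW (lt_trans zg gc).
  move=> M [_ HM]; exists (M + 1); apply: HM; rewrite ltrDl //.
have [ck ckP] := boolp.choice boundk.
pose Cm := \big[Num.max/0]_(k < m) ck k.
have Cm0 : 0 <= Cm by exact: bigmax_ge_id.
have ckCm k : ck k <= Cm by exact: le_bigmax.
have [N NP] : exists N : nat, Cm * (5 / 7) ^+ N < 1.
  have q1 : `|5 / 7 : R| < 1 by rewrite ger0_norm; lra.
  have c1 : 0 < (Cm + 1)^-1 by rewrite invr_gt0; lra.
  have /cvgrPdist_lt/(_ _ c1)[n _ /(_ n (leqnn n))] := cvg_expr q1.
  rewrite /= sub0r normrN ger0_norm; last by apply: exprn_ge0; lra.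
  move=> h; exists n; apply: (@le_lt_trans _ _ ((Cm + 1) * (5 / 7) ^+ n)).
    by rewrite ler_wpM2r ?exprn_ge0 //; lra.
  by rewrite mulrC -ltr_pdivlMr ?div1r //; lra.
pose ev (j : 'I_#|{: 'I_m * 'I_N}|) (s : bundle_idx L -> S -> C) : C :=
  s (idx (t (enum_val j).1)) (phi (t (enum_val j).1) (pt (enum_val j).2)).
apply: (has_dim_separated (ev := ev)).
- exact: sections0.
- by move=> a u v; exact: sectionsD.
- by [].
move=> s [hs ts zs] ev0.
pose f k (z : C) := s (idx (t k)) (phi (t k) z).
have df k z : sq 1 z -> derivable (f k) z 1.
  move=> sz; have [[_ _ dphi] _ domk] := HP (t k).
  exact: dphi _ _ (hs (idx (t k))) z sz (domk z sz).
have fpt k a : a \in [seq pt i | i <- iota 0 N] -> nm a <= 1 / 16 /\ f k a = 0.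
  move=> /mapP[j]; rewrite mem_iota add0n => /andP[_ jN] ->; split; first exact: nm_pt.
  have := ev0 (enum_rank (k, Ordinal jN)).
  by rewrite /ev enum_rankK.
have maxk k : exists z, csq (1 / 2) z /\ forall w, csq (1 / 2) w -> nm (f k w) <= nm (f k z).
  have [|||z z2 zm] := @compact_EVT_max C R (fun z => nm (f k z)) (csq (1 / 2)).
  - by exists 0; apply: sub_csq; apply: sq0; lra.
  - exact: compact_csq.
  - apply: continuous_in_subspaceT => z; rewrite inE => zh.
    apply: (@continuous_comp _ _ _ (f k) (@nm R)); last exact: continuous_nm.
    by apply: derivable_cont; apply: df; apply: sq_csq zh; lra.
  exists z; split; first by rewrite inE in z2.
  by move=> w wh; apply: zm; rewrite inE.
have [zk zkP] := boolp.choice maxk.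
suff A0 k : nm (f k (zk k)) <= 0.
  apply/funext => i; apply/funext => x.
  have [ix|/zs -> //] := pselect (bundle_dom i x).
  have [k [v v8 vx]] := covt x.
  have [_ _ domk] := HP (t k).
  have sv : sq 1 v by apply: sub_sq v8; lra.
  have kx : bundle_dom (idx (t k)) x by rewrite -vx; exact: domk.
  rewrite (ts i (idx (t k)) x ix kx).
  suff -> : s (idx (t k)) x = 0 by rewrite mulr0.
  apply/eqP; rewrite -nm_eq0 eq_le nm_ge0 andbT -vx.
  apply: le_trans (A0 k); have [_ h] := zkP k; apply: h.
  by apply: sub_csq; apply: sub_sq v8; lra.
(* the disc on which the section is largest *)
pose ks := [arg max_(l > k) nm (f l (zk l))]%O.
have ksmax l : nm (f l (zk l)) <= nm (f ks (zk ks)).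
  by rewrite /ks; case: Order.TotalTheory.arg_maxP => // i _ h; exact: h.
apply: le_trans (ksmax k) _.
set A := nm (f ks (zk ks)) in ksmax *.
have [zs2 _] := zkP ks.
have [l lD gc] := ckP ks (zk ks) zs2.
have [v v8 vy] := lD.
have h12 : (0 : R) < 1 / 2 by lra.
have h21 : (1 / 2 : R) < 1 by lra.
have h16 : (0 : R) <= 1 / 16 by lra.
have h162 : (1 / 16 : R) < 1 / 2 by lra.
have h82 : (1 / 8 : R) <= 1 / 2 by lra.
have us : uniq [seq pt i | i <- iota 0 N] by rewrite map_inj_uniq ?iota_uniq //; exact: pt_inj.
have := schwarz h12 h21 (lexx _) us h16 h162 (df l) (fpt l) (zkP l).2 (sub_csq v8) h82.
rewrite size_map size_iota (_ : _ / (1 / 2 - 1 / 16) = 5 / 7); last by field.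
move=> fl.
have Aeq : A <= Cm * (A * (5 / 7) ^+ N).
  have dks : bundle_dom (idx (t ks)) (phi (t ks) (zk ks)).
    by have [_ _ h] := HP (t ks); apply: h; apply: sq_csq zs2; lra.
  have dl : bundle_dom (idx (t l)) (phi (t ks) (zk ks)).
    have [_ _ h] := HP (t l); rewrite -vy; apply: h.
    by apply: sub_sq v8; lra.
  have e : A = nm (g ks l (phi (t ks) (zk ks))) * nm (s (idx (t l)) (phi (t ks) (zk ks))).
    by rewrite /A /f (ts _ (idx (t l)) _ dks dl) nmM.
  rewrite {1}e; apply: ler_pM; rewrite ?nm_ge0 //; first exact: le_trans gc (ckCm ks).
  rewrite -{1}vy; apply: le_trans fl _.
  by apply: ler_wpM2r; [apply: exprn_ge0; lra|exact: ksmax].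
rewrite leNgt; apply/negP => Apos.
move: Aeq; rewrite mulrCA; apply/negP; rewrite -ltNge.
by rewrite gtr_pMr.
Qed.

End Sections.

End CompactSurface.

(** * A quaternion action forces an even dimension *)

Section QuaternionAction.
Variables (K : fieldType) (V : lmodType K) (A : set V) (n : nat).
Hypothesis dimA : has_dim A n.

Definition stable_linear (al : V -> V) := (forall s, A s -> A (al s)) /\
  (forall a s t, al (a *: s + t) = a *: al s + al t).

Lemma stable_linear_mx al (b : 'I_n -> V) : stable_linear al ->
  (forall v, A v <-> exists a : 'I_n -> K, v = \sum_k a k *: b k) ->
  exists X : 'M[K]_n, forall v : 'rV[K]_n,
    al (\sum_k v 0 k *: b k) = \sum_k (v *m X) 0 k *: b k.
Proof.
move=> [sal lal] span.
have Ab k : A (b k).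
  apply/span; exists (fun l => (l == k)%:R).
  rewrite (bigD1 k) //= eqxx scale1r big1 ?addr0 // => l /negPf ->.
  by rewrite scale0r.
have ex k : exists a : 'I_n -> K, al (b k) = \sum_l a l *: b l.
  by apply/span; exact: sal.
have [f fP] := boolp.choice ex.
exists (\matrix_(k, l) f k l) => v.
have al0 : al 0 = 0.
  by have := lal (-1) 0 0; rewrite scaler0 add0r scaleN1r addNr.
have alsum (I : Type) (r : seq I) (c : I -> K) (u : I -> V) :
    al (\sum_(i <- r) c i *: u i) = \sum_(i <- r) c i *: al (u i).
  elim: r => [|i r IH]; first by rewrite !big_nil.
  by rewrite !big_cons lal IH.
rewrite alsum.
under eq_bigr do rewrite fP scaler_sumr.
rewrite exchange_big; apply: eq_bigr => l _; rewrite mxE scaler_suml.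
by apply: eq_bigr => k _; rewrite mxE scalerA.
Qed.

(** The matrices X, Y of the two operators and their product X Y have square -1, of
    determinant [(-1) ^+ n]. Since det (X Y)^2 = det X^2 det Y^2, this determinant is
    its own square, hence 1. *)
Lemma quaternion_even al be : (1 : K) != -1 ->
  stable_linear al -> stable_linear be ->
  (forall s, A s -> al (al s) = - s) -> (forall s, A s -> be (be s) = - s) ->
  (forall s, A s -> be (al (be (al s))) = - s) -> ~~ odd n.
Proof.
move=> N1 sal sbe al2 be2 beal2.
have [b [span free]] := dimA.
have [X XP] := stable_linear_mx sal span.
have [Y YP] := stable_linear_mx sbe span.
have sq (ga : V -> V) (Z : 'M[K]_n) : (forall s, A s -> ga s = - s) ->
    (forall v : 'rV[K]_n, ga (\sum_k v 0 k *: b k) = \sum_k (v *m Z) 0 k *: b k) ->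
    Z = - 1%:M.
  move=> gaN gaZ; apply/row_matrixP => i.
  have As : A (\sum_k (delta_mx 0 i : 'rV[K]_n) 0 k *: b k).
    by apply/span; exists (fun k => (delta_mx 0 i : 'rV[K]_n) 0 k).
  have := gaZ (delta_mx 0 i); rewrite gaN // => /eqP.
  rewrite eq_sym -subr_eq0 opprK -big_split /= => /eqP e.
  apply/rowP => k.
  have := free (fun k => ((delta_mx 0 i : 'rV[K]_n) *m Z) 0 k + (delta_mx 0 i : 'rV[K]_n) 0 k).
  have -> : \sum_k0 (((delta_mx 0 i : 'rV[K]_n) *m Z) 0 k0 + (delta_mx 0 i : 'rV[K]_n) 0 k0) *: b k0 = 0.
    by rewrite -[RHS]e; apply: eq_bigr => l _; rewrite scalerDl.
  move=> /(_ erefl k) /eqP; rewrite addr_eq0 -rowE => /eqP ->.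
  by rewrite !mxE eqxx /= eq_sym.
have detN : \det (- 1%:M : 'M[K]_n) = (-1) ^+ n.
  by rewrite -scaleN1r detZ det1 mulr1.
have X2 : X *m X = - 1%:M.
  by apply: (sq (al \o al)) => [s As|v] /=; [exact: al2|rewrite !XP mulmxA].
have Y2 : Y *m Y = - 1%:M.
  by apply: (sq (be \o be)) => [s As|v] /=; [exact: be2|rewrite !YP mulmxA].
have XY2 : X *m Y *m (X *m Y) = - 1%:M.
  apply: (sq (fun s => be (al (be (al s))))) => // v.
  by rewrite !(XP, YP) !mulmxA.
have := congr1 determinant XY2; rewrite !det_mulmx.
have -> : \det X * \det Y * (\det X * \det Y) = (\det X * \det X) * (\det Y * \det Y) by ring.
have dX : \det X * \det X = (-1) ^+ n by rewrite -det_mulmx X2 detN.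
have dY : \det Y * \det Y = (-1) ^+ n by rewrite -det_mulmx Y2 detN.
rewrite dX dY detN -signr_odd.
by case: (odd n) => //=; rewrite !expr1 mulN1r opprK => /eqP; rewrite (negPf N1).
Qed.

End QuaternionAction.

(** * Holomorphic maps and their derivatives in charts *)

Section HolomorphicAt.
Variable R : realType.
Local Notation C := (Cx R).
Variable S : surface R.
Implicit Types (c d e : chart R S) (f g : S -> C) (h k : S -> S).

(** The properties of a homeomorphism onto an open set through which germs of functions
    are transported by [chart_inv]. *)
Definition regular_chart c := forall x, chart_dom c x ->
  [/\ open (chart_dom c),
      forall y x0, chart_dom c y -> chart_inv c x0 (chart_coord c y) = y,
      \forall w \near chart_coord c x, chart_dom c (chart_inv c x w) /\
        chart_coord c (chart_inv c x w) = w &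
      {for chart_coord c x, continuous (chart_inv c x)}].

Hypothesis reg : forall c, atlas c -> regular_chart c.

Definition hol_at f x := forall c, atlas c -> chart_dom c x ->
  derivable (f \o chart_inv c x) (chart_coord c x) 1.

Lemma holomorphic_onP (W : set S) f :
  holomorphic_on W f <-> forall x, W x -> hol_at f x.
Proof.
by split=> [H x Wx c ac cx|H c ac x Wx cx]; [exact: H|exact: (H x Wx)].
Qed.

Lemma chart_invE c x : atlas c -> chart_dom c x ->
  chart_inv c x (chart_coord c x) = x.
Proof. by move=> ac cx; have [_ h _ _] := reg ac cx; exact: h. Qed.

Lemma near_chart c x (P : S -> Prop) : atlas c -> chart_dom c x ->
  (\forall y \near x, P y) -> \forall w \near chart_coord c x, P (chart_inv c x w).
Proof.
move=> ac cx Px; have [_ _ _ cinv] := reg ac cx.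
have Px' : nbhs (chart_inv c x (chart_coord c x)) [set y | P y] by rewrite chart_invE.
exact: cinv _ Px'.
Qed.

Lemma hol_at_near f g x : (\forall y \near x, f y = g y) -> hol_at f x -> hol_at g x.
Proof.
move=> fg hf c ac cx; apply: near_eq_derivable (hf c ac cx).
exact: (near_chart (P := fun y => f y = g y) ac cx fg).
Qed.

Lemma hol_at_mul f g x : hol_at f x -> hol_at g x -> hol_at (fun y => f y * g y) x.
Proof. by move=> hf hg c ac cx; exact: derivable_mulC (hf c ac cx) (hg c ac cx). Qed.

Lemma hol_at_div f g x : hol_at f x -> hol_at g x -> g x != 0 ->
  hol_at (fun y => f y / g y) x.
Proof.
move=> hf hg gx c ac cx; apply: derivable_divC (hf c ac cx) (hg c ac cx) _.
by rewrite /= chart_invE.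
Qed.

Lemma hol_at_cst (a : C) x : hol_at (fun=> a) x.
Proof. by move=> c _ _; exact: derivable_cst. Qed.

Lemma hol_at_pull f h x : (exists2 d, atlas d & chart_dom d (h x)) ->
  holomorphic_map h -> hol_at f (h x) -> hol_at (f \o h) x.
Proof.
move=> [d ad dhx] [ch dh] hf c ac cx.
have dcd := dh c d ac ad x cx dhx.
have df := hf d ad dhx.
have E : (chart_coord d \o h \o chart_inv c x) (chart_coord c x) = chart_coord d (h x).
  by rewrite /= chart_invE.
have df' : derivable (f \o chart_inv d (h x)) ((chart_coord d \o h \o chart_inv c x) (chart_coord c x)) 1.
  by rewrite E.
apply: near_eq_derivable (derivable_compC dcd df').
have nb : \forall y \near x, chart_dom d (h y).
  have [od _ _ _] := reg ad dhx.
  have : nbhs (h x) (chart_dom d) by apply: open_nbhs_nbhs.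
  exact: ch.
apply: filterS (near_chart (P := fun y => chart_dom d (h y)) ac cx nb) => w dw /=.
by have [_ -> //] := reg ad dhx.
Qed.

Lemma holomorphic_map_comp h k : (forall x : S, exists2 d, atlas d & chart_dom d x) ->
  holomorphic_map h -> holomorphic_map k -> holomorphic_map (h \o k).
Proof.
move=> cov [ch dh] hk; have [ck dk] := hk; split.
  by move=> x; apply: continuous_comp; [exact: ck|exact: ch].
move=> c e ac ae x cx ex; have [d ad dx] := cov (k x).
have d1 := dk c d ac ad x cx dx.
have E : (chart_coord d \o k \o chart_inv c x) (chart_coord c x) = chart_coord d (k x).
  by rewrite /= chart_invE.
have d2 : derivable (chart_coord e \o h \o chart_inv d (k x))
    ((chart_coord d \o k \o chart_inv c x) (chart_coord c x)) 1.
  by rewrite E; exact: dh.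
apply: near_eq_derivable (derivable_compC d1 d2).
have nb : \forall y \near x, chart_dom d (k y).
  have [od _ _ _] := reg ad dx.
  have : nbhs (k x) (chart_dom d) by apply: open_nbhs_nbhs.
  exact: ck.
apply: filterS (near_chart (P := fun y => chart_dom d (k y)) ac cx nb) => w dw /=.
by have [_ -> //] := reg ad dx.
Qed.

Definition map_deriv h c d x : C :=
  'D_1 (chart_coord d \o h \o chart_inv c x) (chart_coord c x).

Lemma chart_derivE c d x : chart_deriv c d x = map_deriv id c d x.
Proof. by []. Qed.

Lemma map_deriv_comp h k c d e x : holomorphic_map h -> holomorphic_map k ->
  atlas c -> atlas d -> atlas e ->
  chart_dom c x -> chart_dom d (k x) -> chart_dom e (h (k x)) ->
  map_deriv (h \o k) c e x = map_deriv h d e (k x) * map_deriv k c d x.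
Proof.
move=> [ch dh] [ck dk] ac ad ae cx dkx ehkx.
have d1 := derivableP (dk c d ac ad x cx dkx).
have d2 := derivableP (dh d e ad ae (k x) dkx ehkx).
have d2' : is_derive ((chart_coord d \o k \o chart_inv c x) (chart_coord c x)) 1
    (chart_coord e \o h \o chart_inv d (k x)) (map_deriv h d e (k x)).
  have E : (chart_coord d \o k \o chart_inv c x) (chart_coord c x) = chart_coord d (k x).
    by rewrite /= chart_invE.
  by rewrite E.
have [_ <-] := is_derive_compC d1 d2'.
apply: near_eq_derive.
have nb : \forall y \near x, chart_dom d (k y).
  have [od _ _ _] := reg ad dkx.
  have : nbhs (k x) (chart_dom d) by apply: open_nbhs_nbhs.
  exact: ck.
apply: filterS (near_chart (P := fun y => chart_dom d (k y)) ac cx nb) => w dw /=.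
by have [_ -> //] := reg ad dkx.
Qed.

Lemma map_deriv_id c x : atlas c -> chart_dom c x -> map_deriv id c c x = 1.
Proof.
move=> ac cx; rewrite -(derive_id (R := C) (chart_coord c x) 1).
apply: near_eq_derive; have [_ _ h _] := reg ac cx.
by apply: filterS h => w [].
Qed.

Lemma map_deriv_near h c d x (F : C -> C) :
  (\forall w \near chart_coord c x, chart_coord d (h (chart_inv c x w)) = F w) ->
  map_deriv h c d x = 'D_1 F (chart_coord c x).
Proof. exact: near_eq_derive. Qed.

End HolomorphicAt.

Section FieldIdentities.
Variable K : fieldType.

(** The factors introduced by a change of trivialisations and of charts cancel. This
    identity and the following ones are the algebra of the gluing arguments for lifts. *)
Lemma ratio_change (f t u m t1 t3 k1 k2 : K) :
  t1 != 0 -> t3 != 0 -> u != 0 -> m != 0 -> k1 != 0 -> k2 != 0 ->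
  (t3^-1 * f * t1) ^+ 2 * (k1 * t * t3 ^+ 2) / (k2 * u * t1 ^+ 2 * (k2^-1 * m * k1)) =
  f ^+ 2 * t / (u * m).
Proof. by move=> h1 h2 h3 h4 h5 h6; field; rewrite ?h1 ?h2 ?h3 ?h4 ?h5 ?h6. Qed.

Lemma ratio_normal (f t u m : K) : f != 0 -> t != 0 -> u != 0 -> m != 0 ->
  f ^+ 2 / (f ^+ 2 * t / (u * m)) * t = u * m.
Proof. by move=> f0 t0 u0 m0; field; rewrite f0 t0 u0 m0. Qed.

Lemma ratio_id (s t k k' : K) : k * k' = 1 -> s * t = k * t * s * k'.
Proof. by move=> e; rewrite -[LHS]mul1r -e; ring. Qed.

Lemma ratio_comp (g f t1 t2 t3 t3' h : K) : t1 != 0 -> t2 != 0 -> h != 0 ->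
  t3 * t3' = 1 ->
  t2 * g * t3 * (t3' * f * t1) / (t2 * h * t1) = g * f / h.
Proof.
move=> t10 t20 h0 e.
have -> : t2 * g * t3 * (t3' * f * t1) = (t3 * t3') * (t2 * g * f * t1) by ring.
by rewrite e; field; rewrite t10 t20 h0.
Qed.

Lemma square_comp (f g h t u v d1 d2 : K) : t != 0 -> u != 0 -> h != 0 ->
  g ^+ 2 * t = u * d1 -> f ^+ 2 * u = v * d2 -> h ^+ 2 * t = v * (d2 * d1) ->
  (g * f / h) ^+ 2 = 1.
Proof.
move=> t0 u0 h0 e1 e2 e3.
have h20 : h ^+ 2 != 0 by rewrite sqrf_eq0.
rewrite expr_div_n; apply/eqP; rewrite -subr_eq0 -(mulIr_eq0 _ (mulIf h20)).
rewrite mulrBl mulfVK // mul1r -(mulIr_eq0 _ (mulIf (mulf_neq0 t0 u0))).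
have -> : ((g * f) ^+ 2 - h ^+ 2) * (t * u) =
  (g ^+ 2 * t) * (f ^+ 2 * u) - (h ^+ 2 * t) * u by ring.
by rewrite e1 e2 e3; apply/eqP; ring.
Qed.

End FieldIdentities.

(** * Lifting automorphisms to a theta characteristic *)

Section Lifting.
Variable R : realType.
Local Notation C := (Cx R).
Variable S : surface R.
Hypothesis reg : forall c : chart R S, atlas c -> regular_chart c.
Hypothesis charts : forall x : S, exists2 c, atlas c & chart_dom c x.
Hypothesis hol_id : holomorphic_map (@id S).
Hypothesis discs : has_discs S.
Hypothesis cptS : compact [set: S].
Hypothesis conS : connected [set: S].
Implicit Types (h : S -> S).

(** The condition on the derivative stands for the theorem that derivatives of
    holomorphic functions are holomorphic; it asks for one pair of charts at each
    point. *)
Definition smooth_auto h := automorphism h /\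
  forall x, exists c d, [/\ atlas c, atlas d, chart_dom c x, chart_dom d (h x) &
    hol_at (map_deriv h c d) x].

Lemma map_deriv_neq0 h c d x : automorphism h -> atlas c -> atlas d ->
  chart_dom c x -> chart_dom d (h x) -> map_deriv h c d x != 0.
Proof.
move=> [hh [g [hg hK gK]]] ac ad cx dhx.
have cghx : chart_dom c (g (h x)) by rewrite hK.
have := map_deriv_comp reg hg hh ac ad ac cx dhx cghx.
have -> : g \o h = id by apply/funext => y; exact: hK.
rewrite map_deriv_id // => /eqP; apply: contraTneq => ->.
by rewrite mulr0 oner_eq0.
Qed.

Lemma chart_derivV (c d : chart R S) x : atlas c -> atlas d -> chart_dom c x -> chart_dom d x ->
  chart_deriv d c x * chart_deriv c d x = 1.
Proof.
move=> ac ad cx dx; rewrite !chart_derivE.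
by have := map_deriv_comp reg hol_id hol_id ac ad ac cx dx cx; rewrite map_deriv_id.
Qed.

Lemma map_deriv_change h (c d c' d' : chart R S) x : holomorphic_map h ->
  atlas c -> atlas d -> atlas c' -> atlas d' ->
  chart_dom c x -> chart_dom d (h x) -> chart_dom c' x -> chart_dom d' (h x) ->
  map_deriv h c' d' x = chart_deriv d d' (h x) * map_deriv h c d x * chart_deriv c' c x.
Proof.
move=> hh ac ad ac' ad' cx dx c'x d'x; rewrite !chart_derivE.
have e1 := map_deriv_comp reg hh hol_id ac' ac ad c'x cx dx.
have e2 := map_deriv_comp reg hol_id hh ac' ad ad' c'x dx d'x.
by rewrite -mulrA; apply: (etrans e2); congr (_ * _); exact: e1.
Qed.

Variable L : cocycle S.
Hypothesis bL : line_bundle L.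
Local Notation I := (bundle_idx L).
Local Notation tr := (@bundle_trans R S L).
Local Notation dom := (@bundle_dom R S L).

Lemma trii i x : dom i x -> tr i i x = 1.
Proof. by case: bL => _ _ _ h _; exact: h. Qed.

Lemma trM i j l x : dom i x -> dom j x -> dom l x -> tr i j x * tr j l x = tr i l x.
Proof. by case: bL => _ _ _ _; exact. Qed.

Lemma trV i j x : dom i x -> dom j x -> tr i j x * tr j i x = 1.
Proof. by move=> ix jx; rewrite trM // trii. Qed.

Lemma tr_neq0 i j x : dom i x -> dom j x -> tr i j x != 0.
Proof.
move=> ix jx; have := trV ix jx; apply: contra_eq_neq => ->.
by rewrite mul0r eq_sym oner_eq0.
Qed.

Lemma idx_ex : exists idx : S -> I, forall x, dom (idx x) x.
Proof. by case: bL => _ h _ _ _; have [f fP] := boolp.choice h; exists f. Qed.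

Lemma near_dom i x : dom i x -> \forall y \near x, dom i y.
Proof. by move=> ix; apply: open_nbhs_nbhs; split=> //; case: bL. Qed.

Lemma near_dom_pull i h x : holomorphic_map h -> dom i (h x) ->
  \forall y \near x, dom i (h y).
Proof. by move=> [ch _] /near_dom; exact: ch. Qed.

Lemma hol_tr i j x : dom i x -> dom j x -> hol_at (tr i j) x.
Proof.
case: bL => _ _ h _ _ ix jx.
by have /holomorphic_onP := h i j; apply; split.
Qed.

(* An isomorphism from the square of [L] to the canonical bundle. *)
Variable T : I -> {c : chart R S | atlas c} -> S -> C.
Hypothesis T_hol : forall i c x, dom i x -> chart_dom (sval c) x -> hol_at (T i c) x.
Hypothesis T_neq0 : forall i c x, dom i x -> chart_dom (sval c) x -> T i c x != 0.
Hypothesis T_change : forall i i' c c' x, dom i x -> dom i' x ->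
  chart_dom (sval c) x -> chart_dom (sval c') x ->
  T i' c' x = chart_deriv (sval c') (sval c) x * T i c x * tr i i' x ^+ 2.

(** An isomorphism from the pullback of [L] by [h] to [L]. *)
Definition lift h (F : I -> I -> S -> C) :=
  [/\ forall i j x, dom i (h x) -> dom j x -> hol_at (F i j) x,
      forall i j x, dom i (h x) -> dom j x -> F i j x != 0 &
      forall i i' j j' x, dom i (h x) -> dom i' (h x) -> dom j x -> dom j' x ->
        F i' j' x = tr j' j x * F i j x * tr i i' (h x)].

(** Under the isomorphism [T], the square of [F] is the natural action of [h] on the
    canonical bundle. *)
Definition square_lift h (F : I -> I -> S -> C) :=
  forall i j c d x, dom i (h x) -> dom j x ->
    chart_dom (sval c) x -> chart_dom (sval d) (h x) ->
    F i j x ^+ 2 * T j c x = T i d (h x) * map_deriv h (sval c) (sval d) x.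

Lemma pullback_lift h : bundle_iso (pullback h L) L -> exists F, lift h F.
Proof.
move=> [F [hF F0 Fc]]; exists F; split=> // i j x ix jx.
by have /holomorphic_onP := hF i j; apply; split.
Qed.

(** The square of any lift and the action on the canonical bundle differ by a
    nonvanishing holomorphic function on a compact surface, that is by a constant; the
    lift is divided by a square root of it. *)
Lemma lift_square h : smooth_auto h -> (exists F, lift h F) ->
  exists2 F, lift h F & square_lift h F.
Proof.
move=> [ah nh] [f [hf f0 fc]].
have hh : holomorphic_map h by case: ah.
have [idx idxP] := idx_ex.
have chart_ex x : exists c : {c : chart R S | atlas c}, chart_dom (sval c) x.
  by have [c ac cx] := charts x; exists (exist _ c ac).
have [ch chP] := boolp.choice chart_ex.
pose r i j (c d : {c : chart R S | atlas c}) x :=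
  f i j x ^+ 2 * T j c x / (T i d (h x) * map_deriv h (sval c) (sval d) x).
have rE i j c d i' j' c' d' x : dom i (h x) -> dom j x -> chart_dom (sval c) x ->
    chart_dom (sval d) (h x) -> dom i' (h x) -> dom j' x -> chart_dom (sval c') x ->
    chart_dom (sval d') (h x) -> r i' j' c' d' x = r i j c d x.
  move=> ix jx cx dx i'x j'x c'x d'x; rewrite /r.
  have ac := svalP c; have ad := svalP d; have ac' := svalP c'; have ad' := svalP d'.
  rewrite (fc i i' j j' x ix i'x jx j'x) (T_change jx j'x cx c'x).
  rewrite (T_change ix i'x dx d'x).
  rewrite (map_deriv_change hh ac ad ac' ad' cx dx c'x d'x).
  have e1 := chart_derivV ad' ad d'x dx; have e2 := trV j'x jx.
  have t1 := tr_neq0 ix i'x; have t3 := tr_neq0 jx j'x.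
  have n1 := T_neq0 ix dx; have n2 := map_deriv_neq0 ah ac ad cx dx.
  have k1 : chart_deriv (sval c') (sval c) x != 0.
    have := chart_derivV ac' ac c'x cx.
    by apply: contra_eq_neq => ->; rewrite mulr0 eq_sym oner_eq0.
  have k2 : chart_deriv (sval d') (sval d) (h x) != 0.
    by move: e1; apply: contra_eq_neq => ->; rewrite mulr0 eq_sym oner_eq0.
  have -> : chart_deriv (sval d) (sval d') (h x) = (chart_deriv (sval d') (sval d) (h x))^-1.
    by apply: (mulIf k2); rewrite e1 mulVf.
  have -> : tr j' j x = (tr j j' x)^-1 by apply: (mulIf t3); rewrite e2 mulVf.
  exact: (@ratio_change C (f i j x) (T j c x) (T i d (h x))
    (map_deriv h (sval c) (sval d) x) (tr i i' (h x)) (tr j j' x)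
    (chart_deriv (sval c') (sval c) x) (chart_deriv (sval d') (sval d) (h x))
    t1 t3 n1 n2 k1 k2).
(* the ratio of the two actions, which no trivialisation or chart affects *)
pose rho x := r (idx (h x)) (idx x) (ch x) (ch (h x)) x.
have rhoE i j c d x : dom i (h x) -> dom j x -> chart_dom (sval c) x ->
    chart_dom (sval d) (h x) -> rho x = r i j c d x.
  by move=> *; apply: rE => //; exact: idxP || exact: chP.
have rho0 x : rho x != 0.
  rewrite /rho /r; apply: mulf_neq0.
    by apply: mulf_neq0; [apply: expf_neq0; exact: f0|exact: T_neq0].
  rewrite invr_neq0 //; apply: mulf_neq0; first exact: T_neq0.
  exact: map_deriv_neq0 ah (svalP _) (svalP _) (chP _) (chP _).
have rho_hol : holomorphic_on setT rho.
  apply/holomorphic_onP => x _.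
  have [c [d [ac ad cx dx hD]]] := nh x.
  pose c' : {c : chart R S | atlas c} := exist _ c ac.
  pose d' : {c : chart R S | atlas c} := exist _ d ad.
  have ix := idxP (h x); have jx := idxP x.
  have hr : hol_at (r (idx (h x)) (idx x) c' d') x.
    have hF := hf _ _ _ ix jx.
    have hn := hol_at_mul (hol_at_mul hF hF) (@T_hol (idx x) c' x jx cx).
    have hTd : hol_at (T (idx (h x)) d' \o h) x.
      by apply: (hol_at_pull reg _ hh); [exists d|exact: T_hol].
    have hd := hol_at_mul hTd hD.
    have nd : T (idx (h x)) d' (h x) * map_deriv h c d x != 0.
      by apply: mulf_neq0; [exact: (@T_neq0 _ d')|exact: map_deriv_neq0].
    exact: (hol_at_div reg hn hd nd).
  apply: (hol_at_near reg) hr.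
  have n1 := near_dom_pull hh ix; have n2 := near_dom jx.
  have n3 : \forall y \near x, chart_dom c y.
    by have [oc _ _ _] := reg ac cx; apply: open_nbhs_nbhs.
  have n4 : \forall y \near x, chart_dom d (h y).
    have [od _ _ _] := reg ad dx.
    have : nbhs (h x) (chart_dom d) by apply: open_nbhs_nbhs.
    by case: hh => chh _; exact: chh.
  apply: filterS2 (filterI n1 n2) (filterI n3 n4) => y [i1 i2] [i3 i4].
  exact: (esym (rhoE (idx (h x)) (idx x) c' d' y i1 i2 i3 i4)).
have rhoC := constant_holomorphic discs cptS conS rho_hol.
have [[x0]|noS] := pselect (exists x0 : S, True); last first.
  exists f => // i j c d x; exfalso; apply: noS; by exists x.
move=> _; pose mu := sqrtC (rho x0).
have mu2 : mu ^+ 2 = rho x0 by rewrite sqrtCK.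
have mu0 : mu != 0 by rewrite -(sqrf_eq0 mu) mu2 rho0.
exists (fun i j x => f i j x / mu).
  split=> [i j x ix jx|i j x ix jx|i i' j j' x ix i'x jx j'x].
  - have hc : hol_at (fun=> mu : C) x by exact: hol_at_cst.
    exact: (hol_at_div reg (hf _ _ _ ix jx) hc mu0).
  - by rewrite mulf_neq0 ?invr_neq0 ?f0.
  - by rewrite (fc i i' j j' x ix i'x jx j'x); ring.
move=> i j c d x ix jx cx dx.
rewrite expr_div_n mu2 (rhoC x0 x) (rhoE i j c d x ix jx cx dx) /r.
have n1 := T_neq0 ix dx; have n2 := map_deriv_neq0 ah (svalP c) (svalP d) cx dx.
exact: ratio_normal (f0 i j x ix jx) (T_neq0 jx cx) n1 n2.
Qed.

Lemma lift_id : lift id (fun i j => tr j i) /\ square_lift id (fun i j => tr j i).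
Proof.
split; first split.
- by move=> i j x ix jx; exact: hol_tr.
- by move=> i j x ix jx; exact: tr_neq0.
- move=> i i' j j' x ix i'x jx j'x.
  by rewrite -(trM j'x ix i'x) -(trM j'x jx ix).
move=> i j c d x ix jx cx dx.
rewrite (T_change jx ix cx dx) -chart_derivE.
have e := chart_derivV (svalP c) (svalP d) cx dx.
exact: (@ratio_id C (tr j i x ^+ 2) (T j c x) _ _ e).
Qed.

Section Composition.
Variables (h k m : S -> S) (F G H : I -> I -> S -> C).
Hypotheses (ah : automorphism h) (ak : automorphism k).
Hypothesis hk : forall x, h (k x) = m x.
Hypotheses (lF : lift h F) (lG : lift k G) (lH : lift m H).
Hypotheses (sF : square_lift h F) (sG : square_lift k G) (sH : square_lift m H).

(** The composite of two normalised lifts and the normalised lift of the composite have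
    the same square, so that their ratio is a holomorphic function with values 1 and
    -1, hence a constant. *)
Lemma lift_comp : exists2 eps : C, eps ^+ 2 = 1 &
  forall i j l x, dom i (m x) -> dom j (k x) -> dom l x ->
    G j l x * F i j (k x) = eps * H i l x.
Proof.
have hh : holomorphic_map h by case: ah.
have hk' : holomorphic_map k by case: ak.
have [idx idxP] := idx_ex.
have [F1 F2 F3] := lF; have [G1 G2 G3] := lG; have [H1 H2 H3] := lH.
pose e i j l x := G j l x * F i j (k x) / H i l x.
have eE i j l i' j' l' x : dom i (m x) -> dom j (k x) -> dom l x ->
    dom i' (m x) -> dom j' (k x) -> dom l' x -> e i' j' l' x = e i j l x.
  move=> ix jx lx i'x j'x l'x; rewrite /e.
  have ix' : dom i (h (k x)) by rewrite hk.
  have i'x' : dom i' (h (k x)) by rewrite hk.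
  rewrite (G3 j j' l l' x jx j'x lx l'x) (F3 i i' j j' (k x) ix' i'x' jx j'x).
  rewrite (H3 i i' l l' x ix i'x lx l'x) hk.
  have t1 := tr_neq0 ix i'x; have t2 := tr_neq0 l'x lx; have t3 := trV jx j'x.
  exact: (ratio_comp (G j l x) (F i j (k x)) t1 t2 (H2 i l x ix lx) t3).
have e2 i j l x : dom i (m x) -> dom j (k x) -> dom l x -> e i j l x ^+ 2 = 1.
  move=> ix jx lx.
  have [c ac cx] := charts x; have [d ad dx] := charts (k x); have [b ab bx] := charts (m x).
  have ix' : dom i (h (k x)) by rewrite hk.
  have bx' : chart_dom b (h (k x)) by rewrite hk.
  have q1 := @sG j l (exist _ c ac) (exist _ d ad) x jx lx cx dx.
  have q2 := @sF i j (exist _ d ad) (exist _ b ab) (k x) ix' jx dx bx'.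
  have q3 := @sH i l (exist _ c ac) (exist _ b ab) x ix lx cx bx.
  have q4 := map_deriv_comp reg hh hk' ac ad ab cx dx bx'.
  have hkm : h \o k = m by apply/funext => y; exact: hk.
  rewrite hkm in q4; rewrite /= in q1 q2 q3; rewrite q4 in q3; rewrite hk in q2.
  have T1 := @T_neq0 l (exist _ c ac) x lx cx.
  have T2 := @T_neq0 j (exist _ d ad) (k x) jx dx.
  exact: (square_comp T1 T2 (H2 i l x ix lx) q1 q2 q3).
pose eps x := e (idx (m x)) (idx (k x)) (idx x) x.
have epsE i j l x : dom i (m x) -> dom j (k x) -> dom l x -> eps x = e i j l x.
  by move=> ix jx lx; exact: eE ix jx lx (idxP _) (idxP _) (idxP _).
have hm : holomorphic_map m.
  have -> : m = h \o k by apply/funext => y; rewrite -hk.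
  exact: (holomorphic_map_comp reg charts hh hk').
have eps_hol : holomorphic_on setT eps.
  apply/holomorphic_onP => x _.
  have ix := idxP (m x); have jx := idxP (k x); have lx := idxP x.
  have ix' : dom (idx (m x)) (h (k x)) by rewrite hk.
  have [d ad dx] := charts (k x).
  have hF : hol_at (F (idx (m x)) (idx (k x)) \o k) x.
    by apply: (hol_at_pull reg _ hk'); [exists d|exact: F1].
  have hr := hol_at_div reg (hol_at_mul (G1 _ _ _ jx lx) hF) (H1 _ _ _ ix lx) (H2 _ _ _ ix lx).
  apply: (hol_at_near reg) hr.
  apply: filterS2 (near_dom_pull hm ix) (filterI (near_dom_pull hk' jx) (near_dom lx)).
  by move=> y iy [jy ly]; rewrite (epsE _ _ _ _ iy jy ly).
have epsC := constant_holomorphic discs cptS conS eps_hol.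
have [[x0 _]|noS] := pselect (exists x0 : S, True); last first.
  exists 1; first by rewrite expr1n.
  by move=> i j l x; exfalso; apply: noS; exists x.
exists (eps x0); first by apply: e2; exact: idxP.
move=> i j l x ix jx lx; rewrite (epsC x0 x) (epsE i j l x ix jx lx) /e.
by rewrite mulfVK // H2.
Qed.

End Composition.

Section Operator.
Variable idx : S -> I.
Hypothesis idxP : forall x, dom (idx x) x.

(** The choice of the trivialisation [idx] at each point does not matter, by
    [lift_actE]. *)
Definition lift_act h (F : I -> I -> S -> C) (s : I -> S -> C) : I -> S -> C :=
  fun j x => if `[< dom j x >] then F (idx (h x)) j x * s (idx (h x)) (h x) else 0.

Lemma lift_actE h F s i j x : lift h F -> global_sections (L := L) s ->
  dom i (h x) -> dom j x -> lift_act h F s j x = F i j x * s i (h x).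
Proof.
move=> [_ _ F3] [_ ts _] ix jx; rewrite /lift_act asboolT //.
have i'x := idxP (h x).
rewrite (F3 i (idx (h x)) j j x ix i'x jx jx) (trii jx) mul1r -mulrA.
by rewrite (ts i (idx (h x)) (h x) ix i'x).
Qed.

Lemma lift_act_section h F s : holomorphic_map h -> lift h F ->
  global_sections (L := L) s -> global_sections (L := L) (lift_act h F s).
Proof.
move=> hh lF gs; have [F1 F2 F3] := lF; have [hs ts zs] := gs; split.
- move=> j; apply/holomorphic_onP => x jx.
  have ix := idxP (h x).
  have [d ad dx] := charts (h x).
  have hsx : hol_at (s (idx (h x))) (h x) by have /holomorphic_onP := hs (idx (h x)); apply.
  have hS : hol_at (s (idx (h x)) \o h) x.
    by apply: (hol_at_pull reg _ hh) => //; exists d.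
  have hr := hol_at_mul (F1 _ _ _ ix jx) hS.
  apply: (hol_at_near reg) hr.
  apply: filterS2 (near_dom_pull hh ix) (near_dom jx) => y iy jy.
  by rewrite (lift_actE lF gs iy jy).
- move=> j j' x jx j'x; have ix := idxP (h x).
  rewrite (lift_actE lF gs ix jx) (lift_actE lF gs ix j'x).
  by rewrite (F3 _ _ j' j x ix ix j'x jx) (trii ix) mulr1 mulrA.
- by move=> j x njx; rewrite /lift_act asboolF.
Qed.

Lemma lift_act_linear h F (a : C) s t :
  lift_act h F (a *: s + t) = a *: lift_act h F s + lift_act h F t.
Proof.
apply/funext => j; apply/funext => x.
have E (u v : I -> S -> C) i y : (a *: u + v) i y = a * u i y + v i y by [].
rewrite E /lift_act; case: asboolP => _; last by rewrite mulr0 addr0.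
by rewrite E mulrDr mulrCA.
Qed.

Lemma lift_act_comp h k m F G H (eps : C) s : holomorphic_map h -> holomorphic_map k ->
  lift h F -> lift k G -> lift m H -> (forall x, h (k x) = m x) ->
  (forall i j l x, dom i (m x) -> dom j (k x) -> dom l x ->
    G j l x * F i j (k x) = eps * H i l x) ->
  global_sections (L := L) s ->
  lift_act k G (lift_act h F s) = eps *: lift_act m H s.
Proof.
move=> hh hk lF lG lH hkm GF gs.
apply/funext => l; apply/funext => x.
have -> : (eps *: lift_act m H s) l x = eps * lift_act m H s l x by [].
have [lx|nlx] := pselect (dom l x); last first.
  by rewrite /lift_act !asboolF ?mulr0.
have jx := idxP (k x); have ix := idxP (m x).
have ix' : dom (idx (m x)) (h (k x)) by rewrite hkm.
have gs' := lift_act_section hh lF gs.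
rewrite (lift_actE lG gs' jx lx) (lift_actE lF gs ix' jx) (lift_actE lH gs ix lx).
by rewrite mulrA (GF _ _ _ _ ix jx lx) hkm mulrA.
Qed.

End Operator.

Lemma lift_act_id idx s : (forall x, dom (idx x) x) -> global_sections (L := L) s ->
  lift_act idx id (fun i j => tr j i) s = s.
Proof.
move=> idxP gs; have [lid _] := lift_id.
apply/funext => j; apply/funext => x; have [_ _ zs] := gs.
have [jx|njx] := pselect (dom j x); last by rewrite /lift_act asboolF // zs.
by rewrite (lift_actE idxP lid gs jx jx) (trii jx) mul1r.
Qed.

(** The square of the lift is a constant sign by [lift_comp]; at the fixed point the
    normalisation says that it is the derivative of [h], namely -1. *)
Lemma lift_involution h F x c : automorphism h -> lift h F -> square_lift h F ->
  (forall y, h (h y) = y) -> h x = x -> atlas c -> chart_dom c x ->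
  map_deriv h c c x = -1 ->
  forall i j l y, dom i y -> dom j (h y) -> dom l y ->
    F j l y * F i j (h y) = -1 * tr l i y.
Proof.
move=> ah lF sF hh hx ac cx Dx.
have [lid sid] := lift_id.
have [eps _ H] := lift_comp ah ah hh lF lF lid sF sF sid.
have [idx idxP] := idx_ex.
have ix := idxP x.
have ihx : dom (idx x) (h x) by rewrite hx.
have chx : chart_dom c (h x) by rewrite hx.
have := H (idx x) (idx x) (idx x) x ix ihx ix.
have := sF (idx x) (idx x) (exist _ c ac) (exist _ c ac) x ihx ix cx chx.
rewrite /= hx Dx (trii ix) mulr1 -expr2 => e1 e2.
have T0 := @T_neq0 (idx x) (exist _ c ac) x ix cx.
have epsN1 : eps = -1.
  by apply: (mulIf T0); rewrite -e2 e1 mulrC.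
by move=> i j l y iy jy ly; rewrite (H i j l y iy jy ly) epsN1.
Qed.

(** The normalised lifts of [a], [b] and [m] act on the sections with square -1, and the
    composite of the first two is plus or minus the third: [quaternion_even] applies. *)
Theorem even_h0 (a b m : S -> S) : aut_invariant L ->
  smooth_auto a -> smooth_auto b -> smooth_auto m ->
  (forall x, a (b x) = m x) ->
  (forall h, h = a \/ h = b \/ h = m -> (forall x, h (h x) = x) /\
     exists x c, [/\ h x = x, atlas c, chart_dom c x & map_deriv h c c x = -1]) ->
  exists n, h0 L n /\ ~~ odd n.
Proof.
move=> invL sa sb sm abm inv.
have [n dimL] := h0_finite discs cptS bL.
exists n; split=> //.
have [idx idxP] := idx_ex.
have lifts h : smooth_auto h -> exists2 F, lift h F & square_lift h F.
  by move=> sh; apply: lift_square => //; apply: pullback_lift; apply: invL; case: sh.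
have [Fa lFa sFa] := lifts a sa; have [Fb lFb sFb] := lifts b sb.
have [Fm lFm sFm] := lifts m sm.
have ha : holomorphic_map a by case: sa => [[]].
have hb : holomorphic_map b by case: sb => [[]].
have hm : holomorphic_map m by case: sm => [[]].
have [lid sid] := lift_id.
have [eps eps2 ab] := lift_comp sa.1 sb.1 abm lFa lFb lFm sFa sFb sFm.
have sqN h F s : smooth_auto h -> h = a \/ h = b \/ h = m -> lift h F -> square_lift h F ->
    global_sections (L := L) s -> lift_act idx h F (lift_act idx h F s) = - s.
  move=> sh hE lF sF gs; have [hh [x [c [hx ac cx Dx]]]] := inv h hE.
  have hmap : holomorphic_map h by case: sh => [[]].
  have H := lift_involution sh.1 lF sF hh hx ac cx Dx.
  rewrite (lift_act_comp idxP hmap hmap lF lF lid hh H gs).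
  by rewrite (lift_act_id idxP gs) scaleN1r.
have stab h F : holomorphic_map h -> lift h F ->
    stable_linear (global_sections (L := L)) (lift_act idx h F).
  move=> hh lF; split; first by move=> s; exact: lift_act_section.
  by move=> r s t; exact: lift_act_linear.
apply: (quaternion_even dimL (al := lift_act idx a Fa) (be := lift_act idx b Fb)).
- by rewrite eq_sym -subr_eq0 -opprD oppr_eq0 -[1 + 1]/(2%:R) pnatr_eq0.
- exact: stab.
- exact: stab.
- by move=> s; apply: sqN => //; left.
- by move=> s; apply: sqN => //; right; left.
- move=> s gs.
  have E t : global_sections (L := L) t ->
      lift_act idx b Fb (lift_act idx a Fa t) = eps *: lift_act idx m Fm t.
    exact: (lift_act_comp idxP ha hb lFa lFb lFm abm ab).
  have gm := lift_act_section idxP hm lFm gs.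
  have gZ t : global_sections (L := L) t -> global_sections (L := L) (eps *: t).
    by move=> gt; rewrite -[eps *: t]addr0; apply: sectionsD => //; exact: sections0.
  rewrite (E s gs) (E _ (gZ _ gm)).
  have -> : eps *: lift_act idx m Fm s = eps *: lift_act idx m Fm s + 0 by rewrite addr0.
  rewrite lift_act_linear (sqN m Fm s sm (or_intror (or_intror erefl)) lFm sFm gs).
  have -> : lift_act idx m Fm 0 = 0.
    have := lift_act_linear idx m Fm (-1) 0 0.
    by rewrite scaler0 add0r scaleN1r addNr.
  by rewrite addr0 scalerA -expr2 eps2 scale1r.
Qed.

End Lifting.

(** * The modular group on the upper half plane *)

Section ModularGroup.
Variable R : realType.
Local Notation C := (Cx R).
Implicit Types (g h : SL2Z) (z : C) (x y : hstar R).

Lemma detS g : \det (val g) = 1. Proof. exact: eqP (valP g). Qed.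

Lemma det_smul g h : \det (val g *m val h) = 1.
Proof. by rewrite det_mulmx !detS mulr1. Qed.

Lemma det_sinv g : \det (\adj (val g)) = 1.
Proof.
by have := congr1 determinant (mul_mx_adj (val g)); rewrite det_mulmx detS det1 mul1r.
Qed.

Definition smul g h : SL2Z := toSL2Z (det_smul g h).
Definition sinv g : SL2Z := toSL2Z (det_sinv g).

Lemma moebius_actM g h x : moebius_act (smul g h) x = moebius_act g (moebius_act h x).
Proof. by apply: val_inj; rewrite /= moebiusM ?detS. Qed.

Lemma moebius_actK g x : moebius_act (sinv g) (moebius_act g x) = x.
Proof.
apply: val_inj; rewrite /= -moebiusM ?detS ?det_sinv //.
by rewrite mul_adj_mx detS moebius1.
Qed.

Lemma moebius_actVK g x : moebius_act g (moebius_act (sinv g) x) = x.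
Proof.
apply: val_inj; rewrite /= -moebiusM ?detS ?det_sinv //.
by rewrite mul_mx_adj detS moebius1.
Qed.

(** Only meant for [z] in the upper half plane. *)
Definition up z : hstar R := insubd (cusp_infty R) (Some z).

Lemma hpt_up z : 0 < imag z -> hpt (up z) = Some z.
Proof. by move=> z0; rewrite /up -[hpt _]/(val _) insubdK // unfold_in /= z0. Qed.

Lemma upE x z : hpt x = Some z -> 0 < imag z -> x = up z.
Proof. by move=> xz z0; apply: val_inj; rewrite /= hpt_up. Qed.

Lemma up_inj z w : 0 < imag z -> 0 < imag w -> up z = up w -> z = w.
Proof. by move=> z0 w0 /(congr1 (@hpt R)); rewrite !hpt_up // => -[]. Qed.

Definition ent g i j : C := (val g i j)%:~R.
Definition den g z : C := ent g 1 0 * z + ent g 1 1.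
Definition mob g z : C := (ent g 0 0 * z + ent g 0 1) / den g z.

Lemma ent_det g : ent g 0 0 * ent g 1 1 - ent g 0 1 * ent g 1 0 = 1.
Proof. by rewrite /ent det_intr // detS. Qed.

Lemma ent_real g i j : ent g i j = ((val g i j)%:~R : R)%:C.
Proof. by rewrite /ent rmorph_int. Qed.

Lemma Im_den g z : complex.Im (den g z) = (val g 1 0)%:~R * imag z.
Proof. by rewrite /den !ent_real; case: z => a b; rewrite /imag /= mul0r !addr0. Qed.

Lemma den_neq0 g z : 0 < imag z -> den g z != 0.
Proof.
move=> z0; apply/eqP => d0.
have := Im_den g z; rewrite d0 /= => /esym/eqP; rewrite mulf_eq0 (gt_eqF z0) orbF => /eqP c0.
have c0' : ent g 1 0 = 0 by rewrite ent_real c0.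
have := ent_det g; rewrite c0' mulr0 subr0.
move: d0; rewrite /den c0' mul0r add0r => ->; rewrite mulr0 => /eqP.
by rewrite eq_sym oner_eq0.
Qed.

Lemma imag_mob g z : 0 < imag z -> imag (mob g z) = imag z / nm (den g z) ^+ 2.
Proof.
move=> z0; have d0 := den_neq0 g z0.
have : nm (den g z) ^+ 2 != 0 by rewrite sqrf_eq0 nm_eq0.
have := det_intr R (detS g); rewrite nm_sqr /mob /den !ent_real.
move: (_%:~R : R) (_%:~R : R) (_%:~R : R) (_%:~R : R) => a d b c det1.
case: z {z0 d0} => x y; rewrite /imag /=; simpc => /= n0.
apply: (@etrans _ _ ((c * b - d * a) * y / ((a * x + b) ^+ 2 + (a * y) ^+ 2))).
  by field.
by rewrite det1 mul1r.
Qed.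

Lemma imag_mob_gt0 g z : 0 < imag z -> 0 < imag (mob g z).
Proof.
by move=> z0; rewrite imag_mob // divr_gt0 // exprn_gt0 // nm_gt0 den_neq0.
Qed.

Lemma act_up g z : 0 < imag z -> moebius_act g (up z) = up (mob g z).
Proof.
move=> z0; apply: upE; last exact: imag_mob_gt0.
by rewrite /= hpt_up //=; have := den_neq0 g z0; rewrite /den /ent => /negPf ->.
Qed.

Lemma mobM g h z : 0 < imag z -> mob (smul g h) z = mob g (mob h z).
Proof.
move=> z0; apply: up_inj; rewrite ?imag_mob_gt0 //.
by rewrite -!act_up ?imag_mob_gt0 // moebius_actM.
Qed.

Lemma is_derive_mob g z : 0 < imag z -> is_derive z 1 (mob g) ((den g z ^+ 2)^-1).
Proof.
move=> z0; have d0 := den_neq0 g z0.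
have dl (a b : C) : is_derive z 1 (fun w : C => a * w + b) a.
  have h := is_derive_mulC (is_derive_cst a z 1) (is_derive_id z 1).
  have h2 := is_deriveD h (is_derive_cst b z 1).
  by apply: is_derive_eq h2 _; rewrite mul0r add0r addr0 /cst mulr1.
have := is_derive_divC (dl (ent g 0 0) (ent g 0 1)) (dl (ent g 1 0) (ent g 1 1)) d0.
move=> h; apply: is_derive_eq h _; rewrite -/(den g z).
rewrite -[RHS]mul1r -(ent_det g); congr (_ / _).
by rewrite /den; ring.
Qed.

Lemma derivable_mob g z : 0 < imag z -> derivable (mob g) z 1.
Proof. by move=> z0; have [] := is_derive_mob g z0. Qed.

Lemma imag_addz z (k : int) : imag (z + k%:~R) = imag z.
Proof. by rewrite /imag raddfD /= -(rmorph_int (real_complex R)) /= addr0. Qed.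

Lemma near_imag (r : R) z : r < imag z -> \forall w \near z, r < imag w.
Proof.
move=> z0; apply/nearCP; exists (imag z - r); first by rewrite subr_gt0.
move=> w /(le_lt_trans (nm_Im _)); rewrite raddfB /= -/(imag z) -/(imag w) ltr_distl.
by move=> /andP[h _]; move: h; rewrite opprB subrKC.
Qed.

Lemma cusp_Bezout (a c : int) : coprimez a c -> exists g, val g 0 0 = a /\ val g 1 0 = c.
Proof.
move=> /coprimezP[[u v] /= uv].
pose M : 'M[int]_2 := \matrix_(i, j) if i == 0 then (if j == 0 then a else - v)
   else (if j == 0 then c else u).
have dM : \det M = 1 by rewrite det2E !mxE /= mulNr opprK -uv mulrC [v * c]mulrC [c * v]mulrC.
by exists (toSL2Z dM); rewrite /= !mxE.
Qed.

(** The numerator and denominator of a rational number form the first column of a matrix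
    of determinant 1. *)
Lemma hstarP x : (exists2 z, 0 < imag z & x = up z) \/
  (exists g, x = moebius_act g (cusp_infty R)).
Proof.
have Hx := hptP x; case e : (hpt x) Hx => [z|] /=; last first.
  move=> _; right; exists (toSL2Z (det1 _ _)); apply: val_inj.
  by rewrite /= e !mxE /= eqxx.
move=> /orP[z0|/asboolP[q zq]].
  by left; exists z => //; exact: upE.
right; have [g [g0 g1]] := @cusp_Bezout (numq q) (denq q) (coprime_num_den q).
exists g; apply: val_inj; rewrite /= e g0 g1.
have -> : ((denq q)%:~R == 0 :> C) = false by rewrite intr_eq0 denq_eq0.
by rewrite zq /ratr.
Qed.

Lemma hpt_cusp_imag g z : hpt (moebius_act g (cusp_infty R)) = Some z -> imag z = 0.
Proof.
rewrite /=; case: ifP => // _ [<-].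
rewrite -!/(ent _ _ _) !ent_real -fmorphV -rmorphM /=.
by [].
Qed.

Lemma up_not_cusp z g : 0 < imag z -> up z <> moebius_act g (cusp_infty R).
Proof.
move=> z0 /(congr1 (@hpt R)); rewrite hpt_up // => /esym/hpt_cusp_imag e.
by rewrite e ltxx in z0.
Qed.

Lemma fix_infty g : (moebius_act g (cusp_infty R) = cusp_infty R) <-> val g 1 0 = 0.
Proof.
split=> [/(congr1 (@hpt R)) /=|c0].
  by case: ifP => // /eqP e _; apply/eqP; rewrite -(intr_eq0 C) e.
by apply: val_inj; rewrite /= c0 eqxx.
Qed.

Lemma c0_unit g : val g 1 0 = 0 ->
  (val g 0 0 = 1 /\ val g 1 1 = 1) \/ (val g 0 0 = -1 /\ val g 1 1 = -1).
Proof.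
move=> c0; have := detS g; rewrite det2E c0 mulr0 subr0 => ad.
have : (val g 0 0 == 1) || (val g 0 0 == -1).
  have := congr1 absz ad; rewrite abszM => /eqP; rewrite muln_eq1 => /andP[/eqP n1 _].
  by case: (val g 0 0) n1 => [m|m] /=; rewrite ?NegzE /= => -> //; case.
case/orP => /eqP a1; [left|right]; split=> //; move: ad; rewrite a1.
  by rewrite mul1r.
by rewrite mulN1r => /eqP; rewrite eqr_oppLR => /eqP.
Qed.

Lemma mob_translation g : val g 1 0 = 0 ->
  exists k : int, (forall z, mob g z = z + k%:~R) /\
    (val g 0 1 = k \/ val g 0 1 = - k).
Proof.
move=> c0; case: (c0_unit c0) => [[a1 d1]|[a1 d1]].
  exists (val g 0 1); split; last by left.
  by move=> z; rewrite /mob /den /ent c0 a1 d1 mul0r add0r mul1r divr1.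
have N1 : ((-1 : int)%:~R : C) = -1 by rewrite rmorphN.
exists (- val g 0 1); split; last by right; rewrite opprK.
move=> z; rewrite /mob /den /ent c0 a1 d1 mul0r add0r N1 mulN1r rmorphN /=.
by rewrite invrN1 mulrN1 opprD opprK.
Qed.

(** If the lower left entry is nonzero, the height of the image is at most the inverse
    of the height of [z]. *)
Lemma high_translation g z : 1 < imag z -> 1 < imag (mob g z) -> val g 1 0 = 0.
Proof.
move=> z1 gz1; apply/eqP/negPn/negP => c0.
have z0 : 0 < imag z by exact: lt_trans z1.
have n0 : 0 < nm (den g z) by rewrite nm_gt0 den_neq0.
move: gz1; rewrite imag_mob // ltr_pdivlMr ?exprn_gt0 // mul1r ltNge => /negP; apply.
have c1 : 1 <= `|(val g 1 0)%:~R : R|.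
  by rewrite -intr_norm -[1]/(1%:~R) ler_int -gtz0_ge1 normr_gt0.
have yn : imag z <= nm (den g z).
  apply: le_trans (nm_Im _); rewrite Im_den normrM [`|imag z|]gtr0_norm //.
  by rewrite ler_peMl // ltW.
apply: (@le_trans _ _ (imag z ^+ 2)); first by rewrite expr2 ler_peMl // ltW.
by rewrite lerXn2r ?nnegrE ?nm_ge0 // ltW.
Qed.

End ModularGroup.

(** * The action of Gamma(p) and the space X(p) *)

Section Congruence.
Variable R : realType.
Local Notation C := (Cx R).
Variable p : nat.
Hypothesis p4 : (4 < p)%N.
Implicit Types (g h : SL2Z) (z w : C) (x y : hstar R).
Local Notation X := (modular_space R p).
Local Notation pr := (@modular_proj R p).
Local Notation act := moebius_act.
Local Notation infty := (cusp_infty R).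
Local Notation ent := (ent R).

Let p1 : (1 < p)%N. Proof. exact: leq_trans p4. Qed.

Lemma Zp_int0 (n : int) : ((n%:~R : 'Z_p) == 0) = (p%:Z %| n)%Z.
Proof.
have nat0 (m : nat) : ((m%:R : 'Z_p) == 0) = (p %| m)%N.
  by rewrite -val_eqE /= val_Zp_nat.
case: n => m; first by rewrite [LHS]nat0.
by rewrite NegzE rmorphN /= oppr_eq0 [LHS]nat0 dvdzE.
Qed.

Lemma in_GammaP g : in_Gamma p g -> [/\ (p%:Z %| (val g 0 0 - 1)%R)%Z, (p%:Z %| (val g 0 1)%R)%Z,
  (p%:Z %| (val g 1 0)%R)%Z & (p%:Z %| (val g 1 1 - 1)%R)%Z].
Proof.
move=> /eqP e; have E i j := congr1 (fun M : 'M['Z_p]_2 => M i j) e.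
split; rewrite -Zp_int0 ?rmorphB /= ?subr_eq0; have := E 0 0; have := E 0 1;
have := E 1 0; have := E 1 1; rewrite !mxE /= => h1 h2 h3 h4.
- by rewrite h4.
- by rewrite h3.
- by rewrite h2.
- by rewrite h1.
Qed.

Lemma map_sinv g : map_mx (intr : int -> 'Z_p) (val g) *m map_mx intr (val (sinv g)) = 1%:M.
Proof. by rewrite -map_mxM /= mul_mx_adj detS map_mx1. Qed.

Lemma Gamma_conj g h : in_Gamma p h -> in_Gamma p (smul g (smul h (sinv g))).
Proof.
by move=> /eqP eh; rewrite /in_Gamma /smul /= !map_mxM eh mul1mx map_sinv.
Qed.

Lemma prP x y : pr x = pr y <-> exists2 h, in_Gamma p h & act h x = y.
Proof.
split=> [/eqmodP/asboolP//|H].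
by apply/eqmodP; apply/asboolP.
Qed.

Lemma pr_Gamma h x : in_Gamma p h -> pr (act h x) = pr x.
Proof. by move=> hG; apply/esym/prP; exists h. Qed.

Lemma pr_act g x y : pr x = pr y -> pr (act g x) = pr (act g y).
Proof.
move=> /prP[h hG <-]; apply/prP; exists (smul g (smul h (sinv g))); first exact: Gamma_conj.
by rewrite !moebius_actM moebius_actK.
Qed.

(** Only the residue of a matrix modulo p acts on X(p). *)
Lemma pr_congr g h x : map_mx (intr : int -> 'Z_p) (val g) = map_mx intr (val h) ->
  pr (act g x) = pr (act h x).
Proof.
move=> e; apply/prP; exists (smul h (sinv g)); last by rewrite moebius_actM moebius_actK.
by rewrite /in_Gamma /smul /= map_mxM -e map_sinv.
Qed.

Lemma pr_surj (u : X) : exists x, u = pr x.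
Proof. by exists (repr u); rewrite /modular_proj reprK. Qed.

(** The automorphism of X(p) induced by [g]; its effect on classes is [hX_pr]. *)
Definition hX g (u : X) : X := pr (act g (repr u)).

Lemma hX_pr g x : hX g (pr x) = pr (act g x).
Proof. by apply: pr_act; rewrite /modular_proj reprK. Qed.

Lemma hX_comp g h u : hX g (hX h u) = hX (smul g h) u.
Proof. by have [x ->] := pr_surj u; rewrite !hX_pr moebius_actM. Qed.

Lemma hXK g u : hX (sinv g) (hX g u) = u.
Proof. by have [x ->] := pr_surj u; rewrite !hX_pr moebius_actK. Qed.

Lemma hXVK g u : hX g (hX (sinv g) u) = u.
Proof. by have [x ->] := pr_surj u; rewrite !hX_pr moebius_actVK. Qed.

Lemma pr_continuous : continuous pr.
Proof. exact: pi_continuous. Qed.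

Lemma open_act g (U : set (hstar R)) : open U -> open (act g @^-1` U).
Proof.
move=> [U1 U2]; split=> [x z Ux xz z0|h].
  have xE := upE xz z0; move: Ux; rewrite /= xE act_up // => Ux.
  have n1 := U1 _ (mob g z) Ux (hpt_up (imag_mob_gt0 g z0)) (imag_mob_gt0 g z0).
  have cm : {for z, continuous (mob g)} := is_derive_continuous (is_derive_mob g z0).
  have n2 : \forall w \near z, forall y, hpt y = Some (mob g w) -> U y by exact: cm _ n1.
  apply: filterS2 n2 (near_imag z0) => w Uw w0 y yw.
  rewrite /= (upE yw w0) act_up //; apply: Uw.
  by rewrite hpt_up // imag_mob_gt0.
rewrite /= -moebius_actM => /U2[M MU]; exists M => y w yw Mw.
by have := MU y w yw Mw; rewrite /= moebius_actM.
Qed.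

(** The saturation of an open set is a union of translates. *)
Lemma open_pr (U : set (hstar R)) : open U -> open (pr @` U).
Proof.
move=> oU.
suff E : pr @^-1` (pr @` U) = \bigcup_(h in in_Gamma p) (act h @^-1` U).
  by have : open (pr @^-1` (pr @` U)) by rewrite E; apply: bigcup_open => h _; exact: open_act.
apply/seteqP; split=> [x [y Uy /esym/prP[h hG hx]]|x [h hG Uhx]].
  by exists h => //=; rewrite hx.
by exists (act h x) => //; rewrite pr_Gamma.
Qed.

Lemma continuous_hX g : continuous (hX g).
Proof.
apply/continuousP => U oU; have oU' : open (act g @^-1` (pr @^-1` U)) by exact: open_act.
have E : pr @^-1` (hX g @^-1` U) = act g @^-1` (pr @^-1` U).
  by apply/funext => x; rewrite /preimage /= hX_pr.
by have : open (pr @^-1` (hX g @^-1` U)) by rewrite E.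
Qed.

Lemma near_up z (U : set (hstar R)) : 0 < imag z -> nbhs (up z) U ->
  \forall w \near z, U (up w).
Proof.
move=> z0; rewrite nbhsE => -[V [[V1 _] Vz] VU].
have := V1 _ z Vz (hpt_up z0) z0.
by apply: filterS2 (near_imag z0) => w w0 Vw; apply/VU/Vw; exact: hpt_up.
Qed.

Lemma near_pr_up z (U : set X) : 0 < imag z -> nbhs (pr (up z)) U ->
  \forall w \near z, U (pr (up w)).
Proof. by move=> z0 /pr_continuous; exact: near_up. Qed.

Lemma open_up (A : set C) : open A -> open [set x : hstar R | exists2 z, A z /\ 0 < imag z & x = up z].
Proof.
move=> oA; split=> [x z [w [Aw w0 ->]]|g [w [_ w0]]].
  rewrite hpt_up // => -[<-] _.
  have nA : \forall v \near w, A v by exact: open_nbhs_nbhs.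
  apply: filterS2 nA (near_imag w0) => v Av v0 y yv.
  by exists v; rewrite ?(upE yv).
by move=> e; case: (up_not_cusp (g := g) w0).
Qed.

(** Gamma(p) acts freely and properly discontinuously on the half plane, which provides
    ordinary charts. If [g] moves a point [w] near [z] to a point [w'] near [z], then
    u = c w + d has modulus close to 1 and u + 1/u is close to the trace t of [g], so
    that the modulus of t is less than 3. As t = 2 modulo p and p > 4, t = 2. Then
    (u - 1)^2 = u c (w - w') is small, which forces c = 0; so [g] is a translation by
    a multiple of p of length less than 1. *)
Lemma Gamma_free z : 0 < imag z -> exists2 e : R, 0 < e & forall g w w',
  in_Gamma p g -> nm (w - z) < e -> nm (w' - z) < e -> mob g w = w' -> w = w'.
Proof.
move=> z0; set y := imag z.
pose e := Num.min (1 / 8) (Num.min (y / 16) (y ^+ 3 / 64)).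
have y3 : 0 < y ^+ 3 by rewrite exprn_gt0.
exists e; first by rewrite !lt_min !divr_gt0.
move=> g w w' /in_GammaP[pa pb pc pd]; rewrite !lt_min.
move=> /andP[w1 /andP[w2 w3]] /andP[w'1 /andP[w'2 w'3]] gw.
have im (v : C) : nm (v - z) < y / 16 -> y * (15 / 16) < imag v /\ imag v < y * (17 / 16).
  move=> /(le_lt_trans (nm_Im _)); rewrite raddfB /= -/(imag v) -/(imag z) -/y.
  by rewrite ltr_norml => /andP[h1 h2]; split; lra.
have [iw1 iw2] := im w w2; have [iw1' iw2'] := im w' w'2.
have iw0 : 0 < imag w by apply: lt_trans iw1; rewrite mulr_gt0 // divr_gt0.
have dw : nm (w - w') < Num.min (1 / 4) (Num.min (y / 8) (y ^+ 3 / 32)).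
  have tri : nm (w - w') <= nm (w - z) + nm (w' - z).
    by rewrite (nmB w' z) nmD3.
  by rewrite !lt_min; apply/and3P; split; lra.
move: dw; rewrite !lt_min => /and3P[dw1 dw2 dw3].
set u := den g w; have u0 : u != 0 := den_neq0 g iw0.
have nu2 : imag w' * nm u ^+ 2 = imag w.
  by rewrite -gw imag_mob // mulfVK // sqrf_eq0 nm_eq0.
have u2lo : 15 / 17 <= nm u ^+ 2.
  rewrite leNgt; apply/negP => h.
  have : imag w' * nm u ^+ 2 < (y * (17 / 16)) * (15 / 17).
    by apply: ltr_pM => //; [rewrite ltW // -gw imag_mob_gt0|rewrite sqr_ge0].
  by rewrite nu2; lra.
have u2hi : nm u ^+ 2 <= 17 / 15.
  rewrite leNgt; apply/negP => h.
  have : (y * (15 / 16)) * (17 / 15) < imag w' * nm u ^+ 2.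
    by apply: ltr_pM => //; try lra; apply: mulr_ge0; lra.
  by rewrite nu2; lra.
have n0 := nm_ge0 u.
have uhi : nm u <= 8 / 7 by rewrite -ler_sqr ?nnegrE //; lra.
have ulo : 7 / 8 <= nm u by rewrite -ler_sqr ?nnegrE //; lra.
(* the inverse of [u] is [a - c w'], whence the trace up to a small error *)
have tr : u + u^-1 = ent g 0 0 + ent g 1 1 + ent g 1 0 * (w - w').
  have inv : u^-1 = ent g 0 0 - ent g 1 0 * w'.
    apply: (mulIf u0); rewrite mulVf // -gw /mob -/u mulrBl -mulrA mulfVK //.
    by rewrite -{1}(ent_det R g) /u /den; ring.
  by rewrite inv /u /den; ring.
set c := `|(val g 1 0)%:~R : R|.
have cy : c * imag w <= nm u.
  by apply: le_trans (nm_Im _); rewrite Im_den normrM [`|imag w|]gtr0_norm.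
have nc : nm (ent g 1 0) = c by rewrite ent_real nm_real.
have cdw : nm (ent g 1 0 * (w - w')) < 1 / 5.
  rewrite nmM nc.
  have c0 : 0 <= c by rewrite normr_ge0.
  have : c * nm (w - w') <= c * (y / 8) by rewrite ler_wpM2l // ltW.
  have : c * (y * (15 / 16)) <= c * imag w by rewrite ler_wpM2l // ltW.
  by lra.
have trn : nm (ent g 0 0 + ent g 1 1) < 3.
  have -> : ent g 0 0 + ent g 1 1 = u + u^-1 - ent g 1 0 * (w - w') by rewrite tr; ring.
  have := nmD (u + u^-1) (- (ent g 1 0 * (w - w'))); rewrite nmN.
  have := nmD u u^-1; rewrite nmV.
  have : (nm u)^-1 <= 8 / 7.
    have nu0 : 0 < nm u by exact: lt_le_trans ulo.
    by rewrite -div1r ler_pdivrMr //; lra.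
  by lra.
have tr2 : val g 0 0 + val g 1 1 = 2.
  set t := val g 0 0 + val g 1 1.
  have tn : `|t| < 3.
    move: trn; rewrite /ent -rmorphD /= -/t nm_int.
    by rewrite -intr_norm -[3]/(3%:~R) ltr_int.
  have pt : (p%:Z %| (t - 2)%R)%Z.
    have -> : t - 2 = (val g 0 0 - 1) + (val g 1 1 - 1) by rewrite /t; ring.
    exact: rpredD.
  have : (`|t - 2| < 5)%N by move: tn; clear; lia.
  move: pt; rewrite dvdzE /= => /dvdnP[k kE]; rewrite kE => kp.
  have : k = 0%N by move: p4 kp; clear; case: k => // k; lia.
  by move=> k0; rewrite k0 mul0n in kE; move: kE; clear; lia.
(* as the trace is 2, [u + u^-1 - 2] is a multiple of [w - w'] *)
have u1 : nm (u - 1) ^+ 2 < (imag w) ^+ 2.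
  have e1 : (u - 1) ^+ 2 = u * (ent g 1 0 * (w - w')).
    have -> : ent g 1 0 * (w - w') = u + u^-1 - 2.
      have -> : (2 : C) = ent g 0 0 + ent g 1 1 by rewrite /ent -rmorphD /= tr2.
      by rewrite tr; ring.
    by field.
  rewrite -nmX e1 !nmM nc.
  have c0 : 0 <= c by rewrite normr_ge0.
  have h1 : c * nm (w - w') <= c * (y ^+ 3 / 32) by rewrite ler_wpM2l // ltW.
  have h2 : c * (y * (15 / 16)) <= nm u by apply: le_trans cy; rewrite ler_wpM2l // ltW.
  have y2 : 0 < y ^+ 2 by rewrite exprn_gt0.
  have h3 : c * (y ^+ 3 / 32) <= y ^+ 2 / 16.
    have -> : c * (y ^+ 3 / 32) = (c * (y * (15 / 16))) * (y ^+ 2 / 30) by field.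
    apply: (@le_trans _ _ (8 / 7 * (y ^+ 2 / 30))); last lra.
    by apply: ler_wpM2r (le_trans h2 uhi); rewrite divr_ge0 // ltW.
  have h4 : nm u * (c * nm (w - w')) <= 8 / 7 * (y ^+ 2 / 16).
    by apply: ler_pM => //; [rewrite mulr_ge0 ?nm_ge0|exact: le_trans h3].
  have : (y * (15 / 16)) ^+ 2 < imag w ^+ 2.
    by rewrite ltr_pXn2r ?nnegrE ?ltW // mulr_gt0 //; lra.
  by rewrite exprMn; lra.
have c0 : val g 1 0 = 0.
  apply/eqP/negPn/negP => cn0.
  have c1 : 1 <= c.
    by rewrite /c -intr_norm -[1]/(1%:~R) ler_int -gtz0_ge1 normr_gt0.
  have : imag w <= nm (u - 1).
    apply: le_trans (nm_Im _); rewrite raddfB /= subr0 Im_den normrM [`|imag w|]gtr0_norm //.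
    by rewrite ler_peMl // ltW.
  by rewrite leNgt -ltr_sqr ?nnegrE ?nm_ge0 ?u1 // ltW.
have [k [kE kb]] := mob_translation R c0.
have kw : w' = w + k%:~R by rewrite -gw kE.
have pk : (p%:Z %| k)%Z by case: kb => kb; move: pb; rewrite kb ?rpredN.
have : (`|k| < 1)%N.
  have : nm (k%:~R : C) < 1.
    have -> : k%:~R = w' - w by rewrite kw addrAC subrr add0r.
    by rewrite nmB; lra.
  rewrite nm_int -intr_norm -[1]/(1%:~R) ltr_int.
  by clear; lia.
by rewrite ltnS leqn0 absz_eq0 => /eqP k0; rewrite kw k0 addr0.
Qed.

End Congruence.

(** * The coordinate q at a cusp *)

Section QCoordinate.
Variable R : realType.
Local Notation C := (Cx R).
Variable p : nat.
Hypothesis p4 : (4 < p)%N.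
Implicit Types (g h : SL2Z) (z w : C) (x y : hstar R).
Local Notation X := (modular_space R p).
Local Notation pr := (@modular_proj R p).
Local Notation act := moebius_act.
Local Notation infty := (cusp_infty R).

Let p0 : (0 : R) < p%:R. Proof. by rewrite ltr0n; exact: leq_trans p4. Qed.

Definition kap : C := (2 * pi / p%:R : R)%:C * 'i%C.
Definition qc z : C := cexp (kap * z).

Lemma twopi_p : 0 < 2 * pi / p%:R :> R.
Proof. by rewrite divr_gt0 // mulr_gt0 // pi_gt0. Qed.

Lemma kap_neq0 : kap != 0.
Proof. by rewrite -nm_gt0 nmM nm_i nm_real mulr1 normr_gt0 gt_eqF // twopi_p. Qed.

Lemma qcoord_up z : 0 < imag z -> qcoord p (up z) = qc z.
Proof. by move=> z0; rewrite /qcoord hpt_up. Qed.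

Lemma qcoord_infty : qcoord p infty = 0. Proof. by []. Qed.

Lemma qc_neq0 z : qc z != 0. Proof. exact: cexp_neq0. Qed.

Lemma nm_qc z : nm (qc z) = expR (- (2 * pi / p%:R * imag z)).
Proof.
rewrite nm_cexp; congr expR; rewrite /kap; case: z => a b; rewrite /imag /=.
by ring.
Qed.

(** The radius of the disc that [horoball M] covers in the coordinate q. *)
Definition qrad (M : R) : R := expR (- (2 * pi / p%:R * M)).

Lemma qrad_gt0 M : 0 < qrad M. Proof. exact: expR_gt0. Qed.

Lemma qrad0 : qrad 0 = 1. Proof. by rewrite /qrad mulr0 oppr0 expR0. Qed.

Lemma le_qrad M N : M <= N -> qrad N <= qrad M.
Proof. by move=> MN; rewrite /qrad ler_expR lerN2 ler_pM2l // twopi_p. Qed.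

Lemma qc_qrad M z : (M < imag z) = (nm (qc z) < qrad M).
Proof. by rewrite nm_qc /qrad ltr_expR ltrN2 ltr_pM2l // twopi_p. Qed.

Lemma qc_imag_gt0 z : nm (qc z) < 1 -> 0 < imag z.
Proof. by rewrite qc_qrad qrad0. Qed.

Lemma qcD z w : qc (z + w) = qc z * qc w.
Proof. by rewrite /qc mulrDr cexpD. Qed.

Lemma qc_eq z w : qc z = qc w -> exists k : int, z = w + (k * p%:Z)%:~R.
Proof.
move=> e; have : cexp (kap * (z - w)) = 1.
  by rewrite mulrBr cexpB -/(qc z) -/(qc w) e mulfV // qc_neq0.
move=> /cexp_eq1[k kE]; exists k.
apply/eqP; rewrite addrC -subr_eq; apply/eqP/(mulfI kap_neq0); rewrite kE.
rewrite /kap -(rmorph_int (real_complex R)); apply/eqP; rewrite eq_complex /=.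
apply/andP; split; apply/eqP; first by ring.
rewrite intrM -pmulrn mulr2n.
by field; rewrite gt_eqF.
Qed.

Lemma qc_period z (k : int) : (p%:Z %| k)%Z -> qc (z + k%:~R) = qc z.
Proof.
move=> /dvdzP[m ->]; rewrite qcD -[RHS]mulr1; congr (_ * _).
have c0 (n : nat) : qc (n%:R * p%:R) = 1.
  elim: n => [|n IH]; first by rewrite mul0r /qc mulr0 cexp0.
  rewrite -addn1 natrD mulrDl qcD IH mul1r mul1r /qc /kap.
  have -> : (2 * pi / p%:R : R)%:C * 'i%C * p%:R = pi *i + pi *i :> C.
    rewrite -(rmorph_nat (real_complex R)); apply/eqP; rewrite eq_complex /=.
    by apply/andP; split; apply/eqP; field; rewrite gt_eqF.
  by rewrite cexpD cexp_pi mulrNN mulr1.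
case: m => m.
  by rewrite intrM -!pmulrn c0.
have := qcD ((Negz m)%:~R * p%:R) (m.+1%:R * p%:R).
rewrite c0 mulr1 intrM -[(p%:Z)%:~R]pmulrn => <-.
by rewrite -mulrDl NegzE rmorphN /= -pmulrn addNr mul0r /qc mulr0 cexp0.
Qed.

Lemma is_derive_qc z : is_derive z 1 qc (kap * qc z).
Proof.
have h : is_derive z 1 (fun w : C => kap * w) kap.
  have := is_derive_mulC (is_derive_cst kap z 1) (is_derive_id z 1).
  by rewrite mul0r add0r /cst mulr1.
by have := is_derive_compC h (is_derive_cexp (kap * z)); rewrite mulrC.
Qed.

(** The local inverse of [qc] with value [z0] at [qc z0]. *)
Definition qlog z0 w : C := z0 + clog (w / qc z0) / kap.

Lemma qlogE z0 : qlog z0 (qc z0) = z0.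
Proof. by rewrite /qlog mulfV ?qc_neq0 // clog1 mul0r addr0. Qed.

Lemma is_derive_qlog z0 : is_derive (qc z0) 1 (qlog z0) ((kap * qc z0)^-1).
Proof.
have h1 : is_derive (qc z0) 1 (fun w : C => w / qc z0) (qc z0)^-1.
  have := is_derive_mulC (is_derive_id (qc z0) 1) (is_derive_cst (qc z0)^-1 (qc z0) 1).
  by rewrite mul1r mulr0 addr0.
have e1 : qc z0 / qc z0 = 1 by rewrite mulfV // qc_neq0.
have h2 : is_derive (qc z0 / qc z0) 1 (@clog R) 1.
  by rewrite e1; have := @is_derive_clog R 1; rewrite invr1; apply; rewrite /= ltr01.
have h3 := is_derive_compC h1 h2.
have h4 := is_derive_mulC h3 (is_derive_cst kap^-1 (qc z0) 1).
have h5 := is_deriveD (is_derive_cst z0 (qc z0) 1) h4.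
apply: is_derive_eq h5 _.
by rewrite /cst mulr0 addr0 add0r mul1r [(kap * qc z0)^-1]invfM mulrC.
Qed.

Lemma near_qlog z0 : \forall w \near qc z0, qc (qlog z0 w) = w.
Proof.
have c1 : {for qc z0, continuous (fun w : C => w / qc z0)}.
  have h1 := is_derive_mulC (is_derive_id (qc z0) 1) (is_derive_cst (qc z0)^-1 (qc z0) 1).
  exact: is_derive_continuous h1.
have n1 : \forall v \near (qc z0 / qc z0), 0 < complex.Re v.
  by apply: near_Re_gt0; rewrite mulfV ?qc_neq0 //= ltr01.
have n2 : \forall w \near qc z0, 0 < complex.Re (w / qc z0) by exact: c1 _ n1.
apply: filterS n2 => w w0.
rewrite /qlog qcD {2}/qc mulrC [kap * _]mulrC mulfVK ?kap_neq0 // clogK //.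
by rewrite mulfVK // qc_neq0.
Qed.

Lemma qc_surj w : w != 0 -> exists z, qc z = w.
Proof.
move=> /cexp_surj[v <-]; exists (v / kap).
by rewrite /qc mulrC mulfVK // kap_neq0.
Qed.

(** A set-theoretic section of [qcoord] over the unit disc. *)
Definition xq w : hstar R := if w == 0 then infty else up (xget 0 [set z | qc z = w]).

Lemma xq0 : xq 0 = infty. Proof. by rewrite /xq eqxx. Qed.

Lemma xqE w : w != 0 -> nm w < 1 -> exists z, [/\ 0 < imag z, qc z = w & xq w = up z].
Proof.
move=> w0 w1; rewrite /xq (negPf w0).
have [z zw] := qc_surj w0.
have := @xgetI _ 0 [set z | qc z = w] z zw; set v := xget _ _ => vw.
by exists v; split=> //; apply: qc_imag_gt0; rewrite vw.
Qed.

Lemma qcoord_xq w : nm w < 1 -> qcoord p (xq w) = w.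
Proof.
move=> w1; have [->|w0] := eqVneq w 0; first by rewrite xq0.
by have [z [z0 zw ->]] := xqE w0 w1; rewrite qcoord_up.
Qed.

Lemma horoballP (M : R) x : 0 <= M -> horoball M x ->
  x = infty \/ exists z, [/\ M < imag z, 0 < imag z & x = up z].
Proof.
move=> M0; rewrite /horoball /=; case e : (hpt x) => [z|] => [Mz|_].
  have z0 : 0 < imag z by exact: le_lt_trans Mz.
  by right; exists z; split=> //; exact: upE.
by left; apply: val_inj; rewrite /= e.
Qed.

Lemma horoball_infty (M : R) : horoball M infty. Proof. by []. Qed.

Lemma horoball_up (M : R) z : 0 < imag z -> M < imag z -> horoball M (up z).
Proof. by move=> z0 Mz; rewrite /horoball /= hpt_up. Qed.

Lemma horoball_xq (M : R) w : 0 <= M -> nm w < qrad M -> horoball M (xq w).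
Proof.
move=> M0 wM; have [->|w0] := eqVneq w 0; first by rewrite xq0.
have w1 : nm w < 1 by apply: lt_le_trans wM _; rewrite -qrad0 le_qrad.
have [z [z0 zw ->]] := xqE w0 w1; apply: horoball_up => //.
by rewrite qc_qrad zw.
Qed.

Lemma horoball_q (M : R) x : 0 <= M -> horoball M x -> nm (qcoord p x) < qrad M.
Proof.
move=> M0 /(horoballP M0)[->|[z [Mz z0 ->]]]; first by rewrite nm0 qrad_gt0.
by rewrite qcoord_up // -qc_qrad.
Qed.

Lemma translation_ex (k : int) :
  exists2 g, ((p%:Z %| k)%Z -> in_Gamma p g) & forall z, mob g z = z + k%:~R.
Proof.
pose M : 'M[int]_2 := \matrix_(i, j) if i == 0 then (if j == 0 then 1 else k)
   else (if j == 0 then 0 else 1).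
have dM : \det M = 1 by rewrite det2E !mxE /= mulr1 mulr0 subr0.
exists (toSL2Z dM); last first.
  by move=> z; rewrite /mob /den /ent /= !mxE /= mul1r mul0r add0r divr1.
move=> pk; apply/eqP/matrixP => i j; rewrite !mxE.
have k0 : (k%:~R : 'Z_p) = 0 by apply/eqP; rewrite (Zp_int0 p4).
case: i => [[|[|i]] //= hi]; case: j => [[|[|j]] //= hj]; exact: k0.
Qed.

(** Two points of the half plane with the same q differ by a multiple of p. *)
Lemma cusp_inj g x y : horoball 0 x -> horoball 0 y -> qcoord p x = qcoord p y ->
  pr (act g x) = pr (act g y).
Proof.
move=> /(horoballP (lexx _))[->|[z [_ z0 ->]]] /(horoballP (lexx _))[->|[w [_ w0 ->]]] //.
- by rewrite qcoord_infty qcoord_up // => /esym/eqP; rewrite (negPf (qc_neq0 w)).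
- by rewrite qcoord_infty qcoord_up // => /eqP; rewrite (negPf (qc_neq0 z)).
rewrite !qcoord_up // => /qc_eq[k ->]; apply: pr_act => //.
have [h /(_ (dvdz_mull _ (dvdzz _))) hG hE] := translation_ex (k * p%:Z).
by rewrite -hE -act_up // pr_Gamma.
Qed.

(** Above height 1 the points are equivalent only under translations, and those of
    Gamma(p) are by multiples of p. *)
Lemma cusp_wd g x y : horoball 1 x -> horoball 1 y -> pr (act g x) = pr (act g y) ->
  qcoord p x = qcoord p y.
Proof.
move=> hx hy /(pr_act (sinv g)); rewrite !moebius_actK => /prP[h hG].
have [->|[z [z1 z0 ->]]] := horoballP ler01 hx; have [->|[w [w1 w0 ->]]] := horoballP ler01 hy => //.
- by move=> /esym e; case: (up_not_cusp w0 e).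
- move=> e; have : up z = act (sinv h) infty by rewrite -e moebius_actK.
  by move=> /(up_not_cusp z0).
rewrite act_up // => /(up_inj (imag_mob_gt0 h z0) w0) hz.
have h1 : 1 < imag (mob h z) by rewrite hz.
have [k [kE kb]] := mob_translation R (high_translation z1 h1).
have [_ pb _ _] := in_GammaP p4 hG.
have pk : (p%:Z %| k)%Z by case: kb => kb; move: pb; rewrite kb ?rpredN.
by rewrite !qcoord_up // -hz kE qc_period.
Qed.

Lemma continuous_pr_act_up g z : 0 < imag z -> {for z, continuous (fun w => pr (act g (up w)))}.
Proof.
move=> z0 U; rewrite /= => nU.
have nU' : nbhs (up z) [set x | U (pr (act g x))].
  have := pr_continuous nU.
  rewrite !nbhsE => -[V [oV Vx] VU]; exists (act g @^-1` V).
    by split=> //; exact: open_act.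
  by move=> x /VU.
exact: near_up z0 nU'.
Qed.

Lemma near_xq g z : 0 < imag z ->
  \forall v \near qc z, pr (act g (xq v)) = pr (act g (up (qlog z v))).
Proof.
move=> z0; have n2 : \forall v \near qc z, nm v < 1.
  apply/nearCP; exists (1 - nm (qc z)); first by rewrite subr_gt0 -qrad0 -qc_qrad.
  by move=> v h; have := nmD (v - qc z) (qc z); rewrite subrK; lra.
apply: filterS2 n2 (near_qlog z) => v v1 qv.
have v0 : 0 < imag (qlog z v) by apply: qc_imag_gt0; rewrite qv.
apply: cusp_inj; first by apply: horoball_xq; rewrite ?qrad0.
  exact: horoball_up.
by rewrite qcoord_xq // qcoord_up.
Qed.

(** At 0 this is the description of the neighbourhoods of a cusp by horoballs; elsewhere
    [xq] agrees with a branch of the logarithm up to Gamma(p). *)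
Lemma continuous_cusp g w : nm w < 1 -> {for w, continuous (fun w => pr (act g (xq w)))}.
Proof.
move=> w1; have [->|w0] := eqVneq w 0.
  move=> U /=; rewrite xq0 => nU.
  have := pr_continuous nU; rewrite nbhsE => -[V [oV Vx] VU].
  have [_ V2] := open_act g oV.
  pose one : SL2Z := toSL2Z (det1 _ _).
  have one1 x : act one x = x by apply: val_inj; rewrite /= moebius1.
  have [|M MV] := V2 one; first by rewrite one1.
  apply/nbhsCP; exists (Num.min 1 (qrad M)); first by rewrite lt_min ltr01 qrad_gt0.
  move=> v; rewrite subr0 lt_min => /andP[v1 vM].
  have [->|v0] := eqVneq v 0; first by rewrite /= xq0; exact: VU _ Vx.
  have [z [z0 zv xz]] := xqE v0 v1.
  suff h : V (act g (xq v)) by exact: VU _ h.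
  rewrite xz; by have := MV (up z) z (hpt_up z0); rewrite one1; apply; rewrite qc_qrad zv.
have [z [z0 zw xz]] := xqE w0 w1.
have cq : {for qc z, continuous (qlog z)} := is_derive_continuous (is_derive_qlog z).
have c2 : {for qc z, continuous (fun v => pr (act g (up (qlog z v))))}.
  apply: (@continuous_comp _ _ _ (qlog z) (fun v => pr (act g (up v)))) => //.
  by rewrite qlogE; exact: continuous_pr_act_up.
rewrite -zw => U /= nU.
have e : pr (act g (xq (qc z))) = pr (act g (up (qlog z (qc z)))).
  by rewrite zw xz -zw qlogE.
rewrite e in nU.
have n1 : \forall v \near qc z, U (pr (act g (up (qlog z v)))) by exact: c2 _ nU.
by apply: filterS2 n1 (near_xq g z0) => v Uv ev; rewrite /preimage /= ev.
Qed.

End QCoordinate.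

(** * The atlas of X(p) *)

Section Charts.
Variable R : realType.
Local Notation C := (Cx R).
Variable p : nat.
Hypothesis p4 : (4 < p)%N.
Implicit Types (g h : SL2Z) (z w : C) (x y : hstar R).
Local Notation X := (modular_space R p).
Local Notation S := (modular_curve R p).
Local Notation pr := (@modular_proj R p).
Local Notation act := moebius_act.
Local Notation infty := (cusp_infty R).
Local Notation xq := (xq p).
Local Notation qrad := (@qrad R p).
Local Notation qc := (@qc R p).
Implicit Types (c d : chart R S) (u : S).

Lemma chart_inv_inj c u0 u : {in chart_dom c &, injective (chart_coord c)} ->
  chart_dom c u -> chart_inv c u0 (chart_coord c u) = u.
Proof.
move=> inj cu; have := @pinvKV _ _ (fun=> u0) (chart_dom c) _ inj u.
by apply; rewrite inE.
Qed.

(** The content of [ordinary_chart], with the open set as a parameter. *)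
Definition ord_on c (V : set (hstar R)) :=
  [/\ open V, {in V &, injective pr}, chart_dom c = pr @` V &
      forall x, V x -> exists z : C,
        [/\ hpt x = Some z, 0 < imag z & chart_coord c (pr x) = z]].

Lemma ordE c V z : ord_on c V -> 0 < imag z -> V (up z) ->
  chart_coord c (pr (up z)) = z /\ chart_dom c (pr (up z)).
Proof.
move=> [_ _ -> cV] z0 Vz; split; last by exists (up z).
by have [w []] := cV _ Vz; rewrite hpt_up // => -[->].
Qed.

Lemma ord_pts c V u : ord_on c V -> chart_dom c u ->
  exists z, [/\ 0 < imag z, V (up z) & u = pr (up z)].
Proof.
move=> [_ _ -> cV] [x Vx <-]; have [z [xz z0 _]] := cV x Vx.
by exists z; rewrite -(upE xz z0).
Qed.

Lemma ord_coord_inj c V : ord_on c V -> {in chart_dom c &, injective (chart_coord c)}.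
Proof.
move=> oc u v; rewrite !inE => /(ord_pts oc)[z [z0 Vz ->]] /(ord_pts oc)[w [w0 Vw ->]].
by rewrite (ordE oc z0 Vz).1 (ordE oc w0 Vw).1 => ->.
Qed.

Lemma ord_inv c V z u0 : ord_on c V -> 0 < imag z -> V (up z) ->
  chart_inv c u0 z = pr (up z).
Proof.
move=> oc z0 Vz; have [e dz] := ordE oc z0 Vz.
by rewrite -{1}e chart_inv_inj //; exact: ord_coord_inj oc.
Qed.

Lemma near_ord c V z : ord_on c V -> 0 < imag z -> V (up z) ->
  \forall w \near z, 0 < imag w /\ V (up w).
Proof.
move=> [oV _ _ _] z0 Vz; apply: filterI; first exact: near_imag.
by apply: near_up => //; apply: open_nbhs_nbhs.
Qed.

Lemma ord_regular c V : ord_on c V -> regular_chart c.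
Proof.
move=> oc u cu; have [z [z0 Vz uE]] := ord_pts oc cu.
have [cz dz] := ordE oc z0 Vz.
have e : chart_coord c u = z by rewrite uE.
have nV := near_ord oc z0 Vz.
split.
- by have [oV _ -> _] := oc; exact: open_pr.
- by move=> v u0; apply: chart_inv_inj; exact: ord_coord_inj oc.
- rewrite e; apply: filterS nV => w [w0 Vw]; rewrite (ord_inv u oc w0 Vw).
  by have [e1 e2] := ordE oc w0 Vw; split.
- rewrite e; apply: (continuous_near (f := fun w => pr (up w))).
    by apply: filterS nV => w [w0 Vw]; rewrite (ord_inv u oc w0 Vw).
  by move=> U; exact: near_pr_up.
Qed.

(** By [Gamma_free] the quotient map is injective on a small disc around [z]. *)
Lemma ord_ex z : 0 < imag z -> exists c V, ord_on c V /\ V (up z).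
Proof.
move=> z0; have [e e0 free] := Gamma_free p4 z0.
pose V := [set x : hstar R | exists2 w, nm (w - z) < e /\ 0 < imag w & x = up w].
pose coord u : C := xget 0 [set w | [/\ nm (w - z) < e, 0 < imag w & pr (up w) = u]].
have inj w w' : nm (w - z) < e -> 0 < imag w -> nm (w' - z) < e -> 0 < imag w' ->
    pr (up w) = pr (up w') -> w = w'.
  move=> we w0 w'e w'0 /prP[h hG]; rewrite act_up // => /(up_inj (imag_mob_gt0 h w0) w'0).
  exact: free hG we w'e.
exists (Chart (pr @` V) coord : chart R S), V; split; last first.
  by exists z => //; split=> //; rewrite subrr nm0.
split=> //.
- apply: (open_up (A := [set w | nm (w - z) < e])).
  rewrite openE => w we; apply/nbhsCP; exists (e - nm (w - z)); first by rewrite subr_gt0.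
  by move=> v vw; rewrite /=; have := nmD3 v z w; lra.
- move=> x y; rewrite !inE => -[w [we w0] ->] [w' [we' w0'] ->] h.
  by rewrite (inj w w').
- move=> _ [w [we w0] ->]; exists w; split=> //; first exact: hpt_up.
  rewrite /= /coord; case: xgetP => [v _ [ve v0 vw]|/(_ w)]; first exact: inj vw.
  by case; split.
Qed.

(** The content of [cusp_chart], with the frame and the height as parameters. *)
Definition cusp_on c g (M : R) :=
  [/\ 1 <= M, chart_dom c = (pr \o act g) @` horoball M &
      forall x, horoball M x -> chart_coord c (pr (act g x)) = qcoord p x].

Lemma cuspE c g M w : cusp_on c g M -> nm w < qrad M ->
  chart_dom c (pr (act g (xq w))) /\ chart_coord c (pr (act g (xq w))) = w.
Proof.
move=> [M1 cd cc] wM; have M0 : 0 <= M by exact: le_trans M1.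
have hw := horoball_xq p4 M0 wM.
rewrite cd cc //; split; first by exists (xq w).
rewrite (qcoord_xq p4) //; apply: lt_le_trans wM _.
by rewrite -(qrad0 R p) (le_qrad p4).
Qed.

Lemma cusp_pts c g M u : cusp_on c g M -> chart_dom c u ->
  exists2 w, nm w < qrad M & u = pr (act g (xq w)).
Proof.
move=> [M1 -> cc] [x hx <-]; have M0 : 0 <= M by exact: le_trans M1.
have qM := horoball_q p4 M0 hx.
have q1 : nm (qcoord p x) < 1.
  by apply: lt_le_trans qM _; rewrite -(qrad0 R p) (le_qrad p4).
exists (qcoord p x) => //=; apply: (cusp_inj p4).
- by have [->|[z [_ z0 ->]]] := horoballP M0 hx; [exact: horoball_infty|exact: horoball_up].
- by apply: (horoball_xq p4); rewrite ?qrad0.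
- by rewrite (qcoord_xq p4).
Qed.

Lemma cusp_coord_inj c g M : cusp_on c g M -> {in chart_dom c &, injective (chart_coord c)}.
Proof.
move=> cc u v; rewrite !inE => /(cusp_pts cc)[z zM ->] /(cusp_pts cc)[w wM ->].
by rewrite (cuspE cc zM).2 (cuspE cc wM).2 => ->.
Qed.

Lemma cusp_inv c g M w u0 : cusp_on c g M -> nm w < qrad M ->
  chart_inv c u0 w = pr (act g (xq w)).
Proof.
move=> cc wM; have [dw e] := cuspE cc wM.
by rewrite -{1}e chart_inv_inj //; exact: cusp_coord_inj cc.
Qed.

Lemma near_nm (r : R) w : nm w < r -> \forall v \near w, nm v < r.
Proof.
move=> wr; apply/nearCP; exists (r - nm w); first by rewrite subr_gt0.
by move=> v h; have := nmD (v - w) w; rewrite subrK; lra.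
Qed.

Lemma qrad_le1 (M : R) : 1 <= M -> qrad M <= 1.
Proof. by move=> M1; rewrite -(qrad0 R p) (le_qrad p4) // (le_trans ler01). Qed.

Lemma cusp_regular c g M : cusp_on c g M -> regular_chart c.
Proof.
move=> cc u cu; have [w wM uE] := cusp_pts cc cu.
have [dw cw] := cuspE cc wM.
have e : chart_coord c u = w by rewrite uE.
have nM := near_nm wM.
have M1 : 1 <= M by case: cc.
split.
- have [_ -> _] := cc.
  have -> : (pr \o act g) @` horoball M = pr @` (act (sinv g) @^-1` horoball M).
    apply/seteqP; split=> [_ [x hx <-]|_ [x hx <-]].
      by exists (act g x) => //; rewrite /preimage /= moebius_actK.
    by exists (act (sinv g) x) => //=; rewrite moebius_actVK.
  apply: open_pr; apply: open_act; split=> [x z hx xz z0|h].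
    move: hx; rewrite /horoball /= xz => /near_imag; apply: filterS => v Mv y yv.
    by rewrite /horoball /= yv.
  rewrite /horoball /mkset; case e1 : (hpt (act h infty)) => [v|] => hh.
    by move: hh; rewrite (hpt_cusp_imag e1) => Mneg; lra.
  have /fix_infty c0 : act h infty = infty by apply: val_inj; exact: e1.
  have [k [kE _]] := mob_translation R c0.
  exists M => y v yv Mv.
  have v0 : 0 < imag v by lra.
  rewrite (upE yv v0) act_up //= hpt_up ?imag_mob_gt0 // kE.
  by rewrite imag_addz.
- by move=> v u0; apply: chart_inv_inj; exact: cusp_coord_inj cc.
- rewrite e; apply: filterS nM => v vM; rewrite (cusp_inv u cc vM).
  by have [? ->] := cuspE cc vM.
- rewrite e; apply: (continuous_near (f := fun w => pr (act g (xq w)))).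
    by apply: filterS nM => v vM; rewrite (cusp_inv u cc vM).
  by apply: (continuous_cusp p4); apply: lt_le_trans wM _; exact: qrad_le1.
Qed.

Lemma cusp_ex g : exists c, cusp_on c g 1.
Proof.
pose coord u : C := qcoord p (xget infty [set x | horoball 1 x /\ pr (act g x) = u]).
exists (Chart ((pr \o act g) @` horoball 1) coord : chart R S); split=> // x hx.
rewrite /= /coord; case: xgetP => [y _ [hy e]|/(_ x)]; first exact: cusp_wd e.
by case.
Qed.

Lemma atlasP c : atlas c -> (exists V, ord_on c V) \/ (exists g M, cusp_on c g M).
Proof. by []. Qed.

Lemma ord_atlas c V : ord_on c V -> @atlas R S c.
Proof. by move=> oc; left; exists V. Qed.

Lemma cusp_atlas c g M : cusp_on c g M -> @atlas R S c.
Proof. by move=> cc; right; exists g, M. Qed.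

Lemma modular_regular c : atlas c -> regular_chart c.
Proof.
by move=> /atlasP[[V /ord_regular]|[g [M /cusp_regular]]].
Qed.

Lemma pr_cases u : (exists2 z, 0 < imag z & u = pr (up z)) \/
  (exists g, u = pr (act g infty)).
Proof.
have [x ->] := pr_surj u; have [[z z0 ->]|[g ->]] := hstarP x; first by left; exists z.
by right; exists g.
Qed.

Lemma modular_charts u : exists2 c, atlas c & chart_dom c u.
Proof.
have [[z z0 ->]|[g ->]] := pr_cases u.
  have [c [V [oc Vz]]] := ord_ex z0.
  by exists c; [exact: ord_atlas oc|have [] := ordE oc z0 Vz].
have [c cc] := cusp_ex g; exists c; first exact: cusp_atlas cc.
have r0 : nm (0 : C) < qrad 1 by rewrite nm0 qrad_gt0.
by have [] := cuspE cc r0; rewrite xq0.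
Qed.

Lemma pr_up_cusp z g : 0 < imag z -> pr (up z) <> pr (act g infty).
Proof.
move=> z0 /esym/prP[h _]; rewrite -moebius_actM => /esym.
exact: up_not_cusp.
Qed.

(** The inverse of an ordinary chart is the quotient map up to an element of Gamma(p);
    that of a cusp chart is the quotient map composed with a logarithm. *)
Lemma chart_inv_up c z : atlas c -> 0 < imag z -> chart_dom c (pr (up z)) ->
  exists l : C -> C, let w0 := chart_coord c (pr (up z)) in
    [/\ derivable l w0 1, l w0 = z &
        \forall w \near w0, chart_inv c (pr (up z)) w = pr (up (l w))].
Proof.
move=> /atlasP[[V oc]|[g [M cc]]] z0.
  move=> /(ord_pts oc)[v [v0 Vv e]].
  have /esym/prP[h hG] := e; rewrite act_up // => /(up_inj (imag_mob_gt0 h v0) z0) hv.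
  have cE : chart_coord c (pr (up z)) = v by rewrite e; have [] := ordE oc v0 Vv.
  exists (mob h); rewrite /= cE; split=> //; first exact: derivable_mob.
  apply: filterS (near_ord oc v0 Vv) => w [w0 Vw].
  by rewrite (ord_inv _ oc w0 Vw) -act_up // pr_Gamma.
move=> /(cusp_pts cc)[w wM e].
have M1 : 1 <= M by case: cc.
have w1 : nm w < 1 by apply: lt_le_trans wM _; exact: qrad_le1.
have w0 : w != 0.
  by apply/eqP => w0; move: e; rewrite w0 xq0; exact: pr_up_cusp.
have [v [v0 vw xv]] := xqE p4 w0 w1.
have cE : chart_coord c (pr (up z)) = w by rewrite e; have [] := cuspE cc wM.
have gv0 := imag_mob_gt0 g v0.
have /esym/prP[h hG] := e; rewrite xv act_up // act_up //.
move=> /(up_inj (imag_mob_gt0 h gv0) z0) hv.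
exists (mob h \o (mob g \o qlog p v)); rewrite /= cE -vw; split.
- have [dq _] := is_derive_qlog p v.
  have lv := qlogE p v.
  have dg : derivable (mob g) (qlog p v (qc v)) 1 by rewrite lv; exact: derivable_mob.
  have d1 := @derivable_compC R (qlog p v) (mob g) (qc v) dq dg.
  apply: (@derivable_compC R (mob g \o qlog p v) (mob h) (qc v) d1).
  by rewrite /= lv; exact: derivable_mob.
- by rewrite (qlogE p v).
- have n1 : \forall t \near qc v, nm t < qrad M by rewrite vw; exact: near_nm.
  have cq := is_derive_continuous (is_derive_qlog p v).
  have n2 : \forall t \near qc v, 0 < imag (qlog p v t).
    have := near_imag v0; rewrite -{1}(qlogE p v) => nn; exact: cq _ nn.
  apply: filterS3 n1 n2 (near_xq p4 g v0) => t tM t0 te.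
  rewrite (cusp_inv _ cc tM) te act_up // [LHS]/= -(pr_Gamma _ hG) act_up //.
  exact: imag_mob_gt0.
Qed.

(** The same comparison, with the exponential in place of the logarithm. *)
Lemma coord_up c z : atlas c -> 0 < imag z -> chart_dom c (pr (up z)) ->
  derivable (fun w => chart_coord c (pr (up w))) z 1.
Proof.
move=> /atlasP[[V oc]|[g [M cc]]] z0.
  move=> /(ord_pts oc)[v [v0 Vv e]].
  have /prP[h hG] := e; rewrite act_up // => /(up_inj (imag_mob_gt0 h z0) v0) hz.
  have n1 : \forall t \near v, V (up t) by apply: filterS (near_ord oc v0 Vv) => t [].
  have n2 : \forall t \near z, V (up (mob h t)).
    have ch := derivable_cont (@derivable_mob R h z z0).
    by move: n1; rewrite -hz => n1; exact: ch _ n1.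
  suff nE : \forall t \near z, mob h t = chart_coord c (pr (up t)).
    exact: (near_eq_derivable nE (@derivable_mob R h z z0)).
  apply: filterS2 n2 (near_imag z0) => t Vt t0.
  have [<- _] := ordE oc (imag_mob_gt0 h t0) Vt.
  by rewrite -act_up // pr_Gamma.
move=> /(cusp_pts cc)[w wM e].
have M1 : 1 <= M by case: cc.
have w1 : nm w < 1 by apply: lt_le_trans wM _; exact: qrad_le1.
have w0 : w != 0.
  by apply/eqP => w0; move: e; rewrite w0 xq0; exact: pr_up_cusp.
have [v [v0 vw xv]] := xqE p4 w0 w1.
have := pr_act (sinv g) e; rewrite moebius_actK xv act_up // => /prP[h hG].
have gz0 := imag_mob_gt0 (sinv g) z0.
rewrite act_up // => /(up_inj (imag_mob_gt0 h gz0) v0) hz.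
have dm : derivable (mob h \o mob (sinv g)) z 1.
  exact: (@derivable_compC R (mob (sinv g)) (mob h) z (@derivable_mob R (sinv g) z z0)
    (@derivable_mob R h _ gz0)).
have dq : derivable (qc \o (mob h \o mob (sinv g))) z 1.
  have [dqc _] := is_derive_qc p (mob h (mob (sinv g) z)).
  exact: (@derivable_compC R (mob h \o mob (sinv g)) qc z dm dqc).
have n2 : \forall t \near z, M < imag (mob h (mob (sinv g) t)).
  have Mv : M < imag v by rewrite (qc_qrad p4) vw.
  have n1 : \forall s \near mob h (mob (sinv g) z), M < imag s by rewrite hz; exact: near_imag.
  exact: derivable_cont dm _ n1.
suff nE : \forall t \near z, qc (mob h (mob (sinv g) t)) = chart_coord c (pr (up t)).
  exact: (near_eq_derivable nE dq).
apply: filterS2 n2 (near_imag z0) => t Mt t0.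
have gt0 := imag_mob_gt0 (sinv g) t0; have hgt0 := imag_mob_gt0 h gt0.
have -> : pr (up t) = pr (act g (up (mob h (mob (sinv g) t)))).
  rewrite -act_up // -[in LHS](moebius_actVK g (up t)) (act_up (sinv g) t0).
  by apply: pr_act; rewrite pr_Gamma.
have [_ _ ->] := cc; first by rewrite qcoord_up.
exact: horoball_up.
Qed.

(** A cusp lies in no ordinary chart, and only at the centre of a cusp chart. *)
Lemma chart_cusp c g0 : atlas c -> chart_dom c (pr (act g0 infty)) ->
  exists g M, [/\ cusp_on c g M, pr (act g0 infty) = pr (act g infty) &
    chart_coord c (pr (act g0 infty)) = 0].
Proof.
move=> /atlasP[[V oc]|[g [M cc]]].
  by move=> /(ord_pts oc)[v [v0 Vv e]]; have := pr_up_cusp v0 (esym e).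
move=> /(cusp_pts cc)[w wM e].
have M1 : 1 <= M by case: cc.
have w1 : nm w < 1 by apply: lt_le_trans wM _; exact: qrad_le1.
have w0 : w = 0.
  apply/eqP/negPn/negP => w0.
  have [v [v0 vw xv]] := xqE p4 w0 w1.
  by move: e; rewrite xv act_up // => /esym; exact: (pr_up_cusp (imag_mob_gt0 g v0)).
exists g, M; split=> //; first by rewrite e w0 xq0.
by rewrite e (cuspE cc wM).2.
Qed.

End Charts.

(** * The automorphisms of X(p) *)

Section Automorphisms.
Variable R : realType.
Local Notation C := (Cx R).
Variable p : nat.
Hypothesis p4 : (4 < p)%N.
Implicit Types (g h : SL2Z) (z w : C) (x y : hstar R).
Local Notation X := (modular_space R p).
Local Notation S := (modular_curve R p).
Local Notation pr := (@modular_proj R p).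
Local Notation act := moebius_act.
Local Notation infty := (cusp_infty R).
Local Notation xq := (xq p).
Local Notation qrad := (@qrad R p).
Local Notation qc := (@qc R p).
Implicit Types (c d : chart R S) (u : S).

(** The frame of the second cusp is transported by [g], so that the coordinate q is
    preserved. *)
Lemma hX_cusp_frame g g1 M1 M2 c d w u0 :
  cusp_on c g1 M1 -> cusp_on d (smul g g1) M2 ->
  nm w < qrad M1 -> nm w < qrad M2 ->
  chart_coord d (hX g (chart_inv c u0 w)) = w.
Proof.
move=> cc cd w1 w2; rewrite (cusp_inv p4 u0 cc w1) hX_pr -moebius_actM.
exact: (cuspE p4 cd w2).2.
Qed.

(** In arbitrary frames, what remains is a matrix fixing infinity; it acts as a
    translation, which multiplies q by a constant. *)
Lemma hX_cusp g g1 M1 g2 M2 c d : cusp_on c g1 M1 -> cusp_on d g2 M2 ->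
  pr (act g (act g1 infty)) = pr (act g2 infty) ->
  exists a : C, \forall w \near (0 : C), forall u0,
     chart_coord d (hX g (chart_inv c u0 w)) = a * w.
Proof.
move=> cc cd /prP[h hG he].
set D := smul (sinv g2) (smul h (smul g g1)).
have Dx x : pr (act g2 (act D x)) = pr (act g (act g1 x)).
  by rewrite /D !moebius_actM moebius_actVK pr_Gamma.
have /fix_infty c0 : act D infty = infty.
  by rewrite /D !moebius_actM he moebius_actK.
have [k [kE _]] := mob_translation R c0.
have M11 : 1 <= M1 by case: cc.
have [M21 _ cdE] := cd.
exists (qc k%:~R).
have n0 : nm (0 : C) = 0 by exact: nm0.
have r1 : nm (0 : C) < qrad M1 by rewrite n0; exact: qrad_gt0.
have r2 : nm (0 : C) < qrad M2 by rewrite n0; exact: qrad_gt0.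
apply: filterS2 (near_nm r1) (near_nm r2) => w w1 w2 u0.
rewrite (cusp_inv p4 u0 cc w1) hX_pr -Dx.
have M20 : 0 <= M2 by exact: le_trans M21.
have wl1 : nm w < 1 by apply: lt_le_trans w1 _; exact: qrad_le1.
have [w0|w0] := eqVneq w 0.
  rewrite w0 xq0 (_ : act D infty = infty); last by apply/fix_infty.
  by rewrite mulr0 cdE.
have [z [z0 zw ->]] := xqE p4 w0 wl1.
have zk := imag_addz z k.
have Mz : M2 < imag z by rewrite (qc_qrad p4) zw.
rewrite act_up // kE cdE; last by apply: horoball_up; rewrite zk.
by rewrite qcoord_up ?zk // qcD zw mulrC.
Qed.

Lemma hX_holomorphic g : holomorphic_map (hX g : S -> S).
Proof.
split; first exact: continuous_hX.
move=> c d ac ad u cu du.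
have [[z z0 uE]|[g0 uE]] := pr_cases u.
  move: cu du; rewrite uE hX_pr act_up // => cu du.
  have gz0 := imag_mob_gt0 g z0.
  have [l [dl lz lE]] := chart_inv_up p4 ac z0 cu.
  have dd := coord_up p4 ad gz0 du.
  have lc := derivable_cont dl.
  set w0 := chart_coord c (pr (up z)) in dl lz lE lc *.
  have n0 : \forall w \near w0, 0 < imag (l w).
    by have := near_imag z0; rewrite -lz => nn; exact: lc _ nn.
  have dg : derivable (mob g) (l w0) 1 by rewrite lz; exact: derivable_mob.
  have d1 := @derivable_compC R l (mob g) w0 dl dg.
  have [F FE] : exists F : C -> C, forall w, F w = chart_coord d (pr (up w)).
    by exists (fun w => chart_coord d (pr (up w))).
  have dF : derivable F (mob g (l w0)) 1.
    rewrite lz; suff nF : \forall w \near mob g z, chart_coord d (pr (up w)) = F w.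
      exact: (near_eq_derivable nF dd).
    by near=> w; rewrite FE.
  have d2 := @derivable_compC R (mob g \o l) F w0 d1 dF.
  suff nE : \forall w \near w0, F (mob g (l w)) =
      (chart_coord d \o hX g \o chart_inv c (pr (up z))) w.
    exact: (near_eq_derivable nE d2).
  by apply: filterS2 n0 lE => w w1 /= ->; rewrite hX_pr act_up // FE.
move: cu du; rewrite uE hX_pr -moebius_actM => cu du.
have [g1 [M1 [c1 e1 c0]]] := chart_cusp p4 ac cu.
have [g2 [M2 [c2 e2 _]]] := chart_cusp p4 ad du.
have e3 : pr (act g (act g1 infty)) = pr (act g2 infty).
  by rewrite -e2 moebius_actM; exact/esym/pr_act.
have [a aE] := hX_cusp c1 c2 e3.
rewrite c0.
have nE : \forall w \near (0 : C), a * w =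
    (chart_coord d \o hX g \o chart_inv c (pr (act g0 infty))) w.
  by apply: filterS aE => w aw; rewrite -(aw (pr (act g0 infty))).
apply: (near_eq_derivable nE).
by have [] := is_derive_mulC (is_derive_cst a (0 : C) 1) (is_derive_id (0 : C) 1).
Unshelve. all: by end_near. Qed.

Definition sl1 : SL2Z := toSL2Z (det1 _ _).

Lemma hX1 : hX sl1 = @id S.
Proof.
apply/funext => u; have [x ->] := pr_surj u; rewrite hX_pr; congr (pr _).
by apply: val_inj; rewrite /= moebius1.
Qed.

Lemma modular_holomorphic_id : holomorphic_map (@id S).
Proof. by rewrite -hX1; exact: hX_holomorphic. Qed.

Lemma hX_automorphism g : automorphism (hX g : S -> S).
Proof.
split; first exact: hX_holomorphic.
exists (hX (sinv g)); split; first exact: hX_holomorphic.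
  by move=> u; exact: hXK.
by move=> u; exact: hXVK.
Qed.

Lemma map_deriv_ord g c d V W z : ord_on c V -> ord_on d W -> 0 < imag z ->
  V (up z) -> W (up (mob g z)) ->
  map_deriv (S := S) (hX g) c d (pr (up z)) = (den g z ^+ 2)^-1.
Proof.
move=> oc od z0 Vz Wz; have gz0 := imag_mob_gt0 g z0.
have [cz _] := ordE oc z0 Vz.
have nW : \forall w \near z, 0 < imag (mob g w) /\ W (up (mob g w)).
  exact: (derivable_cont (@derivable_mob R g z z0) (near_ord od gz0 Wz)).
rewrite (@map_deriv_near R S (hX g) c d (pr (up z)) (mob g)); last first.
  rewrite cz; apply: filterS2 nW (near_ord oc z0 Vz) => w [gw0 Ww] [w0 Vw].
  rewrite (ord_inv (pr (up z)) oc w0 Vw) hX_pr act_up //.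
  by have [] := ordE od gw0 Ww.
by rewrite cz; have [_ ->] := is_derive_mob g z0.
Qed.

Lemma derivable_invden2 g z : 0 < imag z ->
  derivable (fun w : C => 1 / (den g w * den g w)) z 1.
Proof.
move=> z0; have d0 := den_neq0 g z0.
have dd : derivable (den g) z 1.
  have := is_derive_mulC (is_derive_cst (ent R g 1 0) z 1) (is_derive_id z 1) => h.
  have [hh _] := is_deriveD h (is_derive_cst (ent R g 1 1) z 1).
  exact: hh.
apply: (@derivable_divC R (fun=> 1) (fun w => den g w * den g w) z).
- exact: derivable_cst.
- exact: (@derivable_mulC R (den g) (den g) z dd dd).
- by rewrite mulf_neq0.
Qed.

(** At a point of the half plane the derivative is (c z + d)^-2 in ordinary charts; at a
    cusp it is 1 in transported frames. *)
Lemma hX_smooth g : smooth_auto (hX g : S -> S).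
Proof.
split; first exact: hX_automorphism.
move=> u; have [[z z0 ->]|[g0 ->]] := pr_cases u.
  have gz0 := imag_mob_gt0 g z0.
  have [c [V [oc Vz]]] := ord_ex p4 z0; have [d [W [od Wz]]] := ord_ex p4 gz0.
  have [cz cu] := ordE oc z0 Vz; have [dz du] := ordE od gz0 Wz.
  exists c, d; split=> //.
  - exact: ord_atlas oc.
  - exact: ord_atlas od.
  - by rewrite hX_pr act_up.
  pose f u : C := 1 / (den g (chart_coord c u) * den g (chart_coord c u)).
  have ef : \forall y \near pr (up z), f y = map_deriv (S := S) (hX g) c d y.
    have oU : open (pr @` (V `&` act g @^-1` W)).
      apply: open_pr; apply: openI; first by case: oc.
      by apply: open_act; case: od.
    have Uz : (pr @` (V `&` act g @^-1` W)) (pr (up z)).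
      by exists (up z) => //; split=> //; rewrite /preimage /= act_up.
    apply: filterS (open_nbhs_nbhs (conj oU Uz)) => _ [x [Vx Wx] <-].
    have [_ _ _ cV] := oc; have [w [xw w0 cw]] := cV x Vx.
    move: Vx Wx; rewrite /preimage /= (upE xw w0) act_up // => Vx Wx.
    rewrite (map_deriv_ord oc od w0 Vx Wx) /f.
    by have [-> _] := ordE oc w0 Vx; rewrite div1r expr2.
  apply: (@hol_at_near R S (@modular_regular R p p4) f _ _ ef).
  move=> e ae eu.
  have dc := modular_holomorphic_id.2 e c ae (ord_atlas oc) _ eu cu.
  set w0 := chart_coord e (pr (up z)) in dc *.
  have cw0 : chart_coord c (chart_inv e (pr (up z)) w0) = z.
    by rewrite (chart_invE (@modular_regular R p p4) ae eu).
  have dF : derivable (fun w : C => 1 / (den g w * den g w))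
      ((chart_coord c \o chart_inv e (pr (up z))) w0) 1.
    by rewrite /= cw0; exact: derivable_invden2.
  exact: (@derivable_compC R (chart_coord c \o chart_inv e (pr (up z)))
    (fun w : C => 1 / (den g w * den g w)) w0 dc dF).
have [c cc] := cusp_ex R p4 g0; have [d cd] := cusp_ex R p4 (smul g g0).
have r1 : nm (0 : C) < qrad 1 by rewrite nm0; exact: qrad_gt0.
have cu : chart_dom c (pr (act g0 infty)).
  by have [] := cuspE p4 cc r1; rewrite xq0.
exists c, d; split=> //.
- exact: cusp_atlas cc.
- exact: cusp_atlas cd.
- by rewrite hX_pr -moebius_actM; have [] := cuspE p4 cd r1; rewrite xq0.
have [oc _ _ _] := modular_regular p4 (cusp_atlas cc) cu.
have e1 : \forall y \near pr (act g0 infty), 1 = map_deriv (S := S) (hX g) c d y.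
  apply: filterS (open_nbhs_nbhs (conj oc cu)) => y cy.
  have [w wM yE] := cusp_pts p4 cc cy.
  have cw : chart_coord c y = w by rewrite yE; have [] := cuspE p4 cc wM.
  rewrite (@map_deriv_near R S (hX g) c d y id); first by rewrite derive_id.
  rewrite cw; apply: filterS (near_nm wM) => v vM.
  exact: (hX_cusp_frame y cc cd vM vM).
apply: (@hol_at_near R S (@modular_regular R p p4) (fun=> 1) _ _ e1).
exact: hol_at_cst.
Qed.

Lemma hX_fixed_point g z : 0 < imag z -> mob g z = z -> den g z ^+ 2 = -1 ->
  exists (u : S) c, [/\ hX g u = u, atlas c, chart_dom c u &
    map_deriv (S := S) (hX g) c c u = -1].
Proof.
move=> z0 gz dz; have [c [V [oc Vz]]] := ord_ex p4 z0; have [_ cu] := ordE oc z0 Vz.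
exists (pr (up z)), c; split=> //.
- by rewrite hX_pr act_up // gz.
- exact: ord_atlas oc.
by rewrite (map_deriv_ord oc oc z0 Vz) ?gz // dz invrN1.
Qed.

End Automorphisms.

(** * Discs on X(p) *)

Section ChartDiscs.
Variable R : realType.
Local Notation C := (Cx R).
Variable S : surface R.
Hypothesis reg : forall c : chart R S, atlas c -> regular_chart c.

Lemma chart_inv_near (c : chart R S) x y : atlas c -> chart_dom c y ->
  \forall w \near chart_coord c y, chart_inv c y w = chart_inv c x w.
Proof.
move=> ac cy; have [_ inv h _] := reg ac cy; apply: filterS h => w [dw cw].
by rewrite -{2}cw inv.
Qed.

Lemma sq_scale (r s : R) (z : C) : 0 < r -> sq s z -> sq (r * s) (r%:C * z).
Proof.
move=> r0; case: z => a b [/= h1 h2]; rewrite /sq /= !mul0r subr0 addr0.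
by rewrite !normrM (gtr0_norm r0) !ltr_pM2l.
Qed.

(** The images of the squares have to be open by hypothesis: the properties in
    [regular_chart] do not include the continuity of the coordinate. *)
Lemma chart_disc (c : chart R S) x (w0 : C) (r : R) : atlas c -> 0 < r ->
  (forall w, sq r (w - w0) -> chart_dom c (chart_inv c x w) /\
    chart_coord c (chart_inv c x w) = w) ->
  (forall s, 0 < s < r -> open (chart_inv c x @` [set w | sq s (w - w0)])) ->
  disc (fun z => chart_inv c x (w0 + r%:C * z)).
Proof.
move=> ac r0 cr oc.
pose aff (z : C) : C := r%:C * z + w0.
have daff z : derivable aff z 1.
  have h := is_derive_mulC (is_derive_cst (r%:C : C) z 1) (is_derive_id z 1).
  by have [hh _] := is_deriveD h (is_derive_cst w0 z 1); exact: hh.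
have affr z : sq 1 z -> sq r (aff z - w0).
  by rewrite /aff addrK => /(sq_scale r0); rewrite mulr1.
split.
- move=> z /affr/cr[dz cz]; have [_ _ _ cinv] := reg ac dz.
  have cx : {for aff z, continuous (chart_inv c x)}.
    rewrite -[X in {for X, _}]cz.
    exact: continuous_near (chart_inv_near x ac dz) cinv.
  have caff := derivable_cont (daff z).
  move=> A nA; have nA' : nbhs (chart_inv c x (aff z)) A by rewrite /aff addrC.
  have nE : \forall w \near z, A (chart_inv c x (aff w)) by exact: caff _ (cx A nA').
  suff : \forall w \near z, A (chart_inv c x (w0 + r%:C * w)) by [].
  by apply: filterS nE => w; rewrite /aff addrC.
- move=> s /andP[s0 s1].
  have -> : (fun z => chart_inv c x (w0 + r%:C * z)) @` sq s =
      chart_inv c x @` [set w | sq (r * s) (w - w0)].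
    apply/seteqP; split=> [_ [z sz <-]|_ [w sw <-]].
      by exists (w0 + r%:C * z) => //=; rewrite [w0 + _]addrC addrK; exact: sq_scale.
    have rc : r%:C != 0 :> C by rewrite -nm_gt0 nm_real normr_gt0 gt_eqF.
    exists (r^-1%:C * (w - w0)); last first.
      by rewrite fmorphV mulrA mulfV // mul1r subrKC.
    have := @sq_scale r^-1 (r * s) (w - w0); rewrite invr_gt0 => /(_ r0 sw).
    by rewrite mulrA mulVf ?gt_eqF // mul1r.
  by apply: oc; rewrite mulr_gt0 //= -[X in _ < X]mulr1 ltr_pM2l.
move=> W f hf z sz Wz.
have [dz cz] := cr _ (affr _ sz).
have dzE : aff z = w0 + r%:C * z by rewrite /aff addrC.
have df := hf c ac (chart_inv c x (aff z)).
rewrite dzE in df dz cz.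
have {df} := df Wz dz; rewrite cz => df.
have nE : \forall w \near w0 + r%:C * z, (f \o chart_inv c (chart_inv c x (w0 + r%:C * z))) w =
    (f \o chart_inv c x) w.
  by have := chart_inv_near x ac dz; rewrite cz; apply: filterS => w /= ->.
have df2 := near_eq_derivable nE df.
have df3 : derivable (f \o chart_inv c x) (aff z) 1 by rewrite dzE.
have df4 := @derivable_compC R aff (f \o chart_inv c x) z (daff z) df3.
suff n4 : \forall w \near z, ((f \o chart_inv c x) \o aff) w =
    (f \o (fun z => chart_inv c x (w0 + r%:C * z))) w.
  exact: (near_eq_derivable n4 df4).
by near=> w; rewrite /= /aff addrC.
Unshelve. all: by end_near. Qed.

End ChartDiscs.

Section ModularTopology.
Variable R : realType.
Local Notation C := (Cx R).
Variable p : nat.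
Hypothesis p4 : (4 < p)%N.
Implicit Types (g h : SL2Z) (z w : C) (x y : hstar R).
Local Notation X := (modular_space R p).
Local Notation S := (modular_curve R p).
Local Notation pr := (@modular_proj R p).
Local Notation act := moebius_act.
Local Notation infty := (cusp_infty R).
Local Notation xq := (xq p).
Local Notation qrad := (@qrad R p).
Local Notation qc := (@qc R p).
Implicit Types (c d : chart R S) (u : S).

Lemma near_sq (P : C -> Prop) z : (\forall w \near z, P w) ->
  exists2 r : R, 0 < r & forall w, sq r (w - z) -> P w.
Proof.
move=> /nearCP[e e0 H]; exists (e / 3); first by rewrite divr_gt0.
move=> w /sub_csq/nm_csq h; apply: H; apply: le_lt_trans h _; lra.
Qed.

Lemma open_sq_shift (s : R) z : open [set w : C | sq s (w - z)].
Proof.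
have dz v : derivable (fun w : C => w - z) v 1.
  by apply: derivableB; [exact: derivable_id|exact: derivable_cst].
have cz : continuous (fun w : C => w - z) by move=> v; exact: derivable_cont (dz v).
by move/continuousP: cz => /(_ _ (open_sq (r := s))).
Qed.

Lemma open_ord_sq c V u0 (s : R) z : ord_on c V ->
  (forall w, sq s (w - z) -> 0 < imag w /\ V (up w)) ->
  open (chart_inv c u0 @` [set w | sq s (w - z)]).
Proof.
move=> oc H.
have -> : chart_inv c u0 @` [set w | sq s (w - z)] =
    pr @` [set x | exists2 w, sq s (w - z) /\ 0 < imag w & x = up w].
  apply/seteqP; split=> [_ [w sw <-]|_ [_ [w [sw w0] ->] <-]].
    have [w0 Vw] := H w sw; exists (up w); first by exists w.
    by rewrite (ord_inv u0 oc w0 Vw).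
  by have [_ Vw] := H w sw; exists w => //; rewrite (ord_inv u0 oc w0 Vw).
apply: open_pr.
exact: (open_up (A := [set w | sq s (w - z)]) (open_sq_shift (s := s) (z := z))).
Qed.

(** At infinity, the points of a sufficiently high horoball have a small q. *)
Lemma open_qsq (s : R) : 0 < s -> s <= 1 ->
  open [set x | horoball 0 x /\ sq s (qcoord p x)].
Proof.
move=> s0 s1; split=> [x z [_ sx] xz z0|g [hg sg]].
  rewrite (upE xz z0) qcoord_up // in sx.
  have [dq _] := is_derive_qc p z.
  have nq : \forall w \near z, sq s (qc w).
    have oq : \forall v \near qc z, sq s v.
      by apply: open_nbhs_nbhs; split=> //; exact: open_sq.
    exact: (derivable_cont dq oq).
  apply: filterS2 nq (near_imag z0) => w sw w0 y yw.
  by rewrite (upE yw w0); split; [exact: horoball_up|rewrite qcoord_up].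
have gi : act g infty = infty.
  have [//|[z [z0 _ e]]] := horoballP (lexx 0) hg.
  by have := up_not_cusp z0 (esym e).
have [k [kE _]] := mob_translation R ((fix_infty R g).1 gi).
exists (- ln s / (2 * pi / p%:R)) => y w yw Mw.
have tp := twopi_p R p4.
have qs : qrad (- ln s / (2 * pi / p%:R)) = s.
  by rewrite /qrad mulrC divfK ?gt_eqF // opprK lnK ?posrE.
have ls : 0 <= - ln s by rewrite oppr_ge0 ln_le0.
have w0 : 0 < imag w by apply: le_lt_trans Mw; rewrite divr_ge0 // ltW.
have wk := imag_addz w k.
rewrite (upE yw w0) act_up // kE; split; first by apply: horoball_up; rewrite wk.
rewrite qcoord_up ?wk //; apply: nm_sq.
by rewrite -[X in _ < X]qs -(qc_qrad p4) wk.
Qed.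

Lemma open_cusp_sq c g M u0 (s : R) : cusp_on c g M -> 0 < s ->
  (forall w, sq s w -> nm w < qrad M) ->
  open (chart_inv c u0 @` [set w | sq s (w - 0)]).
Proof.
move=> cc s0 H; have M1 : 1 <= M by case: cc.
have q1 := qrad_le1 p4 M1.
have s1 : s <= 1.
  rewrite leNgt; apply/negP => s1.
  have /H : sq s (1 : C) by rewrite /sq /= normr1 normr0.
  by rewrite nm1 => h; have := lt_le_trans h q1; rewrite ltxx.
have -> : chart_inv c u0 @` [set w | sq s (w - 0)] =
    pr @` (act (sinv g) @^-1` [set x | horoball 0 x /\ sq s (qcoord p x)]).
  apply/seteqP; split=> [_ [w sw' <-]|_ [x [hx sx] <-]].
    have sw : sq s w by move: sw'; rewrite /= subr0.
    have wM := H w sw.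
    have w1 := lt_le_trans wM q1.
    rewrite (cusp_inv p4 u0 cc wM); exists (act g (xq w)) => //.
    rewrite /preimage /= moebius_actK (qcoord_xq p4 w1); split=> //.
    by apply: (horoball_xq p4); rewrite ?qrad0.
  exists (qcoord p (act (sinv g) x)); first by rewrite /= subr0.
  rewrite (cusp_inv p4 u0 cc (H _ sx)) -[in RHS](moebius_actVK g x).
  apply: (cusp_inj p4) => //; last by rewrite (qcoord_xq p4) // (lt_le_trans (H _ sx)).
  by apply: (horoball_xq p4) => //; rewrite qrad0 (lt_le_trans (H _ sx)).
apply: open_pr; apply: open_act; exact: open_qsq.
Qed.

Theorem modular_discs : has_discs S.
Proof.
move=> u U oU Uu; pose reg := @modular_regular R p p4.
suff : exists c, [/\ atlas c, chart_dom c u & exists2 r : R, 0 < r &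
    (forall w, sq r (w - chart_coord c u) -> chart_dom c (chart_inv c u w) /\
      chart_coord c (chart_inv c u w) = w) /\
    forall s, 0 < s < r -> open (chart_inv c u @` [set w | sq s (w - chart_coord c u)])].
  move=> [c [ac cu [r r0 [cr oc]]]].
  have nU := near_chart reg ac cu (open_nbhs_nbhs (conj oU Uu) : \forall y \near u, U y).
  have [t t0 tU] := near_sq nU.
  pose e := Num.min r t.
  have e0 : 0 < e by rewrite lt_min r0.
  have er : e <= r by rewrite ge_min lexx.
  have et : e <= t by rewrite ge_min lexx orbT.
  exists (fun z => chart_inv c u (chart_coord c u + e%:C * z)); split.
  - apply: (chart_disc reg ac e0).
      by move=> w we; apply: cr; exact: sub_sq we.
    by move=> s /andP[s0 se]; apply: oc; rewrite s0 (lt_le_trans se).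
  - by rewrite mulr0 addr0 (chart_invE reg ac cu).
  - move=> z sz; apply: tU; rewrite addrC addKr; apply: (sub_sq et).
    by have := sq_scale e0 sz; rewrite mulr1.
have [[z z0 uE]|[g uE]] := pr_cases u.
  have [c [V [oc Vz]]] := ord_ex p4 z0; have [cz cu] := ordE oc z0 Vz.
  rewrite uE; exists c; split=> //; first exact: ord_atlas oc.
  have [r r0 rV] := near_sq (near_ord oc z0 Vz).
  exists r => //; rewrite cz; split.
    move=> w /rV[w0 Vw]; rewrite (ord_inv (pr (up z)) oc w0 Vw).
    by have [] := ordE oc w0 Vw.
  move=> s /andP[_ sr]; apply: (open_ord_sq _ oc) => w sw; apply: rV.
  exact: sub_sq (ltW sr) _ sw.
have [c cc] := cusp_ex R p4 g.
have r1 : nm (0 : C) < qrad 1 by rewrite nm0; exact: qrad_gt0.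
have [cu c0] := cuspE p4 cc r1; rewrite xq0 in cu c0.
rewrite uE; exists c; split=> //; first exact: cusp_atlas cc.
have [r r0 rV] := near_sq (near_nm r1).
exists r => //; rewrite c0; split.
  move=> w /rV wM; rewrite (cusp_inv p4 _ cc wM).
  by have [] := cuspE p4 cc wM.
move=> s /andP[s0 sr]; apply: (open_cusp_sq _ cc s0) => w sw; apply: rV.
by rewrite subr0; exact: sub_sq (ltW sr) _ sw.
Qed.

End ModularTopology.

(** * Compactness and connectedness of X(p) *)

Section ModularCompact.
Variable R : realType.
Local Notation C := (Cx R).
Variable p : nat.
Hypothesis p4 : (4 < p)%N.
Implicit Types (g h : SL2Z) (z w : C) (x y : hstar R).
Local Notation X := (modular_space R p).
Local Notation S := (modular_curve R p).
Local Notation pr := (@modular_proj R p).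
Local Notation act := moebius_act.
Local Notation infty := (cusp_infty R).
Local Notation xq := (xq p).
Local Notation qrad := (@qrad R p).
Local Notation qc := (@qc R p).
Implicit Types (c d : chart R S) (u : S).

Lemma translate_half z : exists g, forall w, imag (mob g w) = imag w /\
  `|complex.Re (mob g z)| <= 1 / 2.
Proof.
pose k : int := - Num.floor (complex.Re z + 1 / 2).
have [g _ gE] := translation_ex R p4 k.
exists g => w; rewrite !gE imag_addz; split=> //.
rewrite raddfD /= -(rmorph_int (real_complex R)) /= /k rmorphN /=.
have := floor_le (complex.Re z + 1 / 2).
have := floorD1_gt (complex.Re z + 1 / 2).
rewrite intrD; set t := _%:~R => h1 h2.
by rewrite ler_norml; apply/andP; split; lra.
Qed.

Lemma sl2S_det : \det (\matrix_(i, j) (if i == 0 then (if j == 0 then 0 else -1)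
   else (if j == 0 then 1 else 0)) : 'M[int]_2) = 1.
Proof. by rewrite det2E !mxE. Qed.

Definition sl2S : SL2Z := toSL2Z sl2S_det.

Lemma imag_sl2S z : 0 < imag z -> imag (mob sl2S z) = imag z / nm z ^+ 2.
Proof.
by move=> z0; rewrite imag_mob // /den /ent /= !mxE /= mul1r addr0.
Qed.

(** Translations bring [z] into the strip; there z -> -1/z at least doubles the height
    as long as it is below 1/2. *)
Lemma fundamental_strip z : 0 < imag z ->
  exists g, `|complex.Re (mob g z)| <= 1 / 2 /\ 1 / 2 <= imag (mob g z).
Proof.
move=> z0.
(* n bounds the number of inversions *)
have [n nz] : exists n : nat, 1 / 2 <= 2 ^+ n * imag z.
  have [n hn] : exists n : nat, (imag z)^-1 < n%:R.
    exists (Num.bound (imag z)^-1); by apply: archi_boundP; rewrite invr_ge0 ltW.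
  exists n; have : n%:R <= 2 ^+ n :> R by rewrite -natrX ler_nat ltnW // ltn_expl.
  move=> h; have h2 : 1 < n%:R * imag z by rewrite -ltr_pdivrMr // div1r.
  have h3 := ler_wpM2r (ltW z0) h; lra.
elim: n z z0 nz => [|n IH] z z0 nz.
  have [g gE] := translate_half z; exists g; have [-> ?] := gE z.
  by split=> //; move: nz; rewrite expr0 [1 * imag z]mul1r.
have [g gE] := translate_half z; have [gi gr] := gE z.
have [h|h] := leP (1 / 2) (imag (mob g z)); first by exists g.
have w0 := imag_mob_gt0 g z0; set w := mob g z in gi gr h w0 *.
have Sw := imag_sl2S w0; have Sw0 := imag_mob_gt0 sl2S w0.
have n2 : nm w ^+ 2 <= 1 / 2.
  rewrite nm_sqr; have : complex.Re w ^+ 2 <= 1 / 4.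
    by move: gr; rewrite ler_norml => /andP[? ?]; nra.
  by rewrite -/(imag w); nra.
have np : 0 < nm w ^+ 2.
  rewrite exprn_gt0 // nm_gt0; apply/eqP => e; move: w0; rewrite e.
  by rewrite /imag ltxx.
have le2 : 2 * imag w <= imag (mob sl2S w).
  rewrite Sw ler_pdivlMr //; nra.
have [|g' [h1 h2]] := IH (mob sl2S w) Sw0.
  have : 0 <= 2 ^+ n :> R by rewrite exprn_ge0.
  move: nz; rewrite exprSr -gi; nra.
by exists (smul g' (smul sl2S g)); rewrite !mobM ?imag_mob_gt0.
Qed.

Definition residue g : 'M['Z_p]_2 := map_mx (intr : int -> 'Z_p) (val g).

Definition residue_rep (m : 'M['Z_p]_2) : SL2Z := xget sl1 [set g | residue g = m].

Lemma residue_repP g x : pr (act (residue_rep (residue g)) x) = pr (act g x).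
Proof.
apply: pr_congr; rewrite /residue_rep; case: xgetP => [h _ //|/(_ g)].
by case.
Qed.

Lemma compact_image (f : C -> S) (r : R) :
  (forall z, csq r z -> {for z, continuous f}) -> compact (f @` csq r).
Proof.
move=> cf; apply: continuous_compact; last exact: compact_csq.
by apply: continuous_in_subspaceT => z; rewrite inE => /cf.
Qed.

(** Up to SL(2, Z), a point of the extended half plane lies in a compact square of the
    half plane or, in the coordinate q, in a compact square around the cusp; and
    SL(2, Z) acts on X(p) through the finitely many matrices modulo p. *)
Theorem modular_compact : compact [set: S].
Proof.
have tp := twopi_p R p4.
(* above height T, q lies in the square of half-side 1/3, which is contained in the unit
   disc; the square of half-side T centred at c0 contains the part of the strip between
   the heights 1/2 and T *)
pose T : R := ln 3 / (2 * pi / p%:R) + 1.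
have T1 : 1 <= T by rewrite lerDr divr_ge0 // ?ln_ge0 ?ltW //; lra.
have qT : qrad T <= 1 / 3.
  have -> : 1 / 3 = qrad (ln 3 / (2 * pi / p%:R)).
    by rewrite /qrad [_ * (ln 3 / _)]mulrC divfK ?gt_eqF // expRN lnK ?posrE // div1r.
  by apply: (le_qrad p4); rewrite /T lerDl.
pose c0 : C := 0 +i* (T + 1 / 2).
pose f1 (g : SL2Z) (z : C) : S := pr (act g (up (z + c0))).
pose f2 (g : SL2Z) (w : C) : S := pr (act g (xq w)).
pose A (m : 'M['Z_p]_2) := f1 (residue_rep m) @` csq T `|` f2 (residue_rep m) @` csq (1 / 3).
have -> : [set: S] = \big[setU/set0]_(m <- enum 'M['Z_p]_2) A m.
  apply/esym/seteqP; split=> // u _.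
  suff [g Ag] : exists g, A (residue g) u.
    rewrite (big_rem (residue g)) ?mem_enum //=; by left.
  have [x ->] := pr_surj u.
  have [[z z0 ->]|[g ->]] := hstarP x; last first.
    exists g; right; exists 0; last by rewrite /f2 residue_repP xq0.
    by split; rewrite normr0 divr_ge0.
  have [g [h1 h2]] := fundamental_strip z0.
  have w0 := imag_mob_gt0 g z0; set w := mob g z in h1 h2 w0 *.
  have xE : up z = act (sinv g) (up w) by rewrite -act_up // moebius_actK.
  exists (sinv g); have [wT|wT] := leP (imag w) T.
    left; exists (w - c0); last by rewrite /f1 subrK residue_repP xE.
    have := T1; rewrite /csq /= /c0; case: (w) h1 h2 wT => a b; rewrite /imag /= oppr0 addr0.
    rewrite !ler_norml => /andP[? ?] ? ? ?.
    by split; apply/andP; split; lra.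
  have q3 : nm (qc w) < 1 / 3 by apply: lt_le_trans qT; rewrite -(qc_qrad p4).
  right; exists (qc w).
    by split; apply: le_trans (ltW q3); [exact: nm_Re|exact: nm_Im].
  rewrite /f2 residue_repP xE; apply: (cusp_inj p4).
  - by apply: (horoball_xq p4); rewrite // qrad0; lra.
  - exact: horoball_up.
  - by rewrite qcoord_up // (qcoord_xq p4) //; lra.
apply: bigsetU_compact => m _; apply: compactU; apply: compact_image => z [zr zi].
  have zc0 : 0 < imag (z + c0).
    rewrite /imag raddfD /= /c0 /=; move: zi; rewrite ler_norml => /andP[? ?]; lra.
  have cg := @continuous_pr_act_up R p (residue_rep m) _ zc0.
  have da : derivable (fun z : C => z + c0) z 1.
    by apply: derivableD; [exact: derivable_id|exact: derivable_cst].
  have ca := derivable_cont da.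
  by move=> U nU; exact: ca _ (cg U nU).
apply: (continuous_cusp p4).
have : nm z <= 2 * (1 / 3) by exact: nm_csq.
lra.
Qed.

(** The half plane is convex. *)
Lemma segment_connected_hstar (B : set (hstar R)) z w : open B -> open (~` B) ->
  0 < imag z -> 0 < imag w -> B (up z) -> B (up w).
Proof.
move=> oB oB' z0 w0 Bz.
pose f (t : R) : C := z + (w - z) * t%:C.
have fi t : `[0, 1]%classic t -> 0 < imag (f t).
  rewrite /= in_itv /= => /andP[t0 t1]; rewrite /f; move: z0 w0.
  case: (z) (w) => a b [a' b']; rewrite /imag /= !mulr0 add0r => b0 b'0.
  have [->|/eqP tn] := eqVneq t 1; first by lra.
  have t2 : t < 1 by rewrite lt_neqAle t1 andbT; apply/eqP.
  have : 0 < (1 - t) * b by rewrite mulr_gt0 // subr_gt0.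
  have : 0 <= t * b' by rewrite mulr_ge0 // ltW.
  lra.
have fE1 : f 1 = w by rewrite /f mulr1 subrKC.
have fE0 : f 0 = z by rewrite /f mulr0 addr0.
have cf t : {for t, continuous f}.
  pose re (s : R) : R := complex.Re z + complex.Re (w - z) * s.
  pose im (s : R) : R := complex.Im z + complex.Im (w - z) * s.
  have cl (a b : R) : {for t, continuous (fun s : R => a + b * s)}.
    by apply: cvgD; [exact: cvg_cst|apply: cvgM; [exact: cvg_cst|exact: cvg_id]].
  have -> : f = (fun s => re s +i* im s).
    apply/funext => s; rewrite /f /re /im; case: (z) (w) => a b [a' b'] /=.
    by simpc.
  exact: (@cvg_complex R R (nbhs t) (nbhs_filter t) re im _ _ (cl _ _) (cl _ _)).
pose I : set R := `[0, 1]%classic.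
have B01 : I `&` (f @^-1` [set v | B (up v)]) = I.
  have H (D : set (hstar R)) : open D ->
      exists2 Q : set R, open Q & I `&` (f @^-1` [set v | D (up v)]) = I `&` Q.
    move=> oD; exists ((f @^-1` [set v | D (up v)])^°); first exact: open_interior.
    apply/seteqP; split=> t [t01 Dt]; split=> //; last exact: interior_subset Dt.
    have nD := near_up (fi t t01) (open_nbhs_nbhs (conj oD Dt)).
    exact: cf t _ nD.
  apply: (@segment_connected R 0 1).
  - by exists 0; split; [rewrite /I /= in_itv /= lexx ler01|rewrite /preimage /= fE0].
  - by have [Q oQ QE] := H B oB; exists Q.
  - have [Q oQ QE] := H _ oB'; exists (~` Q); first exact: open_closedC.
    apply/seteqP; split=> t [t01 Bt]; split=> //.
      move=> Qt; suff : (I `&` (f @^-1` [set v | (~` B) (up v)])) t by case.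
      by rewrite QE.
    apply: contrapT => nBt; apply: Bt.
    suff : (I `&` Q) t by case.
    by rewrite -QE.
have : I 1 by rewrite /I /= in_itv /= ler01 lexx.
by rewrite -B01 => -[_]; rewrite /preimage /= fE1.
Qed.

(** The cusps lie in the closure of the half plane. *)
Lemma open_meets_plane (B : set (hstar R)) x : open B -> B x ->
  exists2 z, 0 < imag z & B (up z).
Proof.
move=> oB; have [[z z0 ->]|[g ->]] := hstarP x; first by exists z.
move=> /(oB.2 g)[M MB]; pose z : C := 0 +i* (Num.max M 0 + 1).
have M0 : 0 <= Num.max M 0 by rewrite le_max lexx orbT.
have MM : M <= Num.max M 0 by rewrite le_max lexx.
have z0 : 0 < imag z by rewrite /imag /=; lra.
exists (mob g z); first exact: imag_mob_gt0.
rewrite -act_up //; apply: (MB (up z) z (hpt_up z0)).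
by rewrite /imag /=; lra.
Qed.

Theorem modular_connected : connected [set: S].
Proof.
move=> B [u Bu] [Q oQ BQ] [D cD BD]; apply/seteqP; split=> // v _.
have oB : open (pr @^-1` B).
  by rewrite BQ setTI; apply: open_comp oQ => x _; exact: pr_continuous.
have oB' : open (~` (pr @^-1` B)).
  rewrite BD setTI; have oD : open (~` D) by exact: closed_openC.
  by apply: (open_comp _ oD) => x _; exact: pr_continuous.
have [x ux] := pr_surj u; have [y vy] := pr_surj v.
have Bx : (pr @^-1` B) x by rewrite /preimage /= -ux.
have [z z0 Bz] := open_meets_plane oB Bx.
apply: contrapT => nBv.
have By : (~` (pr @^-1` B)) y by rewrite /preimage /= -vy.
have [w w0 Bw] := open_meets_plane oB' By.
by apply: Bw; exact: segment_connected_hstar oB oB' z0 w0 Bz.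
Qed.

End ModularCompact.

(** * A Klein four-group of elliptic elements *)

Section TwoSquares.
Variable p : nat.
Hypothesis prp : prime p.
Hypothesis p4 : (4 < p)%N.

Lemma Fp_int0 (n : int) : ((n%:~R : 'F_p) == 0) = (p%:Z %| n)%Z.
Proof.
case: n => m; first by rewrite -(dvdn_pcharf (pchar_Fp prp)).
by rewrite NegzE rmorphN /= oppr_eq0 -[LHS](dvdn_pcharf (pchar_Fp prp)) dvdzE.
Qed.

Lemma Fp_nat (x : 'F_p) : exists n : nat, n%:R = x.
Proof. by exists x; rewrite natr_Zp. Qed.

(** At least half of the classes are squares; as p is odd, the squares a^2 and the
    differences n - b^2 cannot be disjoint. *)
Lemma sum_two_squares (n : 'F_p) : exists a b : 'F_p, a ^+ 2 + b ^+ 2 = n.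
Proof.
pose sqr (x : 'F_p) := x ^+ 2; pose A := sqr @: [set: 'F_p]%SET.
(* a choice of square roots; every class is one of them or the opposite of one *)
pose r a := odflt 0 [pick x | sqr x == a].
have rA a : a \in A -> sqr (r a) = a.
  move=> /imsetP[x _ ->]; rewrite /r; case: pickP => [y /eqP //|/(_ x)].
  by rewrite eqxx.
have cF : #|[set: 'F_p]%SET| = p by rewrite cardsT card_Fp.
have pA : (p <= #|A| + #|A|)%N.
  rewrite -[X in (X <= _)%N]cF; apply: leq_trans (_ : #|(r @: A) :|: ((-%R \o r) @: A)| <= _)%N.
    apply: subset_leq_card; apply/fintype.subsetP => x _; rewrite inE.
    have xA : sqr x \in A by exact: imset_f.
    have /eqP := rA _ xA; rewrite /sqr eqf_sqr => /orP[/eqP e|/eqP e].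
      by apply/orP; left; apply/imsetP; exists (sqr x).
    by apply/orP; right; apply/imsetP; exists (sqr x) => //=; rewrite e opprK.
  apply: leq_trans (leq_card_setU _ _) _; apply: leq_add; exact: leq_imset_card.
pose B := (fun a => n - a) @: A.
have cB : #|B| = #|A| by apply: card_imset => a b /addrI/oppr_inj.
have [/pred0P dis|/existsP[x /andP[xA xB]]] := boolP [disjoint A & B]; last first.
  have /imsetP[a _ aE] := xA; have /imsetP[_ /imsetP[b _ ->] bE] := xB.
  by exists a, b; rewrite -[a ^+ 2]/(sqr a) -aE bE subrK.
have odp : odd p by case: (even_prime prp) p4 => [->|].
have : (#|A| + #|A| <= p)%N.
  rewrite -{2}cB -(cardsUI A B) (_ : A :&: B = finset.set0) ?cards0 ?addn0.
    by rewrite -[X in (_ <= X)%N](card_Fp prp) max_card.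
  by apply/finset.setP => x; rewrite !inE; exact: dis.
move=> Ap; have e : p = (#|A| + #|A|)%N by apply/eqP; rewrite eqn_leq pA Ap.
suff : ~~ odd p by rewrite odp.
by rewrite [in odd p]e addnn odd_double.
Qed.

(** The class y is a sum of two squares, and it has a representative l = C^2 + D^2 with
    C and D coprime. With u C + v D = 1, the number m0 = v C - u D satisfies
    m0^2 + 1 = (u^2 + v^2) l; adding a multiple of l to m0 gives it the residue x. *)
Lemma elliptic_lift (x y : 'F_p) : y != 0 -> exists m l k : int,
  [/\ 0 < l, k * l = m ^+ 2 + 1, m%:~R = x & l%:~R = y].
Proof.
move=> y0.
have [a [b [a0 ab]]] : exists a b : 'F_p, a != 0 /\ a ^+ 2 + b ^+ 2 = y.
  have [a [b ab]] := sum_two_squares y.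
  have [a0|a0] := eqVneq a 0; last by exists a, b.
  exists b, a; split; last by rewrite addrC.
  by apply: contraNneq y0 => b0; rewrite -ab a0 b0 expr0n addr0.
have [c ca] := Fp_nat a; have [d0 db] := Fp_nat b.
have cp : coprime p c.
  by rewrite prime_coprime // (dvdn_pcharf (pchar_Fp prp)) ca.
(* within its class modulo p, d0 is replaced by a number that is 1 modulo c *)
pose d := chinese p c d0 1.
have dp : (d%:R : 'F_p) = b.
  rewrite -db; apply/eqP; rewrite -subr_eq0.
  have := chinese_modl cp d0 1; rewrite -/d => /eqP.
  have h (u v : nat) : u == v %[mod p] -> (u%:R - v%:R : 'F_p) == 0.
    by move=> /eqP e; rewrite subr_eq0 -(Fp_nat_mod prp u) -(Fp_nat_mod prp v) e.
  exact: h.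
have cd : coprime c d.
  have := chinese_modr cp d0 1; rewrite -/d => e.
  by rewrite -coprime_modr e coprime_modr coprimen1.
have /coprimezP[[u v] /= uv] : coprimez c%:Z d%:Z by [].
have c_gt0 : (0 < c)%N.
  by rewrite lt0n; apply: contraNneq a0 => c0; rewrite -ca c0.
set C : int := c%:Z in uv; set D : int := d%:Z in uv.
have C0 : 0 < C by [].
pose m0 := v * C - u * D; pose l := C ^+ 2 + D ^+ 2; pose k0 := u ^+ 2 + v ^+ 2.
have l0 : 0 < l by rewrite ltr_pwDl // ?exprn_gt0 // sqr_ge0.
have Ca : (C%:~R : 'F_p) = a by exact: ca.
have Db : (D%:~R : 'F_p) = b by exact: dp.
have ly : (l%:~R : 'F_p) = y by rewrite /l rmorphD /= !rmorphXn /= Ca Db.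
have [t tE] := Fp_nat ((x - m0%:~R) / y).
exists (m0 + t%:Z * l), l, (k0 + 2 * m0 * t%:Z + t%:Z ^+ 2 * l); split=> //.
  transitivity ((m0 + t%:Z * l) ^+ 2 + (u * C + v * D) ^+ 2); last by rewrite uv expr1n.
  by rewrite /k0 /m0 /l; move: (t%:Z) => s; ring.
have tE' : ((t%:Z)%:~R : 'F_p) = (x - m0%:~R) / y by exact: tE.
by rewrite rmorphD rmorphM /= ly tE' divfK // addrC subrK.
Qed.

(** If one of the two squares is 0, the other one is -1 and is split with the rational
    point (4/5, 3/5) of the unit circle; here p > 5 is used. *)
Lemma neg1_two_squares : (7 <= p)%N ->
  exists x y : 'F_p, [/\ x != 0, y != 0 & x ^+ 2 + y ^+ 2 = -1].
Proof.
move=> p7; have [x [y xy]] := sum_two_squares (-1).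
have nz (n : nat) : (0 < n < p)%N -> (n%:R : 'F_p) != 0.
  move=> /andP[n0 np]; rewrite -(dvdn_pcharf (pchar_Fp prp)).
  by apply/negP => /(dvdn_leq n0); rewrite leqNgt np.
have n3 : (3%:R : 'F_p) != 0 by apply: nz; lia.
have n4 : (4%:R : 'F_p) != 0 by apply: nz; lia.
have n5 : (5%:R : 'F_p) != 0 by apply: nz; lia.
have rot (z : 'F_p) : z ^+ 2 = -1 -> exists x y : 'F_p,
    [/\ x != 0, y != 0 & x ^+ 2 + y ^+ 2 = -1].
  move=> z2; have z0 : z != 0.
    apply: contra_eq_neq z2 => ->; rewrite expr0n eq_sym oppr_eq0; exact: oner_neq0.
  exists (4%:R / 5%:R * z), (3%:R / 5%:R * z); split.
  - by rewrite !mulf_neq0 ?invr_eq0.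
  - by rewrite !mulf_neq0 ?invr_eq0.
  - have -> : (4%:R / 5%:R * z) ^+ 2 + (3%:R / 5%:R * z) ^+ 2 = z ^+ 2 by field.
    exact: z2.
have [x0|x0] := eqVneq x 0; first by apply: (rot y); rewrite -xy x0 expr0n add0r.
have [y0|y0] := eqVneq y 0; first by apply: (rot x); rewrite -xy y0 expr0n addr0.
by exists x, y.
Qed.

End TwoSquares.

(** The elements of order 4, up to sign. A matrix and its opposite act in the same way;
    the sign condition chooses the one for which [elliptic2_fixed] has a simple formula. *)
Definition elliptic2 (g : SL2Z) := val g 1 1 = - val g 0 0 /\ 0 < val g 1 0.

Lemma elliptic2_S : elliptic2 sl2S.
Proof. by split; rewrite /= !mxE //= oppr0. Qed.

Lemma matrix2P (T : Type) (A B : 'M[T]_2) : A 0 0 = B 0 0 -> A 0 1 = B 0 1 ->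
  A 1 0 = B 1 0 -> A 1 1 = B 1 1 -> A = B.
Proof.
move=> h1 h2 h3 h4; apply/matrixP => i j.
have ord2 (l : 'I_2) : l = 0 \/ l = 1.
  by case: l => [[|[|l]] hl] //; [left|right]; exact: val_inj.
by case: (ord2 i) => ->; case: (ord2 j) => ->.
Qed.

Lemma elliptic2_det g : elliptic2 g ->
  val g 0 0 ^+ 2 + val g 0 1 * val g 1 0 = -1.
Proof.
move=> [tr _]; have := detS g; rewrite det2E tr => e.
by apply: oppr_inj; rewrite opprK -[RHS]e; ring.
Qed.

Lemma elliptic2_ex (m l k : int) : 0 < l -> k * l = m ^+ 2 + 1 ->
  exists2 g, elliptic2 g & [/\ val g 0 0 = m, val g 0 1 = - k & val g 1 0 = l].
Proof.
move=> l0 kl; pose M : 'M[int]_2 := \matrix_(i, j) if i == 0 then (if j == 0 then m else - k)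
   else (if j == 0 then l else - m).
have dM : \det M = 1.
  rewrite det2E !mxE /=; have -> : m * - m - - k * l = k * l - m ^+ 2 by ring.
  by rewrite kl addrC addKr.
by exists (toSL2Z dM); [split|split]; rewrite /= !mxE.
Qed.

Lemma elliptic2_involution g (R : realType) (x : hstar R) : elliptic2 g ->
  moebius_act g (moebius_act g x) = x.
Proof.
move=> eg; have dg := elliptic2_det eg; have [tr _] := eg.
have N1 : val g *m val g = - 1%:M.
  apply: matrix2P; rewrite mulmx2E !mxE /= ?tr.
  - by rewrite -expr2 dg.
  - by rewrite oppr0; ring.
  - by rewrite oppr0; ring.
  - by rewrite -dg; ring.
rewrite -moebius_actM; apply: val_inj; rewrite /= N1.
case: (hpt x) => [z|]; rewrite /moebius !mxE /= oppr0 ?eqxx //.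
rewrite mul0r add0r rmorphN oppr_eq0 oner_eq0 /= addr0.
by rewrite mulN1r invrN1 mulrN1 opprK.
Qed.

(** For the matrix with rows (m, b) and (l, -m) it is (m + i) / l. *)
Lemma elliptic2_fixed g (R : realType) : elliptic2 g ->
  exists z : Cx R, [/\ 0 < imag z, mob g z = z & den g z ^+ 2 = -1].
Proof.
move=> eg; have dg := elliptic2_det eg; have [tr l0] := eg.
pose m : R := (val g 0 0)%:~R; pose l : R := (val g 1 0)%:~R; pose b : R := (val g 0 1)%:~R.
have lR : 0 < l by rewrite ltr0z.
have e : m ^+ 2 + b * l = -1.
  by rewrite /m /b /l -rmorphXn -rmorphM -rmorphD /= dg rmorphN1.
pose z : Cx R := (m / l) +i* l^-1.
have z0 : 0 < imag z by rewrite /imag /= invr_gt0.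
have E00 : ent R g 0 0 = m%:C by rewrite ent_real.
have E10 : ent R g 1 0 = l%:C by rewrite ent_real.
have E01 : ent R g 0 1 = b%:C by rewrite ent_real.
have E11 : ent R g 1 1 = (- m)%:C by rewrite ent_real tr rmorphN.
have dz : den g z = 'i%C.
  rewrite /den E10 E11 /z; simpc.
  by rewrite mulrC divfK ?gt_eqF // subrr mulfV ?gt_eqF.
have i2 : ('i%C : Cx R) ^+ 2 = -1 by rewrite sqr_i.
exists z; split=> //; last by rewrite dz.
rewrite /mob dz E00 E01.
have i0 : ('i%C : Cx R) != 0.
  by apply/eqP => i0; move: i2; rewrite i0 expr0n /= => /eqP; rewrite eq_sym oppr_eq0 oner_eq0.
apply: (mulIf i0); rewrite divfK // /z; simpc; congr (_ +i* _).
have -> : b = (-1 - m ^+ 2) / l by rewrite -e addrC addKr mulfK ?gt_eqF.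
by field; rewrite gt_eqF.
Qed.

(** Let x^2 + y^2 = -1 modulo p. Modulo p, the matrices g with rows (x, y), (y, -x) and
    h with rows (-y, x), (x, y) satisfy S g = h. As x and y are nonzero, [elliptic_lift]
    lifts both g and h to integral matrices of trace 0 and determinant 1. *)
Lemma klein_four p : prime p -> (7 <= p)%N ->
  exists g h, [/\ elliptic2 g, elliptic2 h & residue p (smul sl2S g) = residue p h].
Proof.
move=> prp p7; have p4 : (4 < p)%N by apply: leq_trans p7.
have [x [y [x0 y0 xy]]] := neg1_two_squares prp p4 p7.
have [m [l [k [l0 kl mx ly]]]] := elliptic_lift prp p4 x y0.
have [m' [l' [k' [l'0 kl' mx' ly']]]] := elliptic_lift prp p4 (- y) x0.
have [g eg [g00 g01 g10]] := elliptic2_ex l0 kl.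
have [h eh [h00 h01 h10]] := elliptic2_ex l'0 kl'.
have Z (a b : int) : (a%:~R : 'F_p) = b%:~R -> (a%:~R : 'Z_p) = b%:~R.
  move=> ab; apply/eqP; rewrite -subr_eq0 -rmorphB /= (Zp_int0 p4).
  by rewrite -(Fp_int0 prp) rmorphB /= ab subrr.
have [tg _] := eg; have [th _] := eh.
have kF (u v w : int) (s t : 'F_p) : t != 0 -> s ^+ 2 + t ^+ 2 = -1 ->
    w * v = u ^+ 2 + 1 -> u%:~R = s -> v%:~R = t -> (w%:~R : 'F_p) = - t.
  move=> t0 st wv us vt; apply: (mulIf t0); rewrite -{1}vt -rmorphM /= wv.
  rewrite rmorphD rmorphXn /= us mulNr -expr2.
  have -> : s ^+ 2 = -1 - t ^+ 2 by rewrite -st addrK.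
  by rewrite addrC addrA subrr add0r.
have kE := kF m l k x y y0 xy kl mx ly.
have yx : (- y) ^+ 2 + x ^+ 2 = -1 by rewrite sqrrN addrC.
have kE' := kF m' l' k' (- y) x x0 yx kl' mx' ly'.
exists g, h; split=> //; apply: matrix2P; rewrite [LHS]mxE [RHS]mxE;
  apply: Z; rewrite /= mulmx2E !mxE /= ?tg ?th ?h00 ?h01 ?h10 ?g00 ?g01 ?g10.
- by rewrite mul0r add0r mulN1r rmorphN /= ly mx'.
- by rewrite mul0r add0r mulN1r opprK rmorphN /= kE' opprK mx.
- by rewrite mul1r mul0r addr0 mx ly'.
- by rewrite mul1r mul0r addr0 !rmorphN /= kE mx'.
Qed.

(** * The invariant theta characteristic is even *)

Local Close Scope complex_scope.
Local Close Scope ring_scope.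
Local Close Scope classical_set_scope.

Theorem mainTheorem2 (R : realType) (p : nat) (L : cocycle (modular_curve R p)) :
  prime p -> 7 <= p ->
  theta_characteristic L -> aut_invariant L ->
  exists n : nat, h0 L n /\ ~~ odd n.
Proof.
move=> prp p7 [bL [T [T_hol T_neq0 T_change]]] invL.
have p4 : (4 < p)%N by apply: leq_trans p7.
have [g [h [eg eh gh]]] := klein_four prp p7.
have T_hol' (i : bundle_idx L) (c : bundle_idx (canonical_bundle (modular_curve R p))) x :
    bundle_dom i x -> chart_dom (sval c) x -> hol_at (T i c) x.
  by move=> ix cx; have /holomorphic_onP := T_hol i c; apply.
have E := (@even_h0 R (modular_curve R p) (@modular_regular R p p4) (@modular_charts R p p4)
  (@modular_holomorphic_id R p p4) (@modular_discs R p p4) (@modular_compact R p p4)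
  (@modular_connected R p) L bL T T_hol' T_neq0 T_change
  (hX sl2S) (hX g) (hX h) invL (@hX_smooth R p p4 sl2S) (@hX_smooth R p p4 g) (@hX_smooth R p p4 h)).

apply: E.
- by move=> x; rewrite hX_comp; have [y ->] := pr_surj x; rewrite !hX_pr; exact: pr_congr gh.
have H e : elliptic2 e -> (forall x : modular_curve R p, hX e (hX e x) = x) /\
    exists (x : modular_curve R p) c, [/\ hX e x = x, atlas c, chart_dom c x &
      map_deriv (S := modular_curve R p) (hX e) c c x = (-1)%R].
  move=> ee; split.
    move=> x; have [y ->] := pr_surj x.
    by rewrite !hX_pr elliptic2_involution.
  have [z [z0 gz dz]] := elliptic2_fixed R ee.
  exact: (@hX_fixed_point R p p4 e z z0 gz dz).
by move=> k [->|[->|->]]; apply: H => //; exact: elliptic2_S.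
Qed.
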